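(* There exist exactly two non-isomorphic irreducible $\mathbb{Z}_2$-twisted modules over the Ising model SVOA $L(\frac12,0)\oplus L(\frac12,\frac12)$, namely $L(\frac12,\frac1{16})^+$ and $L(\frac12,\frac1{16})^-$.
   Context: Base field $\mathbb{C}$; $\mathbb{N}=\{0,1,2,\dots\}$. $L(c,h)$ is the irreducible highest weight Virasoro module of central charge $c$ and highest weight $h$. The Ising model SVOA. $\mathcal{A}_\psi$ is the algebra generated by $\psi_k$, $k\in\mathbb{Z}+\frac12$, with $\psi_m\psi_n+\psi_n\psi_m=\delta_{m+n,0}$. $M$ is the $\mathcal{A}_\psi$-module induced from the one-dimensional module $\mathbb{C}\mathbf{1}$ of the subalgebra generated by $\psi_k$, $k>0$, on which these act as $0$. The vectors $\psi_{-n_1+\frac12}\cdots\psi_{-n_k+\frac12}\mathbf{1}$ with integers $n_1>\cdots>n_k>0$, $k\ge0$, form a basis; the span of those with $k$ even (resp. odd) is $L(\frac12,0)$ (resp. $L(\frac12,\frac12)$). $M=L(\frac12,0)\oplus L(\frac12,\frac12)$ carries the unique vertex operator superalgebra (SVOA) structure with vacuum $\mathbf{1}$, Virasoro vector $\frac12\psi_{-\frac32}\psi_{-\frac12}\mathbf{1}$, even part $L(\frac12,0)$, odd part $L(\frac12,\frac12)$ and $Y(\psi_{-\frac12}\mathbf{1},z)=\sum_{n\in\mathbb{Z}}\psi_{n+\frac12}z^{-n-1}$. The modules $L(\frac12,\frac1{16})^\pm$. $\mathcal{A}_\phi$ is the algebra generated by $\phi_n$, $n\in\mathbb{Z}$,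 with $\phi_m\phi_n+\phi_n\phi_m=\delta_{m+n,0}$; $N$ is the $\mathcal{A}_\phi$-module induced from the one-dimensional module $\mathbb{C}v_0$ of the subalgebra generated by $\phi_n$, $n>0$, on which these act as $0$. The operators $L_n'=\frac1{16}\delta_{n,0}+\frac12\sum_{k>-n/2}(n+2k)\phi_{-k}\phi_{n+k}$ give a Virasoro representation of central charge $\frac12$ on $N$. Put $v^\pm_{1/16}=\phi_0v_0\pm\frac1{\sqrt2}v_0$, so that $\phi_0v^\pm_{1/16}=\pm\frac1{\sqrt2}v^\pm_{1/16}$. $L(\frac12,\frac1{16})^\pm\subset N$ is the Virasoro submodule generated by $v^\pm_{1/16}$ (it is an $\mathcal{A}_\phi$-submodule, isomorphic to $L(\frac12,\frac1{16})$ as Virasoro module), and $N=L(\frac12,\frac1{16})^+\oplus L(\frac12,\frac1{16})^-$. Each of them is a $\mathbb{Z}_2$-twisted module over the Ising model SVOA by restriction of the twisted module structure on $N$ determined by $Y_N(\psi_{-\frac12}\mathbf{1},z)=\phi(z)=\sum_{n\in\mathbb{Z}}\phi_nz^{-n-1/2}$. $\mathbb{Z}_2$-twisted modules. For an SVOA $V=V^0\oplus V^1$, put $q(a)=i$ for $a\in V^i$, and $p(a,b)=1$ if $a,b\in V^1$, $p(a,b)=0$ for other $\mathbb{Z}_2$-homogeneous $a,b$. A $\mathbb{Z}_2$-twisted $V$-module is a pair $(W,Y_W)$ consisting of an $\mathbb{N}$-graded vector space $W=\bigoplus_{n\in\mathbb{N}}W(n)$ and a linear map $Y_W(\cdot,z):V\to\mathrm{End}(W)[[z^{1/2},z^{-1/2}]]$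 such that: (i) for $a\in V^i$, $Y_W(a,z)=\sum_{n\in\frac{i}{2}+\mathbb{Z}}a_nz^{-n-1}$; (ii) $a_nw=0$ for $n$ sufficiently large; (iii) $Y_W(\mathbf{1},z)=\mathrm{id}_W$; (iv) $a_nW(s)\subset W(s+\mathrm{wt}(a)-n-1)$; (v) for all $\mathbb{Z}_2$-homogeneous $a,b\in V$, $$z_0^{-1}\delta\Big(\frac{z_1-z_2}{z_0}\Big)Y_W(a,z_1)Y_W(b,z_2)-(-1)^{p(a,b)}z_0^{-1}\delta\Big(\frac{-z_2+z_1}{z_0}\Big)Y_W(b,z_2)Y_W(a,z_1)=z_2^{-1}\delta\Big(\frac{z_1-z_0}{z_2}\Big)\Big(\frac{z_1-z_0}{z_2}\Big)^{-q(a)/2}Y_W(Y(a,z_0)b,z_2),$$ where $\delta(z)=\sum_{n\in\mathbb{Z}}z^n$ and binomials are expanded in nonnegative powers of the second variable. *)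

(* Defs.v *)
From HB Require Import structures.
From mathcomp Require Import all_boot all_order all_algebra finmap complex.
From mathcomp Require Import all_classical all_reals.
From mathcomp Require Import zify.

Set Implicit Arguments.
Unset Strict Implicit.
Unset Printing Implicit Defensive.
Import Order.TTheory GRing.Theory Num.Theory.
Local Open Scope classical_set_scope.
Local Open Scope ring_scope.

Section Subspaces.
Context {K : fieldType} {V : lmodType K}.

Definition subspace (U : set V) : Prop := submod_closed [in U].

Record subsp := Subsp { subsp_set :> set V; subspP : subspace subsp_set }.

Definition subsp_pred (U : subsp) : {pred V} := [in subsp_set U].

HB.instance Definition _ (U : subsp) :=
  GRing.isSubmodClosed.Build K V (subsp_pred U)
    (GRing.submod_closed_semi (subspP U)).

Inductive subsp_type (U : subsp) : Type :=
  SubspElt (v : V) of v \in subsp_pred U.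

Definition subsp_val (U : subsp) (x : subsp_type U) : V :=
  let: SubspElt v _ := x in v.

HB.instance Definition _ (U : subsp) := [isSub for @subsp_val U].
HB.instance Definition _ (U : subsp) := [Choice of subsp_type U by <:].
HB.instance Definition _ (U : subsp) :=
  [SubChoice_isSubLmodule of subsp_type U by <:].

End Subspaces.
Arguments subsp {K} V.


Section LinearAlgebra.
Context {K : fieldType} {V : lmodType K}.

Lemma subspace_smallest (P : set V -> Prop) (A : set V) :
  (forall U, P U -> subspace U) -> subspace (smallest P A).
Proof.
move=> hP; split=> [|c u v].
  by rewrite inE => U /= [/hP[+ _] _]; rewrite inE.
rewrite !inE => hu hv U /= [hU AU]; have [_ /(_ c u v)] := hP _ hU.
by rewrite !inE; apply; [exact: hu | exact: hv].
Qed.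

Definition span (A : set V) : set V := smallest subspace A.

Definition direct_sum (I : choiceType) (U : I -> set V) : Prop :=
  [/\ forall i, subspace (U i),
      forall v, exists (s : seq I) (f : I -> V),
        (forall i, U i (f i)) /\ v = \sum_(i <- s) f i &
      forall (s : seq I) (f : I -> V), uniq s -> (forall i, U i (f i)) ->
        \sum_(i <- s) f i = 0 -> forall i, i \in s -> f i = 0].

Definition finite_dim (U : set V) : Prop :=
  exists s : seq V, U `<=` span [set` s].

Definition eigensp (f : V -> V) (c : K) : set V := [set v | f v = c *: v].

End LinearAlgebra.

Definition gbinom {K : fieldType} (x : K) (j : nat) : K :=
  (\prod_(i < j) (x - i%:R)) / (j`!)%:R.

(* The coset i/2 + Z, where i = 0 for false (even) and i = 1 for true (odd). *)
Definition hcoset (i : bool) : set rat :=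
  [set n | n - (i : nat)%:R / 2 \is a Num.int].

Section SVOA.
Context {K : numClosedFieldType}.

(* [sv_Y a n b] is a_n b, where Y(a, z) = \sum_n a_n z^(-n-1).  All sums over
   j in nat below have finitely many nonzero terms, by truncation. *)
Record svoa (V : lmodType K) := SVOA {
  sv_par : bool -> set V;
  sv_vac : V;
  sv_vir : V;
  sv_c : K;
  sv_Y : V -> int -> V -> V;
  sv_linl : forall n b, linear (fun a => sv_Y a n b);
  sv_linr : forall a n, linear (sv_Y a n);
  sv_trunc : forall a b, exists n0 : int, forall n, n0 <= n -> sv_Y a n b = 0;
  sv_par_sum : direct_sum sv_par;
  sv_vac_even : sv_par false sv_vac;
  sv_vir_even : sv_par false sv_vir;
  sv_Y_par : forall i j a b n, sv_par i a -> sv_par j b ->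
    sv_par (i (+) j) (sv_Y a n b);
  sv_vacuum : forall n b, sv_Y sv_vac n b = if n == -1 then b else 0;
  sv_create : forall a n, 0 <= n -> sv_Y a n sv_vac = 0;
  sv_create1 : forall a, sv_Y a (-1) sv_vac = a;
  (* Coefficient of z0^(-l-1) z1^(-m-1) z2^(-n-1) in
     z0^-1 delta((z1-z2)/z0) Y(a,z1) Y(b,z2) c
       - (-1)^p(a,b) z0^-1 delta((-z2+z1)/z0) Y(b,z2) Y(a,z1) c
       = z2^-1 delta((z1-z0)/z2) Y(Y(a,z0)b,z2) c. *)
  sv_jacobi : forall i1 i2 a b c (l m n : int), sv_par i1 a -> sv_par i2 b ->
    \sum_(j \in [set: nat])
      ((-1) ^+ j * gbinom l%:~R j *: sv_Y a (l + m - j%:Z) (sv_Y b (n + j%:Z) c))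
    - (-1) ^+ (i1 && i2) *: \sum_(j \in [set: nat])
      ((-1) ^ (l + j%:Z) * gbinom l%:~R j
         *: sv_Y b (l + n - j%:Z) (sv_Y a (m + j%:Z) c))
    = \sum_(j \in [set: nat])
      (gbinom m%:~R j *: sv_Y (sv_Y a (l + j%:Z) b) (m + n - j%:Z) c);
  (* L_n = (sv_vir)_(n+1). *)
  sv_virasoro : forall (m n : int) v,
    sv_Y sv_vir (m + 1) (sv_Y sv_vir (n + 1) v)
    - sv_Y sv_vir (n + 1) (sv_Y sv_vir (m + 1) v)
    = (m - n)%:~R *: sv_Y sv_vir (m + n + 1) v
      + ((m + n == 0)%:R * (m ^+ 3 - m)%:~R / 12 * sv_c) *: v;
  sv_deriv : forall a n b,
    sv_Y (sv_Y sv_vir 0 a) n b = - n%:~R *: sv_Y a (n - 1) b;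
  sv_wt_sum : direct_sum (fun d : rat => eigensp (sv_Y sv_vir 1) (ratr d));
  sv_wt_par : forall i, sv_par i =
    span (\bigcup_(d in hcoset i) eigensp (sv_Y sv_vir 1) (ratr d));
  sv_wt_fin : forall d : rat, finite_dim (eigensp (sv_Y sv_vir 1) (ratr d));
  sv_wt_bound : exists d0 : rat, forall d : rat, d < d0 ->
    eigensp (sv_Y sv_vir 1) (ratr d) `<=` [set 0] }.

Definition weight_space (V : lmodType K) (S : svoa V) (d : rat) : set V :=
  eigensp (sv_Y S (sv_vir S) 1) (ratr d).

(* W(e) for a grading W(0), W(1), ... and any rational e: it is {0} unless e is
   a natural number. *)
Definition graded_piece (W : lmodType K) (gr : nat -> set W) (e : rat) : set W :=
  [set w | w = 0 \/ exists2 t : nat, e = t%:R & gr t w].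

(* [tw_Y a n w] is a_n w, where Y_W(a, z) = \sum_n a_n z^(-n-1), n in (1/2)Z. *)
Record twisted_module (V : lmodType K) (S : svoa V) (W : lmodType K) :=
  TwistedModule {
  tw_gr : nat -> set W;
  tw_Y : V -> rat -> W -> W;
  tw_gr_sum : direct_sum tw_gr;
  tw_linl : forall n w, linear (fun a => tw_Y a n w);
  tw_linr : forall a n, linear (tw_Y a n);
  tw_par : forall i a n w, sv_par S i a -> ~ hcoset i n -> tw_Y a n w = 0;
  tw_trunc : forall a w, exists n0 : rat, forall n, n0 <= n -> tw_Y a n w = 0;
  tw_vacuum : forall n w, tw_Y (sv_vac S) n w = if n == -1 then w else 0;
  tw_gr_Y : forall d a n s w, weight_space S d a -> tw_gr s w ->
    graded_piece tw_gr (s%:R + d - n - 1) (tw_Y a n w);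
  (* Coefficient of z0^(-l-1) z1^(-m-1) z2^(-n-1), with m in q(a)/2 + Z and
     n in q(b)/2 + Z, in the twisted Jacobi identity.  On the right, the terms
     z2^(-s-1) (z1-z0)^s, s in -q(a)/2 + Z, of
     z2^-1 delta((z1-z0)/z2) ((z1-z0)/z2)^(-q(a)/2) contribute with
     s = j - m - 1, and (-1)^j binom(j-m-1, j) = binom(m, j).  The remaining
     exponents occur on neither side, by [tw_par]. *)
  tw_jacobi : forall i1 i2 a b w (l : int) (m n : rat),
    sv_par S i1 a -> sv_par S i2 b -> hcoset i1 m -> hcoset i2 n ->
    \sum_(j \in [set: nat])
      ((-1) ^+ j * gbinom l%:~R j
         *: tw_Y a (l%:~R + m - j%:R) (tw_Y b (n + j%:R) w))
    - (-1) ^+ (i1 && i2) *: \sum_(j \in [set: nat])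
      ((-1) ^ (l + j%:Z) * gbinom l%:~R j
         *: tw_Y b (l%:~R + n - j%:R) (tw_Y a (m + j%:R) w))
    = \sum_(j \in [set: nat])
      (gbinom (ratr m) j *: tw_Y (sv_Y S a (l + j%:Z) b) (m + n - j%:R) w) }.

Section TwistedModules.
Variables (V : lmodType K) (S : svoa V).

Definition irreducible (W : lmodType K) (T : twisted_module S W) : Prop :=
  (exists w : W, w != 0) /\
  forall U : set W, subspace U -> (forall a n w, U w -> U (tw_Y T a n w)) ->
    U = [set 0] \/ U = setT.

(* Isomorphisms need not respect the gradings: these are not determined by the
   action, as they can be shifted. *)
Definition isomorphic (W1 W2 : lmodType K) (T1 : twisted_module S W1)
    (T2 : twisted_module S W2) : Prop :=
  exists f : {linear W1 -> W2}, bijective f /\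
    forall a n w, f (tw_Y T1 a n w) = tw_Y T2 a n (f w).

Definition is_restriction (W : lmodType K) (U : subsp W)
    (TU : twisted_module S (subsp_type U)) (T : twisted_module S W) : Prop :=
  (forall a n w, subsp_val (tw_Y TU a n w) = tw_Y T a n (subsp_val w)) /\
  (forall s w, tw_gr TU s w <-> tw_gr T s (subsp_val w)).

End TwistedModules.
End SVOA.

(* Model of the induced modules: fermionic Fock space with creation operators indexed by nat: finitely
   supported functions on finite subsets of nat, where the indicator of
   {n_1 > ... > n_k} stands for cre n_1 (... (cre n_k vac)); see [cre_vac]. *)
Section Fock.
Context (K : numClosedFieldType).
Implicit Types (S : {fset nat}) (k i j : nat).

Definition finsupp_set : set ({fset nat} -> K^o) :=
  [set f | finite_set [set S | f S != 0]].

Lemma finsupp_subspace : subspace finsupp_set.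
Proof.
split=> [|c f g]; rewrite !inE /finsupp_set /=.
  by rewrite (_ : [set S | _] = set0) // -subset0 => S /=; rewrite eqxx.
move=> hf hg; apply: (@sub_finite_set _ _ ([set S | f S != 0] `|` [set S | g S != 0])).
  move=> S /= h; apply/orP; apply: contraNT h; rewrite negb_or !negbK.
  by move=> /andP[/eqP f0 /eqP g0]; rewrite !fctE f0 g0 scaler0 addr0.
by rewrite finite_setU.
Qed.

Definition fock : lmodType K := subsp_type (Subsp finsupp_subspace).

Definition fval (u : fock) : {fset nat} -> K := subsp_val u.

Lemma fval_fin (u : fock) : finite_set [set S | fval u S != 0].
Proof. by case: u => f; rewrite /fval /= inE. Qed.

Lemma fvalP (u v : fock) : fval u =1 fval v -> u = v.
Proof. by move=> h; apply: val_inj; apply/funext. Qed.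

Lemma fvalD (u v : fock) S : fval (u + v) S = fval u S + fval v S.
Proof. by []. Qed.

Lemma fvalZ c (u : fock) S : fval (c *: u) S = c * fval u S.
Proof. by []. Qed.

Definition mk_fock (f : {fset nat} -> K) (hf : finite_set [set S | f S != 0]) : fock :=
  @SubspElt _ _ (Subsp finsupp_subspace) f (mem_set hf).

Definition nb_above k S : nat := #|` [fset j in S | (k < j)%N]%fset |.

Definition cre_fun k (f : {fset nat} -> K) S : K :=
  if k \in S then (-1) ^+ nb_above k S * f (S `\ k)%fset else 0.

Definition ann_fun k (f : {fset nat} -> K) S : K :=
  if k \in S then 0 else (-1) ^+ nb_above k S * f (k |` S)%fset.

Lemma cre_fin k u : finite_set [set S | cre_fun k (fval u) S != 0].
Proof.
apply: (sub_finite_set _ (finite_image (fun S => k |` S)%fset (fval_fin u))).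
move=> S /=; rewrite /cre_fun; case: ifP => [kS|]; last by rewrite eqxx.
by rewrite mulf_eq0 negb_or => /andP[_ h]; exists (S `\ k)%fset; rewrite // fsetD1K.
Qed.

Lemma ann_fin k u : finite_set [set S | ann_fun k (fval u) S != 0].
Proof.
apply: (sub_finite_set _ (finite_image (fun S => S `\ k)%fset (fval_fin u))).
move=> S /=; rewrite /ann_fun; case: ifPn => [|kS]; first by rewrite eqxx.
by rewrite mulf_eq0 negb_or => /andP[_ h]; exists (k |` S)%fset; rewrite // fsetU1K.
Qed.

Definition cre k (u : fock) : fock := mk_fock (cre_fin k u).
Definition ann k (u : fock) : fock := mk_fock (ann_fin k u).

Lemma ket_fin S : finite_set [set S' | (S' == S)%:R != 0 :> K].
Proof.
apply: (sub_finite_set _ (finite_set1 S)) => S' /=.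
by case: (S' =P S) => // _; rewrite eqxx.
Qed.

Definition ket S : fock := mk_fock (ket_fin S).

Definition fvac : fock := ket fset0.


Lemma nb_aboveU k i S : i \notin S ->
  nb_above k (i |` S)%fset = ((k < i)%N + nb_above k S)%N.
Proof.
move=> iS; rewrite /nb_above; case: (ltnP k i) => ki /=.
  rewrite -[RHS]/(1 + _)%N -(_ : (i \notin [fset j in S | (k < j)%N]%fset) = 1%N :> nat).
    rewrite -cardfsU1; congr (#|` _|); apply/fsetP => j; rewrite !inE /=.
    by case: eqP => //= ->; rewrite ki.
  by rewrite !inE /= (negbTE iS).
rewrite add0n; congr (#|` _|); apply/fsetP => j; rewrite !inE /=.
by case: eqP => //= ->; rewrite (negbTE iS) ltnNge ki.
Qed.

Lemma nb_aboveD k i S : i \in S ->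
  nb_above k S = ((k < i)%N + nb_above k (S `\ i)%fset)%N.
Proof. by move=> iS; rewrite -nb_aboveU ?fsetD1K // !inE eqxx. Qed.

Lemma fcre k u S : fval (cre k u) S = cre_fun k (fval u) S. Proof. by []. Qed.
Lemma fann k u S : fval (ann k u) S = ann_fun k (fval u) S. Proof. by []. Qed.

Lemma cre_linear k : linear (cre k).
Proof.
move=> c u v; apply: fvalP => S; rewrite fvalD fvalZ !fcre /cre_fun.
by case: ifP => _; rewrite ?mulr0 ?addr0 // fvalD fvalZ mulrDr mulrCA.
Qed.

Lemma ann_linear k : linear (ann k).
Proof.
move=> c u v; apply: fvalP => S; rewrite fvalD fvalZ !fann /ann_fun.
by case: ifP => _; rewrite ?mulr0 ?addr0 // fvalD fvalZ mulrDr mulrCA.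
Qed.

HB.instance Definition _ k :=
  GRing.isLinear.Build K fock fock _ (cre k) (cre_linear k).
HB.instance Definition _ k :=
  GRing.isLinear.Build K fock fock _ (ann k) (ann_linear k).

Lemma sign_sq (n : nat) (x : K) : (-1) ^+ n * ((-1) ^+ n * x) = x.
Proof. by rewrite mulrA -exprD addnn -mul2n exprM sqrrN expr1n expr1n mul1r. Qed.

Lemma sign_ltnC i j : i != j -> (-1) ^+ (i < j)%N = - (-1) ^+ (j < i)%N :> K.
Proof. by case: ltngtP; rewrite ?expr0 ?expr1 ?opprK. Qed.

Lemma cre_anticomm i j u : cre i (cre j u) + cre j (cre i u) = 0.
Proof.
apply: fvalP => S; rewrite fvalD !fcre /cre_fun !fcre /cre_fun.
rewrite !inE [j == i]eq_sym.
have [<-|ij] /= := eqVneq i j; first by rewrite mulr0 if_same addr0.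
case: (boolP (i \in S)) => iS; case: (boolP (j \in S)) => jS;
  rewrite ?mulr0 ?addr0 //.
rewrite !mulrA -!exprD (nb_aboveD i jS) (nb_aboveD j iS).
have -> : (S `\ j `\ i = S `\ i `\ j)%fset.
  by apply/fsetP => k; rewrite !inE; case: eqP; case: eqP.
rewrite [((j < i)%N + _ + _)%N]addnAC -mulrDl !exprD (sign_ltnC ij).
by rewrite !mulNr addNr mul0r.
Qed.

Lemma ann_anticomm i j u : ann i (ann j u) + ann j (ann i u) = 0.
Proof.
apply: fvalP => S; rewrite fvalD !fann /ann_fun !fann /ann_fun.
rewrite !inE [j == i]eq_sym.
have [<-|ij] /= := eqVneq i j; first by rewrite mulr0 if_same addr0.
case: (boolP (i \in S)) => iS; case: (boolP (j \in S)) => jS;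
  rewrite ?mulr0 ?addr0 //.
rewrite !mulrA -!exprD (nb_aboveU i jS) (nb_aboveU j iS).
have -> : (j |` (i |` S) = i |` (j |` S))%fset.
  by apply/fsetP => k; rewrite !inE orbCA.
rewrite [(nb_above i S + _)%N]addnCA [(nb_above j S + _)%N]addnCA.
rewrite [(nb_above j S + _)%N]addnC -mulrDl !exprD (sign_ltnC ij).
by rewrite !mulNr addrN mul0r.
Qed.

Lemma ann_cre_anticomm i j u :
  ann i (cre j u) + cre j (ann i u) = (i == j)%:R *: u.
Proof.
apply: fvalP => S; rewrite fvalD fvalZ !fann !fcre /ann_fun /cre_fun.
rewrite !fann !fcre /ann_fun /cre_fun !inE [j == i]eq_sym.
have [<-|ij] /= := eqVneq i j.
  rewrite mul1r; case: (boolP (i \in S)) => iS.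
    by rewrite add0r fsetD1K // (nb_aboveD i iS) ltnn add0n sign_sq.
  by rewrite addr0 fsetU1K // (nb_aboveU i iS) ltnn add0n sign_sq.
rewrite mul0r; case: (boolP (i \in S)) => iS; case: (boolP (j \in S)) => jS;
  rewrite ?mulr0 ?addr0 //.
rewrite !mulrA -!exprD (nb_aboveD i jS) (nb_aboveU j iS).
have -> : ((i |` S) `\ j = i |` (S `\ j))%fset.
  by apply/fsetP => k; rewrite !inE; case: (eqVneq k i) => //= ->; rewrite ij.
have e1 : ((i < j)%N + (j < i)%N = 1)%N by case: ltngtP ij.
rewrite -mulrDl addnACA e1 add1n exprS mulN1r addnC addNr mul0r //.
Qed.

Lemma cre_sq k u : cre k (cre k u) = 0.
Proof.
have /eqP := cre_anticomm k k u.
by rewrite -mulr2n -scaler_nat scaler_eq0 pnatr_eq0 => /eqP.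
Qed.

Lemma ann_sq k u : ann k (ann k u) = 0.
Proof.
have /eqP := ann_anticomm k k u.
by rewrite -mulr2n -scaler_nat scaler_eq0 pnatr_eq0 => /eqP.
Qed.

Lemma ann_vac k : ann k fvac = 0.
Proof.
apply: fvalP => S; rewrite fann /ann_fun; case: ifP => // _.
rewrite [fval _ _]/((_ == _)%:R) (_ : (_ == _) = false) ?mulr0 //.
by apply/eqP => /fsetP/(_ k); rewrite !inE eqxx.
Qed.

Lemma cre_ket n S : (forall m, m \in S -> (m < n)%N) ->
  cre n (ket S) = ket (n |` S)%fset.
Proof.
move=> hS; have nS : n \notin S by apply/negP => /hS; rewrite ltnn.
apply: fvalP => T; rewrite fcre /cre_fun.
rewrite [fval (ket S) _]/((_ == _)%:R) [fval (ket _) T]/((_ == _)%:R).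
case: ifPn => nT; last first.
  by case: eqP => // TE; move: nT; rewrite TE !inE eqxx.
have [TE|TS] := eqVneq (T `\ n)%fset S.
  rewrite -TE fsetD1K // eqxx (nb_aboveD n nT) ltnn add0n TE mulr1.
  rewrite /nb_above (_ : [fset j in S | (n < j)%N]%fset = fset0) ?cardfs0 //.
  by apply/fsetP => j; rewrite !inE; apply/negP => /andP[/= /hS]; rewrite ltnNge => /negP h /ltnW.
by rewrite mulr0; case: eqP => // TE; move: TS; rewrite TE fsetU1K ?eqxx.
Qed.

Lemma cre_vac (s : seq nat) : sorted gtn s ->
  foldr cre fvac s = ket [fset n in s]%fset.
Proof.
elim: s => [_|n s IH] /=.
  by congr ket; apply/fsetP => j; rewrite !inE.
move=> hs; rewrite IH; last exact: path_sorted hs.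
rewrite cre_ket => [|m].
  by congr ket; apply/fsetP => j; rewrite !inE.
rewrite !inE /= => ms.
by have /allP/(_ _ ms) := order_path_min (fun _ _ _ h1 h2 => ltn_trans h2 h1) hs.
Qed.

End Fock.

Section Ising.
Context (K : numClosedFieldType).

Definition fock_M : lmodType K := fock K.
Definition vac_M : fock_M := fvac K.

(* [psi r] is psi_(r+1/2): creation operator number k is psi_(-k-1/2), and
   annihilation operator number k is psi_(k+1/2). *)
Definition psi (r : int) : fock_M -> fock_M :=
  match r with Posz k => @ann K k | Negz k => @cre K k end.

Lemma psi_linear r : linear (psi r).
Proof. by case: r => k; [apply: ann_linear | apply: cre_linear]. Qed.

Lemma psi_anticomm (r s : int) u :
  psi r (psi s u) + psi s (psi r u) = (r + s + 1 == 0)%:R *: u.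
Proof.
case: r s => [r|r] [s|s]; rewrite /psi.
- by rewrite ann_anticomm (_ : (_ + _ + 1 == 0) = false) ?scale0r //; lia.
- by rewrite ann_cre_anticomm (_ : (_ + _ + 1 == 0) = (r == s)) //; lia.
- by rewrite addrC ann_cre_anticomm (_ : (_ + _ + 1 == 0) = (s == r)) //; lia.
- by rewrite cre_anticomm (_ : (_ + _ + 1 == 0) = false) ?scale0r //; lia.
Qed.

Lemma psi_vac (r : int) : 0 <= r -> psi r vac_M = 0.
Proof. by case: r => // k _; apply: ann_vac. Qed.

(* psi_(-n_1+1/2) ... psi_(-n_k+1/2) 1 for s = [:: n_1; ...; n_k]. *)
Definition psi_monomial (s : seq nat) : fock_M :=
  foldr (fun n => psi (- n%:Z)) vac_M s.

Definition omega_M : fock_M := 2^-1 *: psi (-2) (psi (-1) vac_M).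
Definition psi_state : fock_M := psi (-1) vac_M.

(* The defining properties of the unique SVOA structure of the Ising model on
   fock_M = L(1/2,0) + L(1/2,1/2). *)
Record ising_svoa (S : svoa fock_M) : Prop := IsingSvoa {
  ising_vac : sv_vac S = vac_M;
  ising_vir : sv_vir S = omega_M;
  ising_par : forall i, sv_par S i =
    span [set psi_monomial s | s in
           [set s | [/\ sorted gtn s, all (ltn 0) s & odd (size s) = i]]];
  ising_Y : forall n b, sv_Y S psi_state n b = psi n b }.

Definition fock_N : lmodType K := fock K.
Definition vac_N : fock_N := fvac K.

(* Here creation operator number k is phi_(-k); the self-paired generator phi_0
   is a combination of cre 0 and ann 0 with phi_0^2 = 1/2. *)
Definition phi (n : int) : fock_N -> fock_N :=
  match n with
  | Posz 0 => fun u => cre 0 u + 2^-1 *: ann 0 u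
  | Posz k => @ann K k
  | Negz k => @cre K k.+1
  end.

Lemma phi_linear n : linear (phi n).
Proof.
case: n => [[|k]|k]; [|exact: ann_linear|exact: cre_linear].
move=> c u v /=; rewrite !linearP !scalerDr !scalerA.
by rewrite addrACA.
Qed.

Lemma half_half : 1 = 2^-1 + 2^-1 :> K.
Proof. by rewrite [LHS](splitr 1) !mul1r. Qed.

Lemma phi_anticomm (m n : int) u :
  phi m (phi n u) + phi n (phi m u) = (m + n == 0)%:R *: u.
Proof.
wlog mn : m n / m <= n => [H|].
  have [/H //|/ltW /H] := leP m n.
  by rewrite addrC [n + m]addrC.
case: m n mn => [[|k]|k] [[|l]|l] //= kl;
  rewrite ?(linearD, linearZ) /= ?scalerDr ?scalerA.
- rewrite cre_sq ann_sq scaler0 add0r addr0 -scalerDr [X in 2^-1 *: X]addrC.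
  rewrite ann_cre_anticomm scale1r -scalerDl.
  by rewrite -half_half !scale1r.
- rewrite addrACA -scalerDr [cre _ _ + _]addrC ann_cre_anticomm ann_anticomm.
  by rewrite scaler0 scale0r addr0.
- by rewrite ann_anticomm scale0r.
- rewrite addrACA -scalerDr cre_anticomm add0r [cre _ _ + _]addrC.
  by rewrite ann_cre_anticomm !scale0r scaler0.
- rewrite addrC ann_cre_anticomm eqSS (_ : (_ + _ == 0) = (l == k)) //; lia.
- by rewrite cre_anticomm scale0r.
Qed.

Lemma phi_vac (n : int) : 0 < n -> phi n vac_N = 0.
Proof. by case: n => [[|k]|] // _; apply: ann_vac. Qed.

(* The sum over k > -n/2 has finitely many nonzero terms for each u. *)
Definition Lvir (n : int) (u : fock_N) : fock_N :=
  ((n == 0)%:R / 16) *: u +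
  2^-1 *: \sum_(k \in [set k : int | - n < k * 2])
    ((n + 2 * k)%:~R *: phi (- k) (phi (n + k) u)).

(* v^+ for s = 1 and v^- for s = -1. *)
Definition v16 (s : K) : fock_N := phi 0 vac_N + (s / sqrtC 2) *: vac_N.

Definition Lvir_submodule (U : set fock_N) : Prop :=
  subspace U /\ forall n u, U u -> U (Lvir n u).

Lemma L16_subspace s : subspace (smallest Lvir_submodule [set v16 s]).
Proof. by apply: subspace_smallest => U []. Qed.

(* L(1/2,1/16)^+ for s = 1 and L(1/2,1/16)^- for s = -1. *)
Definition L16 (s : K) : subsp fock_N := Subsp (L16_subspace s).

End Ising.

(* Main.v *)
Require Import Defs.
From HB Require Import structures.
From mathcomp Require Import all_boot all_order all_algebra finmap complex.
From mathcomp Require Import all_classical all_reals.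
From mathcomp Require Import zify ring lra.

Set Implicit Arguments.
Unset Strict Implicit.
Unset Printing Implicit Defensive.
Import Order.TTheory GRing.Theory Num.Theory.
Local Open Scope classical_set_scope.
Local Open Scope ring_scope.

(* A Z_2-twisted module is governed by its Ramond modes phi_r, the modes of
   psi = psi_(-1/2) 1: the Jacobi identity for (psi, b) expresses the modes of
   psi_k b through those of b and the phi_r.  On N this recursion is taken as the
   definition of the field of psi_k b, and the Jacobi identity for (a, b) passes to
   (a, psi_k b) by commuting the residue operators R attached to a and to psi.

   The point about L16 is its stability under the phi_r.  The L_n are the modes of
   omega up to scalars, so a Virasoro submodule is stable under the modes of every
   combination of omega_(-1) omega and T^2 omega, in particular of
   psi_(-7/2) psi_(-1/2) 1.  The commutator of its degree-zero mode with phi_r is a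
   cubic polynomial in r times phi_r, so iterated commutators with L_n, n <> 0,
   separate by a Vandermonde argument the bilinears phi_(-k) phi_(n+k).  As phi_0
   is a scalar on the generator, these bilinears yield all phi_r.

   In an irreducible twisted module a nonzero vector of least degree is killed by
   the phi_r, r > 0; splitting it under phi_0, where phi_0^2 = 1/2, gives the image
   of v^+ or v^- under a morphism from N, which restricts to an isomorphism. *)

(** * Sums with finitely many nonzero terms and generalized binomials *)

Section LocallyFiniteSums.
Context {K : fieldType}.
Implicit Types V W : lmodType K.

(** The Jacobi identity for (psi, b) never isolates psi_k b: since t^m with m half-integral has an
    infinite expansion around z, psi_k b comes with a tail psi_(k+1) b, psi_(k+2) b, ... Truncation
    ends the tail, which explains the recurring descent in k from the truncation bound. On N the
    tail is inverted once and for all by expanding t^(1/2) around z; the resulting operators [Psi k]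
    on local fields satisfy the anticommutation relations of the psi_k, so the universal property of
    the Fock space yields a field for every state with nothing left to check.

    For L16 the obstacle is that [L_0, phi_r] = -r phi_r is linear in r: every term phi_(-k)
    phi_(n+k) of L_n has the same eigenvalue -n, so commutators with L_0 cannot tell the terms
    apart. A cubic can, and weight 4 is where it becomes available. Being odd, it still cancels on
    the terms of L_0, whence the restriction to n <> 0; this is harmless because phi_r phi_0 with r
    <> 0 has n = r. *)

Definition fsupp V (F : nat -> V) := exists B, forall j, (B <= j)%N -> F j = 0.

Definition fsupp2 V (F : nat -> nat -> V) :=
  exists B, forall i j, (B <= i + j)%N -> F i j = 0.

(** A finitely supported sum takes the default value 0 when its support is infinite, so [lsum] is
    additive only under [fsupp]; hence the side conditions throughout. *)
Definition lsum V (F : nat -> V) : V := \sum_(j \in [set: nat]) F j.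

Lemma lsumE V B (F : nat -> V) :
  (forall j, (B <= j)%N -> F j = 0) -> lsum F = \sum_(j < B) F j.
Proof.
move=> h; rewrite /lsum (@fsbig_ord V 0 +%R B F); apply/esym/fsbig_widen => //= j [_ /=].
by move=> /negP; rewrite -leqNgt => /h.
Qed.

Lemma eq_lsum V (F G : nat -> V) : F =1 G -> lsum F = lsum G.
Proof. by move=> h; congr lsum; apply/funext. Qed.

Lemma lsum0 V (F : nat -> V) : (forall j, F j = 0) -> lsum F = 0.
Proof. by move=> h; rewrite (@lsumE _ 0) ?big_ord0. Qed.

Lemma fsupp_weaken V (F : nat -> V) B0 : fsupp F ->
  exists2 B, (B0 <= B)%N & forall j, (B <= j)%N -> F j = 0.
Proof.
case=> B h; exists (maxn B0 B); first exact: leq_maxl.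
by move=> j; rewrite geq_max => /andP[_ /h].
Qed.

Lemma fsuppD V (F G : nat -> V) : fsupp F -> fsupp G -> fsupp (fun j => F j + G j).
Proof.
move=> [B h] [C h']; exists (maxn B C) => j; rewrite geq_max => /andP[/h -> /h' ->].
by rewrite addr0.
Qed.

Lemma fsupp_sub V W (F : nat -> V) (G : nat -> W) :
  fsupp F -> (forall j, F j = 0 -> G j = 0) -> fsupp G.
Proof. by move=> [B h] h'; exists B => j /h/h'. Qed.

Lemma fsuppZ V (c : nat -> K) (F : nat -> V) : fsupp F -> fsupp (fun j => c j *: F j).
Proof. by move=> /fsupp_sub; apply=> j ->; rewrite scaler0. Qed.

Lemma fsuppZc V (c : K) (F : nat -> V) : fsupp F -> fsupp (fun j => c *: F j).
Proof. exact: (@fsuppZ V (fun=> c)). Qed.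

Lemma fsuppN V (F : nat -> V) : fsupp F -> fsupp (fun j => - F j).
Proof. by move=> /fsupp_sub; apply=> j ->; rewrite oppr0. Qed.

Lemma lsumD V (F G : nat -> V) : fsupp F -> fsupp G ->
  lsum (fun j => F j + G j) = lsum F + lsum G.
Proof.
move=> hF /(fsupp_weaken 0)[C _ hC]; have [B CB hB] := fsupp_weaken C hF.
have {}hC j : (B <= j)%N -> G j = 0 by move=> /(leq_trans CB)/hC.
by rewrite !(@lsumE _ B) ?big_split // => j jB; rewrite hB ?hC ?addr0.
Qed.

Lemma lin0 V W (f : V -> W) : linear f -> f 0 = 0.
Proof. by move=> fl; have := fl (-1) 0 0; rewrite !scaleN1r oppr0 addr0 addNr. Qed.

Lemma linD V W (f : V -> W) x y : linear f -> f (x + y) = f x + f y.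
Proof. by move=> fl; rewrite -{1}[x]scale1r fl scale1r. Qed.

Lemma linZ V W (f : V -> W) c x : linear f -> f (c *: x) = c *: f x.
Proof. by move=> fl; rewrite -[c *: x]addr0 fl (lin0 fl) addr0. Qed.

Lemma linN V W (f : V -> W) x : linear f -> f (- x) = - f x.
Proof. by move=> fl; rewrite -scaleN1r linZ // scaleN1r. Qed.

Lemma linB V W (f : V -> W) x y : linear f -> f (x - y) = f x - f y.
Proof. by move=> fl; rewrite linD // linN. Qed.

Lemma lsum_lin V W (f : V -> W) (F : nat -> V) : linear f -> fsupp F ->
  f (lsum F) = lsum (fun j => f (F j)).
Proof.
move=> fl; have f0 := lin0 fl.
move=> [B hB]; rewrite !(@lsumE _ B) //; last by move=> j /hB ->.
by elim/big_rec2: _ => // i y1 y2 _ <-; rewrite linD.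
Qed.

Lemma lin_raddf V W (f : V -> W) (I : Type) (r : seq I) (P : pred I) (F : I -> V) :
  linear f -> f (\sum_(i <- r | P i) F i) = \sum_(i <- r | P i) f (F i).
Proof.
move=> fl; have f0 := lin0 fl.
by elim/big_rec2: _ => // i y1 y2 _ <-; rewrite linD.
Qed.

Lemma lsumZ V c (F : nat -> V) : fsupp F -> lsum (fun j => c *: F j) = c *: lsum F.
Proof.
move=> h; rewrite (@lsum_lin _ _ (fun x => c *: x)) // => a x y.
by rewrite scalerDr !scalerA mulrC.
Qed.

Lemma lsumN V (F : nat -> V) : fsupp F -> lsum (fun j => - F j) = - lsum F.
Proof. by move=> h; rewrite (@lsum_lin _ _ (fun x => - x)) // => a x y; rewrite opprD scalerN. Qed.

Lemma lsumB V (F G : nat -> V) : fsupp F -> fsupp G ->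
  lsum (fun j => F j - G j) = lsum F - lsum G.
Proof. by move=> h h'; rewrite lsumD ?lsumN //; apply: fsuppN. Qed.

Lemma lsum_sum V (I : finType) (F : I -> nat -> V) : (forall i, fsupp (F i)) ->
  lsum (fun j => \sum_i F i j) = \sum_i lsum (F i).
Proof.
move=> hF; have [B hB] : exists B, forall i j, (B <= j)%N -> F i j = 0.
  have /choice[B hB] := hF; exists (\max_i B i) => i j ij.
  by apply: hB; apply: leq_trans ij; apply: leq_bigmax.
rewrite (@lsumE _ B) => [|j jB]; last by apply: big1 => i _; apply: hB.
by rewrite exchange_big; apply: eq_bigr => i _; rewrite (@lsumE _ B) //; apply: hB.
Qed.

Lemma lsum_recl V (F : nat -> V) : fsupp F -> lsum F = F 0%N + lsum (fun j => F j.+1).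
Proof.
move=> [B hB]; rewrite (@lsumE _ B.+1) => [|j jB]; last by apply: hB; lia.
by rewrite big_ord_recl (@lsumE _ B (fun j => F j.+1)) // => j jB; apply: hB; lia.
Qed.

(** Padding with d leading zeros does not change the sum, and it lets series that start at different
    indices be collected under one index. *)
Definition delay V d (F : nat -> V) s := if (d <= s)%N then F (s - d)%N else 0.

Lemma delay_fsupp V d (F : nat -> V) : fsupp F -> fsupp (delay d F).
Proof.
case=> B hB; exists (d + B)%N => s h; rewrite /delay; case: ifP => // ds.
by apply: hB; lia.
Qed.

Lemma lsum_delay V d (F : nat -> V) : fsupp F -> lsum (delay d F) = lsum F.
Proof.
move=> fF; elim: d => [|d IH]; first by apply: eq_lsum => s; rewrite /delay subn0.
by rewrite lsum_recl ?add0r; [exact: IH | exact: delay_fsupp].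
Qed.

Lemma lsum_single V (F : nat -> V) i : (forall j, j != i -> F j = 0) -> lsum F = F i.
Proof.
move=> h; rewrite (@lsumE _ i.+1) => [|j ij]; last by apply: h; lia.
rewrite big_ord_recr big1 /= ?add0r // => j _; apply: h.
by have := ltn_ord j; lia.
Qed.

Lemma fsupp2W V W (F : nat -> nat -> V) (G : nat -> nat -> W) :
  fsupp2 F -> (forall i j, F i j = 0 -> G i j = 0) -> fsupp2 G.
Proof. by move=> [B hB] h; exists B => i j /hB/h. Qed.

(** Truncation of a field is only pointwise: the bound in j depends on the vector acted on, hence on
    i. Joint finiteness holds because only the rows i < B matter and their bounds have a maximum. *)
Lemma fsupp2_nested V (F : nat -> nat -> V) B :
  (forall i j, (B <= i)%N -> F i j = 0) -> (forall i, fsupp (F i)) -> fsupp2 F.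
Proof.
move=> h1 /choice[C hC]; exists (B + \max_(i < B) C i)%N => i j ij.
have [Bi|iB] := leqP B i; first exact: h1.
apply: hC; have := leq_bigmax (F := fun i : 'I_B => C i) (Ordinal iB).
by move: ij; set M := (\max_(_ < B) _)%N => /= ij h; lia.
Qed.

Lemma fsupp2C V (F : nat -> nat -> V) : fsupp2 F -> fsupp2 (fun i j => F j i).
Proof. by case=> B hB; exists B => i j; rewrite addnC; apply: hB. Qed.

Lemma fsupp2_row V (F : nat -> nat -> V) i : fsupp2 F -> fsupp (F i).
Proof. by case=> B hB; exists B => j h; apply: hB; lia. Qed.

Lemma fsupp2_lsum V (F : nat -> nat -> V) : fsupp2 F -> fsupp (fun i => lsum (F i)).
Proof. by case=> B hB; exists B => i h; apply: lsum0 => j; apply: hB; lia. Qed.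

Lemma lsum_antidiag V (F : nat -> nat -> V) : fsupp2 F ->
  lsum (fun i => lsum (F i)) = lsum (fun s => \sum_(i < s.+1) F i (s - i)%N).
Proof.
case=> B hB; rewrite (@lsumE _ B); last by move=> i h; apply: lsum0 => j; apply: hB; lia.
rewrite (@lsumE _ B) => [|s h]; last first.
  by apply: big1 => i _; apply: hB; have := ltn_ord i; lia.
transitivity (\sum_(i < B) \sum_(j < (B - i)%N) F i j).
  by apply: eq_bigr => i _; apply: lsumE => j h; apply: hB; lia.
elim: B {hB} => [|B IH]; first by rewrite !big_ord0.
rewrite [RHS]big_ord_recr /= -IH [\sum_(i < B.+1) F i _]big_ord_recr /= addrA.
rewrite -big_split /= big_ord_recr /= subSnn big_ord1 subnn; congr (_ + _).
by apply: eq_bigr => i _; rewrite subSn ?big_ord_recr //= ltnW.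
Qed.

(** Both iterated sums are sums over antidiagonals, on which the exchange is the reversal i -> s -
    i. *)
Lemma lsum_exchange V (F : nat -> nat -> V) : fsupp2 F ->
  lsum (fun i => lsum (F i)) = lsum (fun j => lsum (fun i => F i j)).
Proof.
move=> h; rewrite !lsum_antidiag //; last exact: fsupp2C.
apply: eq_lsum => s; rewrite (reindex_inj rev_ord_inj) /=.
by apply: eq_bigr => i _; rewrite subSS subKn // -ltnS.
Qed.

End LocallyFiniteSums.

Section Binomials.
Context {K : numFieldType}.
Implicit Types (x y : K) (i j n : nat).

Lemma gbinom0 x : gbinom x 0 = 1.
Proof. by rewrite /gbinom big_ord0 fact0 divr1. Qed.

Lemma gbinomS x j : j.+1%:R * gbinom x j.+1 = (x - j%:R) * gbinom x j.
Proof.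
rewrite /gbinom big_ord_recr /= factS natrM.
have h : j.+1%:R != 0 :> K by rewrite pnatr_eq0.
have h' : (j`!)%:R != 0 :> K by rewrite pnatr_eq0 -lt0n fact_gt0.
by field; rewrite nat1r h h'.
Qed.

Lemma natSI j x y : j.+1%:R * x = j.+1%:R * y -> x = y.
Proof. by apply: mulfI; rewrite pnatr_eq0. Qed.

Lemma gbinomSE x j : gbinom x j.+1 = (x - j%:R) / j.+1%:R * gbinom x j.
Proof.
apply: (@natSI j); rewrite gbinomS.
have h : j.+1%:R != 0 :> K by rewrite pnatr_eq0.
by field; rewrite nat1r.
Qed.

Lemma gbinom1 x : gbinom x 1 = x.
Proof. by rewrite gbinomSE gbinom0 subr0 divr1 mulr1. Qed.

Lemma gbinom0S j : gbinom (0 : K) j = (j == 0%N)%:R.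
Proof.
elim: j => [|j IH]; first by rewrite gbinom0.
by rewrite gbinomSE IH; case: j {IH} => [|j]; rewrite ?subrr ?mul0r ?mulr0.
Qed.

Lemma gbinomDS x j : gbinom (x + 1) j.+1 = gbinom x j.+1 + gbinom x j.
Proof.
elim: j => [|j IH]; first by rewrite !gbinom1 gbinom0.
rewrite gbinomSE IH (gbinomSE x j.+1) (gbinomSE x j).
have h : j.+1%:R != 0 :> K by rewrite pnatr_eq0.
have h' : j.+2%:R != 0 :> K by rewrite pnatr_eq0.
field; rewrite nat1r (_ : 2 + j%:R = j.+2%:R) ?h ?h' //.
by rewrite -natrD; congr _%:R; lia.
Qed.

Lemma gbinom_Vandermonde x y n :
  \sum_(i < n.+1) gbinom x i * gbinom y (n - i) = gbinom (x + y) n.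
Proof.
elim: n => [|n IH]; first by rewrite big_ord1 !gbinom0 mulr1.
apply: (@natSI n); rewrite gbinomS -IH !mulr_sumr.
pose G i := (x - i%:R) * (gbinom x i * gbinom y (n - i)).
pose H i := (y - (n - i)%N%:R) * (gbinom x i * gbinom y (n - i)).
transitivity (\sum_(i < n.+1) G i + \sum_(i < n.+1) H i); last first.
  rewrite -big_split; apply: eq_bigr => i _; rewrite /G /H natrB 1?leq_ord //=; ring.
(* The factor n + 1 is split as i + (n + 1 - i), while x + y - n was split as (x - i) + (y - (n -
   i)); [gbinomS] matches the halves, the first one after an index shift. *)
transitivity (\sum_(i < n.+2) i%:R * (gbinom x i * gbinom y (n.+1 - i))
            + \sum_(i < n.+2) (n.+1 - i)%N%:R * (gbinom x i * gbinom y (n.+1 - i))).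
  rewrite -big_split; apply: eq_bigr => i _; rewrite /= -mulrDl -natrD subnKC //.
  by rewrite -ltnS.
congr (_ + _).
  rewrite big_ord_recl mul0r add0r; apply: eq_bigr => i _.
  by rewrite lift0 subSS mulrA gbinomS -mulrA.
rewrite big_ord_recr /= subnn mul0r addr0; apply: eq_bigr => i _.
by rewrite subSn ?leq_ord // mulrCA gbinomS mulrCA.
Qed.

Lemma gbinom_fall x i j :
  gbinom x i * gbinom (x - i%:R) j = (\prod_(k < (i + j)%N) (x - k%:R)) / (i`! * j`!)%:R.
Proof.
rewrite /gbinom big_split_ord /= natrM invfM.
rewrite mulrACA; congr (_ * _ * _); apply: eq_bigr => k _ /=.
by rewrite natrD opprD addrA.
Qed.

Lemma trinomial x i j :
  gbinom x i * gbinom (x - i%:R) j = gbinom x j * gbinom (x - j%:R) i.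
Proof. by rewrite !gbinom_fall addnC mulnC. Qed.

Lemma gbinom_absorb x j : (x - j%:R) * gbinom x j = x * gbinom (x - 1) j.
Proof. by have := trinomial x 1 j; rewrite !gbinom1 => ->; rewrite mulrC. Qed.

Lemma gbinom_nat n i : gbinom (n%:R : K) i = 'C(n, i)%:R.
Proof.
elim: n i => [|n IH] [|i]; rewrite ?gbinom0 ?bin0 ?gbinom0S //.
by rewrite -natr1 gbinomDS !IH binS natrD.
Qed.

Lemma trinomialD x d e : gbinom x (d + e) * gbinom (d + e)%:R d
  = gbinom x d * gbinom (x - d%:R) e.
Proof.
have fn0 k : (k`!)%:R != 0 :> K by rewrite pnatr_eq0 -lt0n fact_gt0.
rewrite gbinom_fall gbinom_nat /gbinom -(@bin_fact (d + e) d) ?leq_addr // addKn.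
rewrite !natrM; have h : 'C(d + e, d)%:R != 0 :> K.
  by rewrite pnatr_eq0 -lt0n bin_gt0 leq_addr.
by field; rewrite h !fn0.
Qed.

Lemma gbinom_neg x i : (-1) ^+ i * gbinom x i = gbinom (i%:R - 1 - x) i.
Proof.
rewrite /gbinom mulrA; congr (_ / _).
rewrite -[i in (-1) ^+ i]card_ord -prodr_const -big_split /=.
rewrite (reindex_inj rev_ord_inj) /=; apply: eq_bigr => j _.
by rewrite natrB // -natr1; ring.
Qed.

Lemma gbinom_small n i : (n < i)%N -> gbinom (n%:R : K) i = 0.
Proof. by move=> h; rewrite gbinom_nat bin_small. Qed.

(* The coefficients of t^q (t-z)^k in its expansion at infinity; [binom_zero]
   is the analogue at 0. *)
Lemma binom_infty x (k q : K) c s :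
  \sum_(i < s.+1) gbinom x (s - i) * gbinom k i * gbinom (k + q - i%:R) c
  = \sum_(d < c.+1) gbinom q (c - d) * gbinom k d * gbinom (x + k - d%:R) s.
Proof.
transitivity (\sum_(i < s.+1) \sum_(d < c.+1)
  gbinom q (c - d) * gbinom k d * (gbinom (k - d%:R) i * gbinom x (s - i))).
  (* Vandermonde for (k - i) + q introduces d; [trinomial] then turns the product of binomials in k
     and k - i into one in k and k - d, so that the sum over i is again a Vandermonde
     convolution. *)
  apply: eq_bigr => i _; rewrite addrAC -gbinom_Vandermonde mulr_sumr.
  apply: eq_bigr => d _; rewrite -mulrA [gbinom k i * _]mulrA trinomial; ring.
rewrite exchange_big; apply: eq_bigr => d _; rewrite -mulr_sumr gbinom_Vandermonde.
by congr (_ * gbinom _ _); ring.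
Qed.

Lemma binom_zero x (k q : K) c s :
  \sum_(i < s.+1) gbinom x (s - i) * gbinom k i * gbinom (q + i%:R) c
  = \sum_(d < c.+1 | (d <= s)%N)
      gbinom q (c - d) * gbinom k d * gbinom (x + k - d%:R) (s - d).
Proof.
transitivity (\sum_(i < s.+1) \sum_(d < c.+1) gbinom q (c - d) *
  (gbinom x (s - i) * (gbinom k i * gbinom i%:R d))).
  apply: eq_bigr => i _; rewrite addrC -gbinom_Vandermonde mulr_sumr.
  by apply: eq_bigr => d _; ring.
rewrite exchange_big [RHS]big_mkcond; apply: eq_bigr => d _; rewrite -mulr_sumr.
case: ifPn => [ds|]; last first.
  rewrite -ltnNge => sd; rewrite big1 ?mulr0 // => i _.
  by rewrite gbinom_small ?mulr0 //; have := ltn_ord i; lia.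
rewrite -mulrA; congr (_ * _).
have -> : x + k - d%:R = (k - d%:R) + x by ring.
rewrite -gbinom_Vandermonde mulr_sumr -subSn // -!(big_mkord xpredT
  (fun i => gbinom x (s - i) * (gbinom k i * gbinom i%:R d))) -!(big_mkord xpredT
  (fun i => gbinom k d * (gbinom (k - d%:R) i * gbinom x (s - d - i)))).
rewrite (@big_cat_nat _ _ _ d) //=; last by lia.
rewrite [X in X + _]big1_seq ?add0r => [|i]; last first.
  by rewrite mem_index_iota => /andP[_ h]; rewrite gbinom_small ?mulr0.
rewrite -[X in \sum_(X <= _ < _) _]add0n big_addn; apply: eq_bigr => i _.
by rewrite addnC trinomialD -subnDA; ring.
Qed.

(** Pascal's rule for the right-hand side of the Jacobi identity, reflecting t = (t - z) + z. The
    left-hand side obeys the same relation, see [R_rec], so agreement of the two sides spreads from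
    a few exponents to all. *)
Lemma lsum_binom_rec (V : lmodType K) (G : int -> rat -> V) (l0 l : int) (q n : rat) :
  (forall (l : int) (z : rat), l0 <= l -> G l z = 0) ->
  lsum (fun j : nat => gbinom (ratr (q + 1)) j *: G (l + j%:Z) (q + 1 + n - j%:R))
  = lsum (fun j : nat => gbinom (ratr q) j *: G (l + 1 + j%:Z) (q + n - j%:R))
  + lsum (fun j : nat => gbinom (ratr q) j *: G (l + j%:Z) (q + (n + 1) - j%:R)).
Proof.
move=> hG; have fs (x : nat -> K) (y : nat -> rat) l' : fsupp (fun j : nat => x j *: G (l' + j%:Z) (y j)).
  by exists `|(l0 - l')%R|%N => j hj; rewrite hG ?scaler0 //; lia.
rewrite (lsum_recl (fs _ (fun j : nat => q + 1 + n - j%:R) l)).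
rewrite (lsum_recl (fs _ (fun j : nat => q + (n + 1) - j%:R) l)).
rewrite [RHS]addrCA -lsumD; first last.
- by exists `|(l0 - l)%R|%N => j hj; rewrite hG ?scaler0 //; lia.
- exact: fs.
congr (_ + _); first by rewrite !gbinom0 (_ : q + 1 + n = q + (n + 1)) //; ring.
apply: eq_lsum => j; rewrite rmorphD rmorph1 gbinomDS scalerDl addrC.
have -> : l + j.+1%:Z = l + 1 + j%:Z by lia.
have -> : q + 1 + n - j.+1%:R = q + n - j%:R by rewrite -natr1; ring.
by have -> : q + (n + 1) - j.+1%:R = q + n - j%:R by rewrite -natr1; ring.
Qed.

End Binomials.

(** * Residue operators *)

Section Fields.
Context {K : numFieldType} {N : lmodType K} (P : N -> N).
Hypotheses (P_lin : linear P) (PK : involutive P).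
Implicit Types (X A B : rat -> N -> N) (w : N) (i : bool) (l k : int) (m q n : rat).

Definition good X :=
  (forall n, linear (X n)) /\
  (forall w, exists n0 : rat, forall n, n0 <= n -> X n w = 0).

(** Conjugation by the parity P stands in for the sign (-1)^p(a,b): it multiplies a field of parity
    i' by (-1)^(i i'). The residue operators can thus be applied to X without knowing that X is
    homogeneous. *)
Definition th i X n w := if i then P (X n (P w)) else X n w.

Definition R1 A m l X n w : N :=
  lsum (fun j : nat => ((-1) ^+ j * gbinom l%:~R j)
    *: A (l%:~R + m - j%:R) (X (n + j%:R) w)).

Definition R2 i A m l X n w : N :=
  lsum (fun j : nat => ((-1) ^ (l + j%:Z) * gbinom l%:~R j)
    *: th i X (l%:~R + n - j%:R) (A (m + j%:R) w)).

(* The coefficients of Res (t^m (t - z)^l A(t)) X(z), expanded at t = infinity,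
   minus those of the same expression with A acting first, expanded at t = 0. *)
Definition R i A m l X n w := R1 A m l X n w - R2 i A m l X n w.

Lemma trunc_nat X n w : good X -> exists b : nat, forall j, (b <= j)%N -> X (n + j%:R) w = 0.
Proof.
case=> _ /(_ w)[n0 h]; have := archi_boundP (normr_ge0 (n0 - n)).
set b := Num.bound _ => hb; exists b => j jb; apply: h.
rewrite -lerBlDl (le_trans (ler_norm _)) // (le_trans (ltW hb)) //.
by rewrite ler_nat.
Qed.

Lemma good_th i X : good X -> good (th i X).
Proof.
case: i => // -[lX tX]; split=> [n c u v|w].
  by rewrite /th P_lin lX P_lin.
by have [n0 h] := tX (P w); exists n0 => n /h; rewrite /th => ->; rewrite lin0.
Qed.

Lemma thth i i' X : th i (th i' X) = th (i (+) i') X.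
Proof.
by apply/funext => n; apply/funext => w; case: i i' => [] []; rewrite /th //= !PK.
Qed.

Lemma R1_fsupp A m l X n w : (forall n, linear (A n)) -> good X ->
  fsupp (fun j : nat => ((-1) ^+ j * gbinom l%:~R j : K)
    *: A (l%:~R + m - j%:R) (X (n + j%:R) w)).
Proof.
move=> lA /(@trunc_nat _ n w)[B hB]; exists B => j /hB ->.
by rewrite (lin0 (lA _)) scaler0.
Qed.

Lemma R2_fsupp i A m l X n w : good A -> (forall n, linear (X n)) ->
  fsupp (fun j : nat => ((-1) ^ (l + j%:Z) * gbinom l%:~R j : K)
    *: th i X (l%:~R + n - j%:R) (A (m + j%:R) w)).
Proof.
move=> /(@trunc_nat _ m w)[B hB] lX; exists B => j /hB ->.
by rewrite /th (lin0 P_lin) (lin0 (lX _)) (lin0 P_lin) if_same scaler0.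
Qed.

Lemma good_R1 A m l X : (forall n, linear (A n)) -> good X -> good (R1 A m l X).
Proof.
move=> lA gX; split=> [n c u v|w].
  have fs u' := R1_fsupp m l n u' lA gX.
  rewrite /R1 -lsumZ // -lsumD //; last exact: fsuppZc.
  apply: eq_lsum => j; rewrite (proj1 gX) lA scalerDr !scalerA.
  by congr (_ *: _ + _); rewrite mulrC.
have [n0 h] := proj2 gX w; exists n0 => n nn; apply: lsum0 => j.
by rewrite h ?(lin0 (lA _)) ?scaler0 // (le_trans nn) // lerDl ler0n.
Qed.

Lemma good_R2 i A m l X : good A -> good X -> good (R2 i A m l X).
Proof.
move=> gA gX; have gtX := good_th i gX; split=> [n c u v|w].
  have fs u' := R2_fsupp i m l n u' gA (proj1 gX).
  rewrite /R2 -lsumZ // -lsumD //; last exact: fsuppZc.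
  apply: eq_lsum => j; rewrite (proj1 gA) (proj1 gtX) scalerDr !scalerA.
  by congr (_ *: _ + _); rewrite mulrC.
have [B hB] := trunc_nat m w gA.
have /choice[nn hn] := fun j : nat => proj2 gtX (A (m + j%:R) w).
(* Only the vectors A (m + j) w with j < B are nonzero. The sum of the absolute values dominates
   each of their bounds, B absorbs the shift by j, and l is compensated. *)
exists (\sum_(j < B) `|nn j| + B%:R - l%:~R) => n h; apply: lsum0 => j.
have [Bj|jB] := leqP B j; first by rewrite hB // (lin0 (proj1 gtX _)) scaler0.
rewrite hn ?scaler0 //; rewrite lerBlDr in h.
apply: le_trans (_ : \sum_(j < B) `|nn j| <= _); last first.
  by rewrite lerBrDr [l%:~R + n]addrC; apply: le_trans h; rewrite lerD2l ler_nat ltnW.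
rewrite (bigD1 (Ordinal jB)) //= (le_trans (ler_norm _)) // lerDl.
exact: sumr_ge0.
Qed.

Lemma goodD X Y : good X -> good Y -> good (fun n w => X n w + Y n w).
Proof.
move=> [lX tX] [lY tY]; split=> [n c u v|w].
  by rewrite lX lY scalerDr addrACA.
have [a ha] := tX w; have [b hb] := tY w; exists (Num.max a b) => n.
by rewrite ge_max => /andP[/ha -> /hb ->]; rewrite addr0.
Qed.

Lemma goodZ c X : good X -> good (fun n w => c *: X n w).
Proof.
move=> [lX tX]; split=> [n d u v|w].
  by rewrite lX scalerDr !scalerA mulrC.
by have [a ha] := tX w; exists a => n /ha ->; rewrite scaler0.
Qed.

Lemma good_shift x X : good X -> good (fun n w => X (n + x) w).
Proof.
move=> [lX tX]; split=> [n|w] //.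
by have [a ha] := tX w; exists (a - x) => n h; apply: ha; rewrite -lerBlDr.
Qed.

Lemma good0 : good (fun _ _ => 0).
Proof. by split=> [n c u v|w]; [rewrite scaler0 addr0 | exists 0]. Qed.

Lemma good_sum (I : Type) (r : seq I) (p : pred I) (F : I -> rat -> N -> N) :
  (forall j, good (F j)) -> good (fun n w => \sum_(j <- r | p j) F j n w).
Proof.
move=> h; elim: r => [|j r IH].
  by rewrite (_ : (fun _ _ => _) = fun _ _ => 0);
     [exact: good0 | apply/funext => n; apply/funext => w; rewrite big_nil].
rewrite (_ : (fun _ _ => _) = fun n w =>
  (if p j then F j n w else 0) + \sum_(j <- r | p j) F j n w).
  by apply: goodD => //; case: (p j) => //; exact: good0.
by apply/funext => n; apply/funext => w; rewrite big_cons; case: ifP; rewrite ?add0r.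
Qed.

Lemma good_R i A m l X : good A -> good X -> good (R i A m l X).
Proof.
move=> gA gX; rewrite /R.
have -> : (fun n w => R1 A m l X n w - R2 i A m l X n w) =
   (fun n w => R1 A m l X n w + (-1) *: R2 i A m l X n w).
  by apply/funext => n; apply/funext => w; rewrite scaleN1r.
apply: goodD; first exact: good_R1 (proj1 gA) gX.
exact/goodZ/good_R2.
Qed.

Definition parity_op i A := forall n w, A n (P w) = (-1) ^+ i *: P (A n w).

Lemma th_R1 i i' B q k X n w : (forall n, linear (B n)) -> good X -> parity_op i' B ->
  th i (R1 B q k X) n w = (-1) ^+ (i && i') *: R1 B q k (th i X) n w.
Proof.
move=> lB gX hB; case: i; last by rewrite scale1r.
rewrite [in LHS]/th /R1 (lsum_lin P_lin); last exact: (R1_fsupp q k n (P w) lB gX).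
rewrite -lsumZ; last exact: (R1_fsupp q k n w lB (good_th true gX)).
apply: eq_lsum => j; rewrite /th hB (linZ _ _ P_lin) !scalerA.
by rewrite mulrAC -expr2 sqrr_sign mul1r.
Qed.

Lemma th_R2 i i' B q k X n w : good B -> good X -> parity_op i' B ->
  th i (R2 i' B q k X) n w = (-1) ^+ (i && i') *: R2 i' B q k (th i X) n w.
Proof.
move=> gB gX hB; have gtX := good_th i gX; case: i gtX => gtX; last by rewrite scale1r.
rewrite [in LHS]/th /R2 (lsum_lin P_lin); last exact: (R2_fsupp _ _ _ _ _ gB (proj1 gX)).
rewrite -lsumZ; last exact: (R2_fsupp _ _ _ _ _ gB (proj1 gtX)).
apply: eq_lsum => j; rewrite hB (linZ _ _ (proj1 (good_th i' gX) _)) !(linZ _ _ P_lin).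
by rewrite [LHS]scalerA [RHS]scalerA mulrC thth addbC -thth.
Qed.

Lemma th_R i i' B q k X n w : good B -> good X -> parity_op i' B ->
  th i (R i' B q k X) n w = (-1) ^+ (i && i') *: R i' B q k (th i X) n w.
Proof.
move=> gB gX pB; rewrite /R scalerBr -(th_R1 _ _ _ _ _ (proj1 gB) gX pB).
rewrite -(th_R2 _ _ _ _ _ gB gX pB) /th; case: i => //.
by rewrite (linB _ _ P_lin).
Qed.

Lemma R1R1_fsupp2 X (A' B' : rat -> N -> N) (f : nat -> nat -> K) (x y : nat -> nat -> rat) n w :
  (forall n, linear (A' n)) -> (forall n, linear (B' n)) -> good X ->
  fsupp2 (fun a b : nat =>
    f a b *: A' (x a b) (B' (y a b) (X (n + (a + b)%:R) w))).
Proof.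
move=> lA lB gX; have [b hb] := trunc_nat n w gX; exists b => a a' /hb ->.
by rewrite (lin0 (lB _)) (lin0 (lA _)) scaler0.
Qed.

Lemma R2R2_fsupp2 A B m q (Z : rat -> N -> N) (f : nat -> nat -> K) (x : nat -> nat -> rat) w :
  good A -> good B -> (forall n, linear (Z n)) ->
  fsupp2 (fun a b : nat => f a b *: Z (x a b) (B (q + b%:R) (A (m + a%:R) w))).
Proof.
move=> gA gB lZ; have [b hb] := trunc_nat m w gA; apply: (@fsupp2_nested _ _ _ b).
  by move=> a a' /hb ->; rewrite (lin0 (proj1 gB _)) (lin0 (lZ _)) scaler0.
move=> a; have [b' hb'] := trunc_nat q (A (m + a%:R) w) gB; exists b' => j /hb' ->.
by rewrite (lin0 (lZ _)) scaler0.
Qed.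

Lemma R1R1 A B m q l k X n w :
  (forall n, linear (A n)) -> (forall n, linear (B n)) -> good X ->
  R1 A m l (R1 B q k X) n w = lsum (fun a : nat => lsum (fun b : nat =>
    (((-1) ^+ a * gbinom l%:~R a) * ((-1) ^+ b * gbinom k%:~R b))
    *: A (l%:~R + m - a%:R) (B (k%:~R + q - b%:R) (X (n + (a + b)%:R) w)))).
Proof.
move=> lA lB gX; apply: eq_lsum => a; rewrite (lsum_lin (lA _)); last exact: (R1_fsupp q k (n + a%:R) w lB gX).
rewrite -lsumZ; last first.
  apply: fsupp_sub (R1_fsupp q k (n + a%:R) w lB gX) _ => b ->; exact: lin0.
by apply: eq_lsum => b; rewrite (linZ _ _ (lA _)) scalerA natrD addrA.
Qed.

Lemma R2R2 i i' A B m q l k X n w : good A -> good B -> good X -> parity_op i' B ->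
  R2 i A m l (R2 i' B q k X) n w = (-1) ^+ (i && i') *: lsum (fun a : nat => lsum (fun b : nat =>
    (((-1) ^ (l + a%:Z) * gbinom l%:~R a) * ((-1) ^ (k + b%:Z) * gbinom k%:~R b))
    *: th (i (+) i') X (l%:~R + k%:~R + n - (a + b)%:R) (B (q + b%:R) (A (m + a%:R) w)))).
Proof.
move=> gA gB gX pB; have gtX := good_th i gX; have gttX := good_th (i (+) i') gX.
have h2 f x := @R2R2_fsupp2 A B m q _ f x w gA gB (proj1 gttX).
rewrite -lsumZ; last exact: fsupp2_lsum.
apply: eq_lsum => a; rewrite th_R2 // scalerA mulrC -scalerA; congr (_ *: _).
rewrite /R2 -lsumZ; last exact: (R2_fsupp _ _ _ _ _ gB (proj1 gtX)).
apply: eq_lsum => b; rewrite scalerA thth addbC natrD; congr (_ *: th _ _ _ _).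
by ring.
Qed.

(** In the mixed terms B acts last and A first, with X between them, whichever residue is taken
    first. So A and B never have to be exchanged, and only the parity conjugation passing B leaves a
    sign. *)
Lemma cross i i' A B m q l k X n w : good A -> good B -> good X -> parity_op i' B ->
  R2 i A m l (R1 B q k X) n w = (-1) ^+ (i && i') *: R1 B q k (R2 i A m l X) n w.
Proof.
move=> gA gB gX pB; have gtX := good_th i gX.
transitivity ((-1) ^+ (i && i') *: lsum (fun a : nat => lsum (fun b : nat =>
   (((-1) ^ (l + a%:Z) * gbinom l%:~R a) * ((-1) ^+ b * gbinom k%:~R b))
   *: B (k%:~R + q - b%:R) (th i X (l%:~R + n - a%:R + b%:R) (A (m + a%:R) w))))).
  rewrite -lsumZ; last first.
    have [c hc] := trunc_nat m w gA; exists c => a /hc h; apply: lsum0 => b.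
    by rewrite h (lin0 (proj1 gtX _)) (lin0 (proj1 gB _)) scaler0.
  apply: eq_lsum => a; rewrite (th_R1 _ _ _ _ _ (proj1 gB) gX pB).
  rewrite scalerA mulrC -scalerA; congr (_ *: _); rewrite /R1 -lsumZ.
    by apply: eq_lsum => b; rewrite scalerA.
  exact: (R1_fsupp _ _ _ _ (proj1 gB) gtX).
congr (_ *: _); rewrite lsum_exchange; last first.
  have [c hc] := trunc_nat m w gA; apply: (@fsupp2_nested _ _ _ c) => [a b /hc ->|a].
    by rewrite (lin0 (proj1 gtX _)) (lin0 (proj1 gB _)) scaler0.
  have [c' hc'] := trunc_nat (l%:~R + n - a%:R) (A (m + a%:R) w) gtX.
  by exists c' => b /hc' ->; rewrite (lin0 (proj1 gB _)) scaler0.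
apply: eq_lsum => b; rewrite (lsum_lin (proj1 gB _)).
  rewrite -lsumZ.
    apply: eq_lsum => a; rewrite (linZ _ _ (proj1 gB _)) scalerA mulrC addrAC addrA.
    by congr (_ *: B _ (th _ _ _ _)); ring.
  apply: fsupp_sub (R2_fsupp i m l (n + b%:R) w gA (proj1 gX)) _ => a ->.
  exact: (lin0 (proj1 gB _)).
exact: (R2_fsupp i m l (n + b%:R) w gA (proj1 gX)).
Qed.

Section Commutator.
Variables (i i' : bool) (A B : rat -> N -> N) (C : nat -> rat -> N -> N) (c0 : nat).
Variables (m q : rat) (l k : int) (X : rat -> N -> N).
Hypotheses (gA : good A) (gB : good B) (gC : forall c, good (C c)) (gX : good X).
Hypotheses (pA : parity_op i A) (pB : parity_op i' B).
Hypothesis comm : forall (r s : int) w,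
  A (r%:~R + m) (B (s%:~R + q) w) - (-1) ^+ (i && i') *: B (s%:~R + q) (A (r%:~R + m) w)
  = \sum_(c < c0) gbinom (ratr (s%:~R + q)) c
       *: C c (r%:~R + m + (s%:~R + q) - c%:R) w.

Let comm_scaled x y w : (exists r : int, x = r%:~R + m) -> (exists r : int, y = r%:~R + q) ->
  A x (B y w) - (-1) ^+ (i && i') *: B y (A x w)
  = \sum_(c < c0) gbinom (ratr y) c *: C c (x + y - c%:R) w.
Proof. by move=> [r ->] [s ->]; apply: comm. Qed.

(** Leibniz rule: the divided c-th derivative of t^q (t - z)^k is the sum over d of [coef c d]
    t^(q-c+d) (t - z)^(k-d). *)
Let coef c d : K := gbinom (ratr q) (c - d) * gbinom k%:~R d.

Lemma R1_comm n w : R1 A m l (R1 B q k X) n w - (-1) ^+ (i && i') *: R1 B q k (R1 A m l X) n w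
  = \sum_(c < c0) \sum_(d < c.+1)
      coef c d *: R1 (C c) (m + q - (c - d)%N%:R) (l + k - d%:Z) X n w.
Proof.
have lA := proj1 gA; have lB := proj1 gB.
rewrite !R1R1 //.
pose f (b a : nat) : K := ((-1) ^+ b * gbinom k%:~R b) * ((-1) ^+ a * gbinom l%:~R a).
have fs1 := R1R1_fsupp2 f (fun a b : nat => k%:~R + q - a%:R)
  (fun a b : nat => l%:~R + m - b%:R) n w lB lA gX.
have fs2 := R1R1_fsupp2 (fun a b => f b a) (fun a b : nat => l%:~R + m - a%:R)
  (fun a b : nat => k%:~R + q - b%:R) n w lA lB gX.
transitivity (lsum (fun b : nat => lsum (fun a : nat => f b a *: \sum_(c < c0)
   gbinom (k%:~R + ratr q - b%:R) c *:
     C c (l%:~R + k%:~R + m + q - c%:R - (b + a)%:R) (X (n + (b + a)%:R) w)))).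
  transitivity (lsum (fun b : nat => lsum (fun a : nat => f b a *:
      A (l%:~R + m - a%:R) (B (k%:~R + q - b%:R) (X (n + (a + b)%:R) w))))
    - (-1) ^+ (i && i') *: lsum (fun b : nat => lsum (fun a : nat => f b a *:
      B (k%:~R + q - b%:R) (A (l%:~R + m - a%:R) (X (n + (b + a)%:R) w))))).
    congr (_ - _); rewrite lsum_exchange.
      by apply: eq_lsum => b; apply: eq_lsum => a; rewrite /f mulrC.
    by apply: fsupp2W fs2 _ => a b; rewrite /f mulrC.
  rewrite -lsumZ; last exact: fsupp2_lsum.
  rewrite -lsumB; first last.
  - exact/fsuppZc/fsupp2_lsum.
  - exact/fsupp2_lsum/(fsupp2C fs2).
  apply: eq_lsum => b; rewrite -lsumZ; last exact: fsupp2_row fs1.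
  rewrite -lsumB; first last.
  - exact/fsuppZc/(fsupp2_row _ fs1).
  - exact/(fsupp2_row _ (fsupp2C fs2)).
  apply: eq_lsum => a; rewrite [X in _ - X]scalerA [X in _ - X *: _]mulrC -[X in _ - X]scalerA -scalerBr [(b + a)%N]addnC.
  rewrite comm_scaled; first last.
  - by exists (k - b%:Z); rewrite intrB; ring.
  - by exists (l - a%:Z); rewrite intrB; ring.
  congr (_ *: _); apply: eq_bigr => c _; congr (_ *: C c _ _).
    by rewrite rmorphB /= rmorphD /= ratr_int ratr_nat; congr gbinom; ring.
  by rewrite natrD; ring.
have cC c d : fsupp (fun j : nat => ((-1) ^+ j * gbinom (l + k - d%:Z)%:~R j : K) *:
    C c ((l + k - d%:Z)%:~R + (m + q - (c - d)%N%:R) - j%:R) (X (n + j%:R) w)).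
  by have := R1_fsupp (m + q - (c - d)%N%:R) (l + k - d%:Z) n w (proj1 (gC c)) gX.
transitivity (lsum (fun s : nat => \sum_(c < c0) \sum_(d < c.+1)
  coef c d *: (((-1) ^+ s * gbinom (l + k - d%:Z)%:~R s) *:
   C c ((l + k - d%:Z)%:~R + (m + q - (c - d)%N%:R) - s%:R) (X (n + s%:R) w)))); last first.
  rewrite lsum_sum => [|c]; last first.
    have [b hb] := trunc_nat n w gX; exists b => s /hb ->.
    by apply: big1 => d _; rewrite (lin0 (proj1 (gC c) _)) !scaler0.
  apply: eq_bigr => c _; rewrite lsum_sum => [|d]; last exact: fsuppZc.
  by apply: eq_bigr => d _; rewrite lsumZ.
(* The indices of C and of X now depend on b + a only, so each antidiagonal carries a single vector;
   its scalar coefficient is evaluated by [binom_infty]. *)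
rewrite lsum_antidiag; last first.
  have [b hb] := trunc_nat n w gX; exists b => a a' /hb ->.
  by rewrite big1 ?scaler0 // => c _; rewrite (lin0 (proj1 (gC c) _)) scaler0.
apply: eq_lsum => s; under eq_bigr => b _ do rewrite scaler_sumr.
rewrite exchange_big; apply: eq_bigr => c _.
pose v := C c (l%:~R + k%:~R + m + q - c%:R - s%:R) (X (n + s%:R) w).
transitivity ((\sum_(b < s.+1) f b (s - b)%N * gbinom (k%:~R + ratr q - b%:R) c) *: v).
  rewrite scaler_suml; apply: eq_bigr => b _; rewrite scalerA /v.
  by rewrite subnKC // -ltnS.
transitivity ((\sum_(d < c.+1) coef c d * ((-1) ^+ s * gbinom (l + k - d%:Z)%:~R s)) *: v).
  congr (_ *: _); transitivity ((-1) ^+ s * (\sum_(b < s.+1)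
    gbinom l%:~R (s - b) * gbinom (k%:~R : K) b * gbinom (k%:~R + ratr q - b%:R) c)).
    rewrite mulr_sumr; apply: eq_bigr => b _.
    have -> : (-1) ^+ s = (-1) ^+ b * (-1) ^+ (s - b) :> K.
      by rewrite -exprD subnKC // -ltnS.
    by rewrite /f; ring.
  rewrite binom_infty mulr_sumr; apply: eq_bigr => d _; rewrite /coef intrB intrD.
  by ring.
rewrite scaler_suml; apply: eq_bigr => d _; rewrite scalerA; congr (_ *: C c _ _).
by rewrite intrB intrD natrB -1?ltnS //; ring.
Qed.

(** The minus sign appears because in [R2] the modes of A and B act before X, so that nesting
    reverses their order. The expansion is now at t = 0, and the scalar identity is [binom_zero]. *)
Lemma R2_comm n w : R2 i A m l (R2 i' B q k X) n w
    - (-1) ^+ (i && i') *: R2 i' B q k (R2 i A m l X) n w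
  = - \sum_(c < c0) \sum_(d < c.+1)
      coef c d *: R2 (i (+) i') (C c) (m + q - (c - d)%N%:R) (l + k - d%:Z) X n w.
Proof.
have lA := proj1 gA; have lB := proj1 gB; have gZ := good_th (i (+) i') gX.
set Z := th (i (+) i') X in gZ; have lZ := proj1 gZ.
rewrite !R2R2 //.
pose f (b a : nat) : K :=
  ((-1) ^ (k + b%:Z) * gbinom k%:~R b) * ((-1) ^ (l + a%:Z) * gbinom l%:~R a).
have fs1 := R2R2_fsupp2 m q (fun a b => f b a)
  (fun a b : nat => l%:~R + k%:~R + n - (a + b)%:R) w gA gB lZ.
have fs2 := R2R2_fsupp2 q m f
  (fun a b : nat => k%:~R + l%:~R + n - (a + b)%:R) w gB gA lZ.
pose z s c := Z (l%:~R + k%:~R + n - s%:R) (C c (m + q + s%:R - c%:R) w).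
transitivity (- lsum (fun b : nat => lsum (fun a : nat => f b a *: \sum_(c < c0)
   gbinom (ratr q + b%:R) c *: z (b + a)%N c))).
  transitivity ((-1) ^+ (i && i') *: lsum (fun b : nat => lsum (fun a : nat => f b a *:
      Z (l%:~R + k%:~R + n - (a + b)%:R) (B (q + b%:R) (A (m + a%:R) w))))
    - lsum (fun b : nat => lsum (fun a : nat => f b a *:
      Z (k%:~R + l%:~R + n - (b + a)%:R) (A (m + a%:R) (B (q + b%:R) w))))).
    congr (_ - _).
      congr (_ *: _); rewrite lsum_exchange.
        by apply: eq_lsum => b; apply: eq_lsum => a; rewrite /f mulrC.
      by apply: fsupp2W fs1 _ => a b; rewrite /f mulrC.
    by rewrite scalerA [i' && i]andbC -expr2 sqrr_sign scale1r [i' (+) i]addbC.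
  rewrite -[LHS]opprK opprB; congr (- _).
  rewrite -lsumZ; last exact/fsupp2_lsum/(fsupp2C fs1).
  rewrite -lsumB; first last.
  - exact/fsuppZc/fsupp2_lsum/(fsupp2C fs1).
  - exact/fsupp2_lsum/fs2.
  apply: eq_lsum => b; rewrite -lsumZ; last exact/(fsupp2_row _ (fsupp2C fs1)).
  rewrite -lsumB; first last.
  - exact/fsuppZc/(fsupp2_row _ (fsupp2C fs1)).
  - exact/(fsupp2_row _ fs2).
  apply: eq_lsum => a; rewrite [X in _ - X]scalerA [X in _ - X *: _]mulrC -[X in _ - X]scalerA -scalerBr [(a + b)%N]addnC.
  rewrite [k%:~R + _]addrC -(linZ _ _ (lZ _)) -(linB _ _ (lZ _)).
  rewrite comm_scaled; first last.
  - by exists b%:Z; rewrite addrC.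
  - by exists a%:Z; rewrite addrC.
  congr (_ *: _); rewrite (lin_raddf _ _ _ (lZ _)); apply: eq_bigr => c _.
  rewrite (linZ _ _ (lZ _)) rmorphD /= ratr_nat /z; congr (_ *: Z _ (C c _ _)).
  by rewrite natrD; ring.
have cC c d := R2_fsupp (i (+) i') (m + q - (c - d)%N%:R) (l + k - d%:Z) n w (gC c) (proj1 gX).
congr (- _).
transitivity (lsum (fun s : nat => \sum_(c < c0) \sum_(d < c.+1 | (d <= s)%N)
  (coef c d * ((-1) ^ (l + k + s%:Z) * gbinom (l + k - d%:Z)%:~R (s - d))) *: z s c)); last first.
  (* The summand of d starts only at s = d. Read as a delayed series it sums, for each d, to a
     complete [R2] with exponent l + k - d. *)
  transitivity (lsum (fun s : nat => \sum_(c < c0) \sum_(d < c.+1) coef c d *: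
     delay d (fun s : nat => ((-1) ^ (l + k - d%:Z + s%:Z) * gbinom (l + k - d%:Z)%:~R s) *:
       Z ((l + k - d%:Z)%:~R + n - s%:R) (C c (m + q - (c - d)%N%:R + s%:R) w)) s)).
    apply: eq_lsum => s; apply: eq_bigr => c _; rewrite big_mkcond; apply: eq_bigr => d _.
    rewrite /delay; case: ifP => ds; last by rewrite scaler0.
    rewrite scalerA /z; congr (_ * (_ * _) *: Z _ (C c _ w)).
    - have -> : l + k + s%:Z = l + k - d%:Z + (s - d)%N%:Z + (d%:Z + d%:Z) by lia.
      by rewrite expfzDr ?oppr_eq0 ?oner_eq0 // -PoszD addnn -mul2n -exprnP exprM sqrrN !expr1n mulr1.
    - by rewrite intrB intrD natrB //; ring.
    - by rewrite !natrB -1?ltnS //; ring.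
  rewrite lsum_sum => [|c].
    apply: eq_bigr => c _; rewrite lsum_sum => [|d].
      by apply: eq_bigr => d _; rewrite lsumZ ?lsum_delay //; exact: delay_fsupp.
    exact/fsuppZc/delay_fsupp.
  have /choice[b hb] := fun d => delay_fsupp d (cC c d).
  exists (\sum_(d < c.+1) b d)%N => s h; apply: big1 => d _.
  rewrite [delay _ _ _]hb ?scaler0 //; apply: leq_trans h.
  by rewrite (bigD1 d) //= leq_addr.
rewrite lsum_antidiag; last first.
  have /choice[b hb] := fun c => trunc_nat (m + q - c%:R) w (gC c).
  exists (\sum_(c < c0) b c)%N => s a h; rewrite big1 ?scaler0 // => c _.
  rewrite /z [m + q + _ - _]addrAC hb ?(lin0 (lZ _)) ?scaler0 //; apply: leq_trans h.
  by rewrite (bigD1 c) //= leq_addr.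
apply: eq_lsum => s; under eq_bigr => b _ do rewrite scaler_sumr.
rewrite exchange_big; apply: eq_bigr => c _.
rewrite -scaler_suml.
transitivity ((\sum_(b < s.+1) f b (s - b)%N * gbinom (ratr q + b%:R) c) *: z s c).
  rewrite scaler_suml; apply: eq_bigr => b _; rewrite scalerA.
  by rewrite subnKC // -ltnS.
congr (_ *: _); transitivity ((-1) ^ (l + k + s%:Z) * (\sum_(b < s.+1)
    gbinom l%:~R (s - b) * gbinom (k%:~R : K) b * gbinom (ratr q + b%:R) c)).
  rewrite mulr_sumr; apply: eq_bigr => b _.
  have -> : (-1) ^ (l + k + s%:Z) = (-1) ^ (k + b%:Z) * (-1) ^ (l + (s - b)%N%:Z) :> K.
    by rewrite -expfzDr ?oppr_eq0 ?oner_eq0 //; congr (_ ^ _); have := ltn_ord b; lia.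
  by rewrite /f; ring.
rewrite binom_zero mulr_sumr; apply: eq_bigr => d _; rewrite /coef intrB intrD.
by ring.
Qed.

Lemma subrACA (V : zmodType) (x y z t : V) : (x - y) - (z - t) = (x - z) - (y - t).
Proof. by rewrite opprD addrACA -opprD. Qed.

Lemma cancel_cross (V : zmodType) (a a' b y d d' : V) :
  a - y - (b - d) - (a' - b - (y - d')) = (a - a') + (d - d').
Proof.
by rewrite (subrACA a) (subrACA (a - b)) (subrACA a b a') subrr subr0 (subrACA y d y)
           subrr sub0r opprK.
Qed.

Lemma RB0 i0 A0 m0 l0 X1 X2 n w : good A0 -> good X1 -> good X2 ->
  R i0 A0 m0 l0 (fun n w => X1 n w - X2 n w) n w = R i0 A0 m0 l0 X1 n w - R i0 A0 m0 l0 X2 n w.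
Proof.
move=> gA0 g1 g2; rewrite /R.
have e1 : R1 A0 m0 l0 (fun n w => X1 n w - X2 n w) n w = R1 A0 m0 l0 X1 n w - R1 A0 m0 l0 X2 n w.
  rewrite -lsumB.
  - by apply: eq_lsum => j; rewrite (linB _ _ (proj1 gA0 _)) scalerBr.
  - exact: (R1_fsupp m0 l0 n w (proj1 gA0) g1).
  - exact: (R1_fsupp m0 l0 n w (proj1 gA0) g2).
have e2 : R2 i0 A0 m0 l0 (fun n w => X1 n w - X2 n w) n w
        = R2 i0 A0 m0 l0 X1 n w - R2 i0 A0 m0 l0 X2 n w.
  rewrite -lsumB.
  - apply: eq_lsum => j; rewrite -scalerBr /th; case: i0 => //.
    by rewrite (linB _ _ P_lin).
  - exact: (R2_fsupp i0 m0 l0 n w gA0 (proj1 g1)).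
  - exact: (R2_fsupp i0 m0 l0 n w gA0 (proj1 g2)).
by rewrite e1 e2 subrACA.
Qed.

(** The residue operators represent the commutation relations of A and B: by [cross] the mixed terms
    cancel, and what remains are the two expansions of one residue of C c against a Leibniz
    derivative. This lets a Jacobi identity for A be carried through an operator attached to B. *)
Theorem R_comm n w : R i A m l (R i' B q k X) n w - (-1) ^+ (i && i') *: R i' B q k (R i A m l X) n w
  = \sum_(c < c0) \sum_(d < c.+1)
      coef c d *: R (i (+) i') (C c) (m + q - (c - d)%N%:R) (l + k - d%:Z) X n w.
Proof.
have lA := proj1 gA; have lB := proj1 gB.
have gAX1 := good_R1 m l lA gX; have gAX2 := good_R2 i m l gA gX.
have gBX1 := good_R1 q k lB gX; have gBX2 := good_R2 i' q k gB gX.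
rewrite [R i' B q k X]/R RB0 // [R i A m l X]/R RB0 //.
transitivity ((R1 A m l (R1 B q k X) n w - (-1) ^+ (i && i') *: R1 B q k (R1 A m l X) n w)
  + (R2 i A m l (R2 i' B q k X) n w - (-1) ^+ (i && i') *: R2 i' B q k (R2 i A m l X) n w)).
  rewrite {1 2 3 4}/R (cross _ _ _ _ _ _ _ gA gB gX pB) (cross _ _ _ _ _ _ _ gB gA gX pA).
  rewrite !scalerBr !scalerA [i' && i]andbC -expr2 sqrr_sign scale1r.
  exact: cancel_cross.
rewrite R1_comm R2_comm -sumrB; apply: eq_bigr => c _; rewrite -sumrB.
by apply: eq_bigr => d _; rewrite -scalerBr.
Qed.

End Commutator.

End Fields.

(** * Linearity of the residue operators and their recursion in the exponent *)

Section FieldProducts.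
Context {K : numFieldType} {N : lmodType K} (P : N -> N).
Hypotheses (P_lin : linear P) (PK : involutive P).
Implicit Types (X A B : rat -> N -> N) (w : N) (i : bool) (l k : int) (m q n : rat).

Lemma R_D i A m l X Y n w : good A -> good X -> good Y ->
  R P i A m l (fun n w => X n w + Y n w) n w = R P i A m l X n w + R P i A m l Y n w.
Proof.
move=> gA gX gY; rewrite /R addrACA -opprD; congr (_ - _); rewrite -lsumD.
- by apply: eq_lsum => j; rewrite (linD _ _ (proj1 gA _)) scalerDr.
- exact: (R1_fsupp m l n w (proj1 gA) gX).
- exact: (R1_fsupp m l n w (proj1 gA) gY).
- apply: eq_lsum => j; rewrite -scalerDr /th; case: i => //.
  by rewrite (linD _ _ P_lin).
- exact: (R2_fsupp P_lin i m l n w gA (proj1 gX)).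
- exact: (R2_fsupp P_lin i m l n w gA (proj1 gY)).
Qed.

Lemma R_Z i A m l c X n w : good A -> good X ->
  R P i A m l (fun n w => c *: X n w) n w = c *: R P i A m l X n w.
Proof.
move=> gA gX; rewrite /R scalerBr; congr (_ - _); rewrite -lsumZ.
- by apply: eq_lsum => j; rewrite (linZ _ _ (proj1 gA _)) !scalerA mulrC.
- exact: (R1_fsupp m l n w (proj1 gA) gX).
- apply: eq_lsum => j; rewrite /th; case: i; rewrite ?(linZ _ _ P_lin) !scalerA;
  by congr (_ *: _); rewrite mulrC.
- exact: (R2_fsupp P_lin i m l n w gA (proj1 gX)).
Qed.

Lemma R_0 i A m l n w : good A -> R P i A m l (fun _ _ => 0) n w = 0.
Proof.
move=> gA; rewrite /R /R1 /R2 !lsum0 ?subr0 // => j.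
  by rewrite /th (lin0 P_lin) if_same scaler0.
by rewrite (lin0 (proj1 gA _)) scaler0.
Qed.

Lemma R_sum (I : Type) (r : seq I) i A m l (Y : I -> rat -> N -> N) n w :
  good A -> (forall j, good (Y j)) ->
  R P i A m l (fun n w => \sum_(j <- r) Y j n w) n w = \sum_(j <- r) R P i A m l (Y j) n w.
Proof.
move=> gA gY; elim: r => [|j r IH].
  rewrite big_nil (_ : (fun _ _ => _) = fun _ _ => 0); first exact: R_0.
  by apply/funext => n'; apply/funext => w'; rewrite big_nil.
rewrite big_cons -IH -R_D //; last exact: good_sum.
rewrite (_ : (fun _ _ => _) = fun n w => Y j n w + \sum_(j <- r) Y j n w) //.
by apply/funext => n'; apply/funext => w'; rewrite big_cons.
Qed.

Lemma R_shift i A m l x X n w :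
  R P i A m l (fun n w => X (n + x) w) n w = R P i A m l X (n + x) w.
Proof.
rewrite /R; congr (_ - _); apply: eq_lsum => j.
  by congr (_ *: A _ (X _ _)); ring.
have e : l%:~R + n - j%:R + x = l%:~R + (n + x) - j%:R by ring.
by rewrite /th e.
Qed.

Lemma R_scale i A m l c X n w : good A -> good X ->
  R P i (fun n w => c *: A n w) m l X n w = c *: R P i A m l X n w.
Proof.
move=> gA gX; have gtX := good_th P_lin i gX; rewrite /R scalerBr; congr (_ - _).
  rewrite -lsumZ; last exact: (R1_fsupp m l n w (proj1 gA) gX).
  by apply: eq_lsum => j; rewrite !scalerA mulrC.
rewrite -lsumZ; last exact: (R2_fsupp P_lin i m l n w gA (proj1 gX)).
by apply: eq_lsum => j; rewrite (linZ _ _ (proj1 gtX _)) !scalerA mulrC.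
Qed.

Lemma R_l0 i A m X n w : R P i A m 0 X n w = A m (X n w) - th P i X n (A m w).
Proof.
rewrite /R /R1 /R2; congr (_ - _); rewrite (@lsum_single _ _ _ 0%N).
- by rewrite gbinom0 mulr1 scale1r subr0 add0r addr0.
- by case=> // j _; rewrite (gbinom0S (K := K)) mulr0 scale0r.
- by rewrite gbinom0 mulr1 addr0 expr0z scale1r subr0 add0r addr0.
- by case=> // j _; rewrite (gbinom0S (K := K)) mulr0 scale0r.
Qed.

Lemma gbinom_int_rec l j :
  gbinom ((l + 1)%:~R : K) j.+1 = gbinom l%:~R j.+1 + gbinom l%:~R j.
Proof. by rewrite intrD gbinomDS. Qed.

(** (t - z)^(l+1) = t (t - z)^l - z (t - z)^l, read off in both expansions by Pascal's rule. *)
Lemma R_rec i A m l X n w : good A -> good X ->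
  R P i A m (l + 1) X n w = R P i A (m + 1) l X n w - R P i A m l X (n + 1) w.
Proof.
move=> gA gX.
have f1 := R1_fsupp (m + 1) l n w (proj1 gA) gX.
have f1' := R1_fsupp m l (n + 1) w (proj1 gA) gX.
have f1'' := R1_fsupp m (l + 1) n w (proj1 gA) gX.
have f2 := R2_fsupp P_lin i (m + 1) l n w gA (proj1 gX).
have f2' := R2_fsupp P_lin i m l (n + 1) w gA (proj1 gX).
have f2'' := R2_fsupp P_lin i m (l + 1) n w gA (proj1 gX).
have succ F : fsupp F -> fsupp (fun j => F j.+1 : N).
  by case=> b hb; exists b => j h; apply: hb; apply: leqW.
have -> : R P i A m (l + 1) X n w = (R1 A (m + 1) l X n w - R1 A m l X (n + 1) w)
    - (R2 P i A (m + 1) l X n w - R2 P i A m l X (n + 1) w); last by rewrite subrACA.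
rewrite /R /R1 /R2; congr (_ - _).
  rewrite lsum_recl // [in RHS]lsum_recl // -[RHS]addrA -lsumB //; last exact: succ f1.
  congr (_ + _); first by rewrite !gbinom0 intrD; congr (_ *: A _ _); ring.
  apply: eq_lsum => j; rewrite gbinom_int_rec mulrDr scalerDl; congr (_ + _).
    by rewrite intrD; congr (_ *: A _ _); ring.
  rewrite exprS mulN1r mulNr scaleNr intrD -natr1; congr (- (_ *: A _ (X _ _))); ring.
rewrite (lsum_recl f2'') (lsum_recl f2') opprD [RHS]addrCA -lsumB //; last exact: succ f2'.
congr (_ + _).
  rewrite !gbinom0 !mulr1 !addr0 intrD expfzDr ?oppr_eq0 ?oner_eq0 // expr1z mulrN1 scaleNr.
  by congr (- (_ *: th _ _ _ _ _)); ring.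
apply: eq_lsum => j; rewrite gbinom_int_rec mulrDr scalerDl addrC intrD -natr1.
rewrite (_ : l + 1 + j.+1%:Z = l + j%:Z + (1 + 1)); last by lia.
rewrite (_ : l + j.+1%:Z = l + j%:Z + 1); last by lia.
rewrite !expfzDr ?oppr_eq0 ?oner_eq0 // !expr1z mulrNN !mulr1 mulrN1 !mulNr !scaleNr opprK.
congr (_ *: _ + _ *: _); first by congr (th _ _ _ _ (A _ _)); ring.
by congr (th _ _ _ _ _); ring.
Qed.
End FieldProducts.

(** * Composition of a field with the twisted fermion *)

Section TwistedFermion.
Context {K : numFieldType} {N : lmodType K} (P : N -> N) (F : rat -> N -> N).
Hypotheses (P_lin : linear P) (PK : involutive P).
Hypotheses (gF : good F) (pF : parity_op P true F).
Implicit Types (X A B : rat -> N -> N) (w : N) (i : bool) (l k : int) (m q n : rat).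

(** In the convention a_n z^(-n-1), phi_r is the mode of index r - 1/2. *)
Definition half_odd q := exists r : int, q = r%:~R - 1 / 2.

Hypothesis car : forall p q w, half_odd p -> half_odd q ->
  F p (F q w) + F q (F p w) = (p + q == -1)%:R *: w.

Definition idf n w : N := if n == -1 then w else 0.

Lemma good_idf : good idf.
Proof.
split=> [n c u v|w]; rewrite /idf; first by case: ifP; rewrite ?scaler0 ?addr0.
by exists 0 => n n0; case: eqP => // ne; rewrite ne in n0.
Qed.

Definition rho q l X n w := R P true F q l X n w.

Lemma half_oddD q r : half_odd q -> half_odd (r%:~R + q).
Proof. by move=> [s ->]; exists (r + s); rewrite intrD addrA. Qed.

(** [R_comm] with the identity field as the only C c. The anticommutator of F is a scalar, so no
    derivatives occur and the factors t^p (t - z)^l and t^q (t - z)^k simply multiply. *)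
Lemma rho_comm p q l k X n w : good X -> half_odd p -> half_odd q ->
  rho p l (rho q k X) n w + rho q k (rho p l X) n w
  = R P false idf (p + q) (l + k) X n w.
Proof.
move=> gX hp hq.
have := @R_comm K N P P_lin PK true true F F (fun=> idf) 1 p q l k X gF gF
  (fun=> good_idf) gX pF pF.
rewrite expr1 => /(_ _ n w); rewrite scaleN1r opprK => -> //; last first.
  move=> r s w'; rewrite scaleN1r opprK car; [|exact: half_oddD..].
  by rewrite big_ord1 gbinom0 scale1r /idf subr0; case: eqP; rewrite ?scale1r ?scale0r.
by rewrite !big_ord1 !gbinom0 mulr1 scale1r !subr0.
Qed.

(** For l >= 0 the factor (t - z)^l is a polynomial, whose expansions at infinity and at 0 agree. *)
Lemma R_idf_ge0 l m X n w : 0 <= l -> good X -> R P false idf m l X n w = 0.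
Proof.
move=> + gX; case: l => // l _; elim: l m n => [|l IH] m n.
  by rewrite R_l0 /idf /th; case: ifP; rewrite ?subrr // (lin0 (proj1 gX _)) subr0.
by rewrite -addn1 PoszD R_rec // ?IH ?subr0 //; exact: good_idf.
Qed.

Lemma R_idf_lt0 l X n w : l < 0 -> good X ->
  R P false idf (-1) l X n w = (-1) ^ (l + 1) *: X (n + l%:~R) w.
Proof.
move=> l0 gX; rewrite /R /R1 /R2 lsum0 => [|j].
  rewrite (@lsum_single _ _ _ 0%N) => [|[//|j] _].
    rewrite gbinom0 mulr1 !addr0 sub0r /th /idf eqxx [l%:~R + n]addrC.
    by rewrite expfzDr ?oppr_eq0 ?oner_eq0 // expr1z mulrN1 scaleNr.
  by rewrite /idf -[X in _ == X]addr0 (inj_eq (addrI _)) pnatr_eq0 /th (lin0 (proj1 gX _)) scaler0.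
rewrite /idf; case: eqP; rewrite ?scaler0 // => h; exfalso.
have : (l%:~R : rat) = j%:R by rewrite -[LHS](addrK (-1 - j%:R)); move: h; lra.
by rewrite -[j%:R]/(j%:Z%:~R) => /intr_inj; lia.
Qed.

Lemma rho_0 q l n w : rho q l (fun _ _ => 0) n w = 0.
Proof. exact: R_0. Qed.

Lemma rho_D q l X Y n w : good X -> good Y ->
  rho q l (fun n w => X n w + Y n w) n w = rho q l X n w + rho q l Y n w.
Proof. exact: R_D. Qed.

Lemma rho_Z q l c X n w : good X -> rho q l (fun n w => c *: X n w) n w = c *: rho q l X n w.
Proof. exact: R_Z. Qed.

Lemma rho_sum (I : Type) (r : seq I) q l (Y : I -> rat -> N -> N) n w :
  (forall j, good (Y j)) ->
  rho q l (fun n w => \sum_(j <- r) Y j n w) n w = \sum_(j <- r) rho q l (Y j) n w.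
Proof. exact: R_sum. Qed.

Lemma rho_shift q l x X n w : rho q l (fun n w => X (n + x) w) n w = rho q l X (n + x) w.
Proof. exact: R_shift. Qed.

(** Mutual locality of F and X: a high power of t - z removes their supercommutator. The exponent is
    uniform in q, n and w. *)
Definition loc X := exists l0 : int, forall l q n w, l0 <= l -> half_odd q -> rho q l X n w = 0.

Lemma good_rho q l X : good X -> good (rho q l X).
Proof. exact: good_R. Qed.

(** Dong's lemma in residue form. For k >= l0 the residue against X vanishes, and for k >= -l the
    exponent k + l is nonnegative, so the anticommutator vanishes as well. *)
Lemma loc_rho q l X : good X -> loc X -> half_odd q -> loc (rho q l X).
Proof.
move=> gX [l0 h] hq; exists (Num.max l0 (- l)) => k p n w; rewrite ge_max => /andP[k0 kl] hp.
have /eqP := rho_comm k l n w gX hp hq; rewrite R_idf_ge0 //; last by lia.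
rewrite (_ : rho q l (rho p k X) n w = 0) ?addr0; first by move/eqP.
have -> : rho p k X = fun _ _ => 0 by apply/funext => n'; apply/funext => w'; rewrite h.
exact: rho_0.
Qed.

Lemma loc_shift x X : loc X -> loc (fun n w => X (n + x) w).
Proof. by move=> [l0 h]; exists l0 => l q n w hl hq; rewrite /rho R_shift; apply: h. Qed.

Lemma locD X Y : good X -> good Y -> loc X -> loc Y -> loc (fun n w => X n w + Y n w).
Proof.
move=> gX gY [a ha] [b hb]; exists (Num.max a b) => l q n w; rewrite ge_max => /andP[la lb] hq.
by rewrite rho_D // ha // hb // addr0.
Qed.

Lemma locZ c X : good X -> loc X -> loc (fun n w => c *: X n w).
Proof.
move=> gX [a ha]; exists a => l q n w la hq.
by rewrite rho_Z // ha // scaler0.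
Qed.

Lemma loc0 : loc (fun _ _ => 0).
Proof. by exists 0 => l q n w _ _; exact: rho_0. Qed.

Lemma loc_sum (I : Type) (r : seq I) (Y : I -> rat -> N -> N) :
  (forall j, good (Y j)) -> (forall j, loc (Y j)) -> loc (fun n w => \sum_(j <- r) Y j n w).
Proof.
move=> gY lY; elim: r => [|j r IH].
  by rewrite (_ : (fun _ _ => _) = fun _ _ => 0);
     [exact: loc0 | apply/funext => n; apply/funext => w; rewrite big_nil].
rewrite (_ : (fun _ _ => _) = fun n w => Y j n w + \sum_(j <- r) Y j n w).
  by apply: locD => //; exact: good_sum.
by apply/funext => n; apply/funext => w; rewrite big_cons.
Qed.

Local Notation h := (- (1 / 2) : rat).

Lemma half_odd_h : half_odd h.
Proof. by exists 0; rewrite sub0r. Qed.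

(* The mode of [psi_k], i.e. the coefficient of (t - z)^k, from
   (t - z)^k = sum_i binom(1/2, i) z^(1/2 - i) t^(-1/2) (t - z)^(k + i). *)
Definition Psi k X n w : N :=
  lsum (fun i : nat => gbinom (ratr (1 / 2) : K) i
    *: rho h (k + i%:Z) X (n + (1 / 2 - i%:R)) w).

Lemma loc_bound X : loc X -> exists l0 : int, forall l q, l0 <= l -> half_odd q ->
  rho q l X = fun _ _ => 0.
Proof.
move=> [l0 hl]; exists l0 => l q ll hq.
by apply/funext => n; apply/funext => w; apply: hl.
Qed.

Lemma Psi_fsupp k X n w : loc X -> fsupp (fun i : nat => gbinom (ratr (1 / 2) : K) i
    *: rho h (k + i%:Z) X (n + (1 / 2 - i%:R)) w).
Proof.
move=> [l0 hl]; exists `|l0 - k|%N => j jB; rewrite hl ?scaler0 //; first by lia.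
exact: half_odd_h.
Qed.

Lemma Psi_fin k X : loc X -> exists b : nat, Psi k X = fun n w =>
  \sum_(i < b) gbinom (ratr (1 / 2) : K) i *: rho h (k + i%:Z) X (n + (1 / 2 - i%:R)) w.
Proof.
move=> [l0 hl]; exists `|l0 - k|%N; apply/funext => n; apply/funext => w.
apply: lsumE => j jB; rewrite hl ?scaler0 //; first by lia.
exact: half_odd_h.
Qed.

Lemma good_Psi k X : good X -> loc X -> good (Psi k X).
Proof.
move=> gX /(Psi_fin k)[b ->]; apply: good_sum => i; apply: goodZ.
exact/good_shift/good_rho.
Qed.

Lemma loc_Psi k X : good X -> loc X -> loc (Psi k X).
Proof.
move=> gX lX; have [b ->] := Psi_fin k lX; apply: loc_sum => i.
  exact/goodZ/good_shift/good_rho.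
apply/locZ/loc_shift/loc_rho => //; last exact: half_odd_h.
exact/good_shift/good_rho.
Qed.

Lemma Psi_lin k c X Y n w : good X -> good Y -> loc X -> loc Y ->
  Psi k (fun n w => c *: X n w + Y n w) n w = c *: Psi k X n w + Psi k Y n w.
Proof.
move=> gX gY lX lY; rewrite /Psi -lsumZ; last exact: Psi_fsupp.
rewrite -lsumD; [|exact/fsuppZc/Psi_fsupp|exact: Psi_fsupp].
apply: eq_lsum => i; rewrite rho_D //; last exact: goodZ.
by rewrite rho_Z // scalerDr !scalerA mulrC.
Qed.

Lemma Psi_large X : loc X -> exists l0 : int, forall k, l0 <= k -> Psi k X = fun _ _ => 0.
Proof.
move=> [l0 hl]; exists l0 => k kl; apply/funext => n; apply/funext => w.
apply: lsum0 => j; rewrite hl ?scaler0 //; first by lia.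
exact: half_odd_h.
Qed.

Lemma Psi_Psi l k X n w : good X -> loc X -> Psi l (Psi k X) n w =
  lsum (fun i : nat => lsum (fun j : nat =>
    (gbinom (ratr (1 / 2)) i * gbinom (ratr (1 / 2)) j)
      *: rho h (l + i%:Z) (rho h (k + j%:Z) X) (n + 1 - (i + j)%:R) w)).
Proof.
move=> gX lX; apply: eq_lsum => i.
have [b hb] : exists b, forall j : nat, (b <= j)%N -> rho h (k + j%:Z) X = fun _ _ => 0.
  have [l0 hl] := loc_bound lX; exists `|l0 - k|%N => j jb; apply: hl; last exact: half_odd_h.
  by lia.
have -> : Psi k X = fun n w => \sum_(j < b) gbinom (ratr (1 / 2) : K) j
    *: rho h (k + j%:Z) X (n + (1 / 2 - j%:R)) w.
  by apply/funext => n'; apply/funext => w'; apply: lsumE => j /hb ->; rewrite scaler0.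
rewrite rho_sum //; last first.
  by move=> j; apply/goodZ/good_shift/good_rho.
rewrite (@lsumE _ _ b) => [|j /hb ->]; last by rewrite rho_0 // scaler0.
rewrite scaler_sumr; apply: eq_bigr => j _; rewrite rho_Z; last exact/good_shift/good_rho.
have -> : n + 1 - (i + j)%:R = n + (1 / 2 - i%:R) + (1 / 2 - j%:R) by rewrite natrD; field.
by rewrite (rho_shift _ _ _ (rho h (k + j%:Z) X)) scalerA.
Qed.

Lemma Psi_Psi_fsupp l k X n w : good X -> loc X -> fsupp2 (fun i j : nat =>
    (gbinom (ratr (1 / 2) : K) i * gbinom (ratr (1 / 2)) j)
      *: rho h (l + i%:Z) (rho h (k + j%:Z) X) (n + 1 - (i + j)%:R) w).
Proof.
move=> gX lX; have [l0 hl] := loc_bound lX.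
apply: fsupp2C; apply: (@fsupp2_nested _ _ _ `|l0 - k|%N) => [j i hj|j].
  by rewrite hl; [rewrite rho_0 // scaler0| lia | exact: half_odd_h].
have [l1 hl1] := loc_bound (loc_rho (k + j%:Z) gX lX half_odd_h).
by exists `|l1 - l|%N => i hi; rewrite hl1; [rewrite scaler0| lia | exact: half_odd_h].
Qed.

Lemma ratr_half : ratr (1 / 2) + ratr (1 / 2) = 1%:R :> K.
Proof. by rewrite -rmorphD (_ : 1 / 2 + 1 / 2 = 1 :> rat) ?rmorph1 //; field. Qed.

(** The two square roots multiply: binom(1/2, .) convolved with itself is binom(1, .), so only s = 0
    and s = 1 contribute. Both terms vanish for l + k >= 0, they cancel each other for l + k < -1,
    and for l + k = -1 the first one is X. *)
Lemma Psi_anticomm l k X n w : good X -> loc X ->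
  Psi l (Psi k X) n w + Psi k (Psi l X) n w = (l + k + 1 == 0)%:R *: X n w.
Proof.
move=> gX lX; rewrite !Psi_Psi // [in X in _ + X]lsum_exchange; last exact: Psi_Psi_fsupp.
have f1 := Psi_Psi_fsupp l k n w gX lX; have f2 := fsupp2C (Psi_Psi_fsupp k l n w gX lX).
rewrite -lsumD; [|exact: fsupp2_lsum..].
transitivity (lsum (fun i : nat => lsum (fun j : nat =>
   (gbinom (ratr (1 / 2)) i * gbinom (ratr (1 / 2)) j) *:
   R P false idf (-1) (l + k + (i + j)%N%:Z) X (n + 1 - (i + j)%:R) w))).
  apply: eq_lsum => i; rewrite -lsumD; [|exact: fsupp2_row f1|exact: fsupp2_row f2].
  apply: eq_lsum => j; rewrite [X in _ + X *: _]mulrC [(j + i)%N]addnC -scalerDr.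
  rewrite rho_comm //; [|exact: half_odd_h..].
  have -> : h + h = -1 by field.
  by have -> : l + i%:Z + (k + j%:Z) = l + k + (i + j)%N%:Z by lia.
have idv (i j : nat) : (`|(l + k)%R|%N <= i + j)%N ->
    R P false idf (-1) (l + k + (i + j)%N%:Z) X (n + 1 - (i + j)%:R) w = 0.
  by move=> ij; apply: R_idf_ge0 => //; lia.
rewrite lsum_antidiag; last by exists `|(l + k)%R|%N => i j /idv ->; rewrite scaler0.
pose G (s : nat) := gbinom 1%:R s *: R P false idf (-1) (l + k + s%:Z) X (n + 1 - s%:R) w.
transitivity (lsum G).
  apply: eq_lsum => s; rewrite /G -ratr_half -gbinom_Vandermonde scaler_suml.
  by apply: eq_bigr => i _; rewrite subnKC // -ltnS.
rewrite (@lsumE _ _ 2) => [|s s2]; last by rewrite /G gbinom_small ?scale0r.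
rewrite big_ord_recl big_ord1 /G /= -[bump 0 0]/1%N gbinom0 gbinom1 !scale1r addr0 subr0 addrK.
have [L0|L0] := leP 0 (l + k).
  rewrite !R_idf_ge0 ?addr0 //; last by lia.
  by rewrite gt_eqF ?scale0r //; lia.
rewrite R_idf_lt0 //; have [L1|L1] := eqVneq (l + k + 1) 0.
  rewrite R_idf_ge0 ?L1 // scale1r addr0; have -> : l + k = -1 by apply/eqP; rewrite -subr_eq0 opprK L1.
  by rewrite scale1r; congr (X _ w); ring.
rewrite R_idf_lt0 //; last by lia.
rewrite [in X in _ + X]expfzDr ?oppr_eq0 ?oner_eq0 // expr1z mulrN1 scaleNr.
rewrite scale0r; apply/eqP; rewrite subr_eq0; apply/eqP; congr (_ *: X _ w).
by rewrite intrD; ring.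
Qed.


Lemma rho_rec q l X n w : good X ->
  rho q (l + 1) X n w = rho (q + 1) l X n w - rho q l X (n + 1) w.
Proof. exact: R_rec. Qed.

Section ModeExpansion.
Variables (X : rat -> N -> N) (w : N).
Hypotheses (gX : good X) (lX : loc X).

Let S q l n := lsum (fun j : nat => gbinom (ratr q : K) j *: Psi (l + j%:Z) X (q + n - j%:R) w).

Let S_rec q l n : S (q + 1) l n = S q (l + 1) n + S q l (n + 1).
Proof.
have [l0 hl] := Psi_large lX; apply: (@lsum_binom_rec _ _ (fun l x => Psi l X x w) l0).
by move=> l' x /hl ->.
Qed.

(** The convolution of binom(-1/2, .) and binom(1/2, .) is binom(0, .), so this inverts the
    definition of [Psi]. *)
Let S_half l n : rho h l X n w = S h l n.
Proof.
have [l0 hl] := loc_bound lX.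
transitivity (lsum (fun j : nat => lsum (fun i : nat =>
   (gbinom (ratr h) j * gbinom (ratr (1 / 2)) i) *: rho h (l + (j + i)%N%:Z) X (n - (j + i)%:R) w))).
  rewrite lsum_antidiag; last first.
    by exists `|l0 - l|%N => i j hij; rewrite hl ?scaler0 //; [lia|exact: half_odd_h].
  rewrite (@lsum_single _ _ _ 0%N) => [|s s0].
    by rewrite big_ord1 !gbinom0 mulr1 scale1r !addr0.
  transitivity (gbinom (ratr h + ratr (1 / 2)) s *: rho h (l + s%:Z) X (n - s%:R) w).
    rewrite -gbinom_Vandermonde scaler_suml; apply: eq_bigr => i _.
    by rewrite subnKC // -ltnS.
  by rewrite -rmorphD addNr rmorph0 gbinom0S (negbTE s0) scale0r.
apply: eq_lsum => j; rewrite /Psi -lsumZ; last exact: Psi_fsupp.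
apply: eq_lsum => i; rewrite scalerA.
have -> : l + j%:Z + i%:Z = l + (j + i)%N%:Z by lia.
by have -> : h + n - j%:R + (1 / 2 - i%:R) = n - (j + i)%:R by rewrite natrD; ring.
Qed.

(** Both sides obey the same recursion in q. Raising q from -1/2 is immediate. Lowering q determines
    only a sum of the values at l and l + 1, so one starts from large l, where both sides vanish by
    locality, and descends. *)
Lemma rho_Psi q l n : half_odd q -> rho q l X n w =
  lsum (fun j : nat => gbinom (ratr q) j *: Psi (l + j%:Z) X (q + n - j%:R) w).
Proof.
move=> [r ->]; have [l0 hl0] := loc_bound lX; have [l1 hl1] := Psi_large lX.
have -> : r%:~R - 1 / 2 = r%:~R + h by [].
have hr r' : half_odd (r'%:~R + h) by apply/half_oddD/half_odd_h.
rewrite -/(S _ _ _); elim/int_ind: r l n => [|r IH|r IH] l n.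
- by rewrite add0r S_half.
- have e : (r.+1%:Z)%:~R + h = (r%:Z%:~R + h) + 1 by rewrite -addn1 PoszD intrD; ring.
  rewrite e S_rec -!IH rho_rec //.
  by rewrite subrK.
- have e : (- r%:Z)%:~R + h = ((- r.+1%:Z)%:~R + h) + 1.
    rewrite (_ : - r%:Z = - r.+1%:Z + 1) ?intrD; [ring|lia].
  set q' := (- r.+1%:Z)%:~R + h in e *.
  have [B hB] : exists B : int, forall l n, B <= l -> rho q' l X n w = S q' l n.
    exists (Num.max l0 l1) => l' n' hl; rewrite hl0 //; [|by lia|exact: hr].
    by apply/esym/lsum0 => j; rewrite hl1 ?scaler0 //; lia.
  have [k hk] : exists k : nat, B <= l + k%:Z by exists `|B - l|%N; lia.
  elim: k l n hk => [|k IHk] l n hk; first by apply: hB; rewrite addr0 in hk.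
  have h1 : rho q' (l + 1) X (n - 1) w = S q' (l + 1) (n - 1) by apply: IHk; lia.
  have rr := rho_rec q' l (n - 1) w gX; rewrite subrK in rr.
  have := IH l (n - 1); rewrite e S_rec -h1 rr subrK => /eqP.
  by rewrite eq_sym -addrA -subr_eq0 addrAC subrr add0r addrC subr_eq0 => /eqP.
Qed.

End ModeExpansion.

Lemma rho_idf q l n w : 0 <= l -> rho q l idf n w = 0.
Proof.
case: l => // l _; elim: l q n => [|l IH] q n.
  rewrite /rho R_l0 /idf /th; case: ifP => _; first by rewrite PK subrr.
  by rewrite (lin0 (proj1 gF _)) (lin0 P_lin) subr0.
by rewrite -addn1 PoszD rho_rec ?IH ?subr0 //; exact: good_idf.
Qed.

Lemma loc_idf : loc idf.
Proof. by exists 0 => l q n w l0 _; apply: rho_idf. Qed.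

Lemma Psi_idf k n w : 0 <= k -> Psi k idf n w = 0.
Proof. by move=> k0; apply: lsum0 => i; rewrite rho_idf ?scaler0 //; lia. Qed.

Lemma th_rho q l X n w : good X -> th P true (rho q l X) n w = - rho q l (th P true X) n w.
Proof. by move=> gX; rewrite (th_R P_lin PK _ _ _ _ _ gF gX pF) scaleN1r. Qed.

Lemma loc_th X : good X -> loc X -> loc (th P true X).
Proof.
move=> gX [l0 hl]; exists l0 => l q n w ll hq; apply/eqP; rewrite -oppr_eq0 -th_rho //.
by rewrite /th hl // (lin0 P_lin).
Qed.

Lemma th_Psi k X n w : good X -> loc X ->
  th P true (Psi k X) n w = - Psi k (th P true X) n w.
Proof.
move=> gX lX; rewrite /th /Psi (lsum_lin P_lin); last exact: Psi_fsupp.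
rewrite -lsumN; last exact/Psi_fsupp/loc_th.
by apply: eq_lsum => i; rewrite (linZ _ _ P_lin) -scalerN -th_rho.
Qed.

Definition dd X n w : N := - ratr n *: X (n - 1) w.

Lemma good_dd X : good X -> good (dd X).
Proof.
move=> [lX tX]; split=> [n c u v|w].
  by rewrite /dd lX scalerDr !scalerA mulrC.
have [n0 hn] := tX w; exists (n0 + 1) => n; rewrite -lerBrDr => /hn h'.
by rewrite /dd h' scaler0.
Qed.

(** The extra term compensates for the derivative of (t - z)^l in z, which is -l (t - z)^(l-1). *)
Lemma rho_dd q l X n w : good X ->
  rho q l (dd X) n w = dd (rho q l X) n w + l%:~R *: rho q (l - 1) X n w.
Proof.
move=> gX; have gdX := good_dd gX; have [lX _] := gX; have [lF _] := gF.
have f1 := R1_fsupp q l n w lF gdX; have f1' := R1_fsupp q l (n - 1) w lF gX.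
have f1'' := R1_fsupp q (l - 1) n w lF gX.
have f2 := R2_fsupp P_lin true q l n w gF (proj1 gdX).
have f2' := R2_fsupp P_lin true q l (n - 1) w gF lX.
have f2'' := R2_fsupp P_lin true q (l - 1) n w gF lX.
have e1 : R1 F q l (dd X) n w = - ratr n *: R1 F q l X (n - 1) w + l%:~R *: R1 F q (l - 1) X n w.
  transitivity (- ratr n *: R1 F q l X (n - 1) w - lsum (fun j : nat =>
    j%:R *: (((-1) ^+ j * gbinom l%:~R j) *: F (l%:~R + q - j%:R) (X (n - 1 + j%:R) w)))).
    rewrite -lsumZ // -lsumB; [|exact: fsuppZc|exact: fsuppZ].
    apply: eq_lsum => j; rewrite /dd (linZ _ _ (lF _)) [n + _ - 1]addrAC !scalerA -scalerBl.
    congr (_ *: _); rewrite rmorphD /= ratr_nat; ring.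
  congr (_ + _); rewrite -lsumZ // lsum_recl; last exact: fsuppZ.
  rewrite scale0r add0r -lsumN; last first.
    by have [b hb] := f1'; exists b => j hj; rewrite hb ?scaler0 //; exact: leqW.
  apply: eq_lsum => j; rewrite !scalerA -scaleNr; congr (_ *: F _ (X _ _)).
  - rewrite mulrCA gbinomS gbinom_absorb intrB exprS; ring.
  - by rewrite intrB -natr1; ring.
  - by rewrite -natr1; ring.
have e2 : R2 P true F q l (dd X) n w
    = - ratr n *: R2 P true F q l X (n - 1) w + l%:~R *: R2 P true F q (l - 1) X n w.
  rewrite -!lsumZ // -lsumD; [|exact: fsuppZc..].
  apply: eq_lsum => j; rewrite /th /dd (linZ _ _ P_lin) !scalerA.
  have -> : l%:~R + (n - 1) - j%:R = l%:~R + n - j%:R - 1 :> rat by ring.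
  have -> : (l - 1)%:~R + n - j%:R = l%:~R + n - j%:R - 1 :> rat by rewrite intrB; ring.
  rewrite -scalerDl; congr (_ *: _).
  have -> : (-1) ^ (l - 1 + j%:Z) = - (-1) ^ (l + j%:Z) :> K.
    rewrite (_ : l + j%:Z = (l - 1 + j%:Z) + 1); last by lia.
    by rewrite [in RHS]expfzDr ?oppr_eq0 ?oner_eq0 // expr1z mulrN1 opprK.
  rewrite rmorphB rmorphD /= ratr_int ratr_nat.
  have := gbinom_absorb (l%:~R : K) j; rewrite intrB => hab.
  set s := (-1) ^ _.
  have -> : s * gbinom l%:~R j * (- (l%:~R + ratr n - j%:R))
     = - ratr n * (s * gbinom l%:~R j) - s * ((l%:~R - j%:R) * gbinom l%:~R j) by ring.
  rewrite hab; ring.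
rewrite /dd /rho /R e1 e2 !scalerBr opprD addrACA; congr (_ + _).
Qed.

Lemma Psi_dd k X n w : good X -> loc X ->
  Psi k (dd X) n w = dd (Psi k X) n w + k%:~R *: Psi (k - 1) X n w.
Proof.
move=> gX lX; rewrite /dd /Psi.
pose v (i : nat) := rho h (k + i%:Z) X (n - 1 + (1 / 2 - i%:R)) w.
pose b (i : nat) : K := gbinom (ratr (1 / 2)) i.
have fv c : fsupp (fun i : nat => c i *: v i).
  have [l0 hl] := loc_bound lX; exists `|l0 - k|%N => i hi.
  by rewrite /v hl ?scaler0 //; [lia | exact: half_odd_h].
have f2 := Psi_fsupp (k - 1) n w lX.
pose u (i : nat) := rho h (k - 1 + i%:Z) X (n + (1 / 2 - i%:R)) w.
have fu c : fsupp (fun i : nat => c i *: u i).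
  have [l0 hl] := loc_bound lX; exists `|(l0 - (k - 1))%R|%N => i hi.
  by rewrite /u hl ?scaler0 //; [lia | exact: half_odd_h].
transitivity (lsum (fun i : nat => (b i * - (ratr (n + 1 / 2) - i%:R)) *: v i)
  + lsum (fun i : nat => (b i * (k%:~R + i%:R)) *: u i)).
  rewrite -lsumD //; apply: eq_lsum => i; rewrite rho_dd // scalerDr /dd !scalerA /b.
  rewrite /v /u (_ : k + i%:Z - 1 = k - 1 + i%:Z); last by lia.
  rewrite (_ : n + (1 / 2 - i%:R) - 1 = n - 1 + (1 / 2 - i%:R)); last by ring.
  by rewrite intrD addrA rmorphB /= ratr_nat.
(* The part i of k + i, moved by one index, supplies the derivative of z^(1/2-i): it turns the
   factor n + 1/2 - i of the other sum into n. *)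
have -> : lsum (fun i : nat => (b i * (k%:~R + i%:R)) *: u i) =
   k%:~R *: lsum (fun i : nat => b i *: u i) + lsum (fun i : nat => (b i * (ratr (1 / 2) - i%:R)) *: v i).
  transitivity (k%:~R *: lsum (fun i : nat => b i *: u i) + lsum (fun i : nat => (b i * i%:R) *: u i)).
    rewrite -lsumZ // -lsumD //; last exact: fsuppZc.
    by apply: eq_lsum => i; rewrite scalerA -scalerDl mulrDr [b i * k%:~R]mulrC.
  congr (_ + _); rewrite lsum_recl // mulr0 scale0r add0r; apply: eq_lsum => i.
  rewrite mulrC gbinomS [X in _ = X *: _]mulrC /u /v.
  rewrite (_ : k - 1 + i.+1%:Z = k + i%:Z); last by lia.
  by rewrite (_ : n + (1 / 2 - i.+1%:R) = n - 1 + (1 / 2 - i%:R)) // -natr1; ring.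
rewrite [RHS]addrC addrCA; congr (_ + _); rewrite -lsumZ // -lsumD //.
apply: eq_lsum => i; rewrite -scalerDl scalerA /b; congr (_ *: _).
by rewrite rmorphD /=; ring.
Qed.

End TwistedFermion.

(** * Fock space *)

Section FockSpace.
Context {K : numClosedFieldType}.
Local Notation fock := (fock K).
Local Notation ket := (@ket K).
Implicit Types (S T : {fset nat}) (u v : fock) (k n : nat).

Lemma fval_ket S T : fval (ket S) T = (T == S)%:R. Proof. by []. Qed.

Lemma fval_sum (I : Type) (r : seq I) (p : pred I) (f : I -> fock) S :
  fval (\sum_(i <- r | p i) f i) S = \sum_(i <- r | p i) fval (f i) S.
Proof. by elim/big_rec2: _ => // i y z _ <-. Qed.

Lemma fval0 S : fval (0 : fock) S = 0. Proof. by []. Qed.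

Lemma fvalN u S : fval (- u) S = - fval u S. Proof. by []. Qed.

Lemma fock_span u : u = \sum_(S <- fset_set [set S | fval u S != 0]) fval u S *: ket S.
Proof.
apply: fvalP => T; rewrite fval_sum.
under eq_bigr => S _ do rewrite fvalZ fval_ket.
have [u0|u0] := eqVneq (fval u T) 0.
  rewrite u0 big1_seq // => S /andP[_ hS]; case: eqP => [e|_]; last by rewrite mulr0.
  by move: hS; rewrite -e in_fset_set ?inE; [rewrite /= u0 eqxx | exact: fval_fin].
rewrite (bigD1_seq T) /=; last exact: fset_uniq.
  rewrite eqxx mulr1 big1 ?addr0 // => S ST.
  by rewrite eq_sym (negbTE ST) mulr0.
by rewrite in_fset_set ?inE //; exact: fval_fin.
Qed.

(** Removing the largest element means that the creation operator which restores it acts without a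
    sign, as in [cre_ket]. *)
Lemma ket_ind (Q : {fset nat} -> Prop) : Q fset0 ->
  (forall n S, (forall m, m \in S -> (m < n)%N) -> Q S -> Q (n |` S)%fset) -> forall S, Q S.
Proof.
move=> Q0 QS S; have [c] := ubnP #|` S|; elim: c S => // c IH S.
have [->//|[x0 x0S]] := fset_0Vmem S.
pose n := (\max_(j : S) (fsval j : nat))%N.
have nS : n \in S.
  have [|j ej] := @bigop.eq_bigmax S (fun j => fsval j : nat).
    by apply/card_gt0P; exists [` x0S]%fset.
  by rewrite /n ej; exact: valP.
move=> cS; rewrite -(fsetD1K nS); apply: QS => [m|]; last first.
  by apply: IH; move: cS; rewrite (cardfsD1 n S) nS.
rewrite !inE => /andP[mn mS]; rewrite ltn_neqAle mn.
exact: (@leq_bigmax S (fun j => fsval j : nat) [` mS]%fset).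
Qed.

Lemma fock_ind (Q : fock -> Prop) :
  Q 0 -> (forall c u v, Q u -> Q v -> Q (c *: u + v)) -> Q (fvac K) ->
  (forall n S, (forall m, m \in S -> (m < n)%N) -> Q (ket S) -> Q (cre n (ket S))) ->
  forall u, Q u.
Proof.
move=> Q0 Ql Qv Qc u; rewrite (fock_span u).
elim/big_rec: _ => // S v _; apply: Ql; elim/ket_ind: S => // n S nS.
by rewrite -(cre_ket _ nS); apply: Qc.
Qed.

Definition below n u := forall S, fval u S != 0 -> forall m, m \in S -> (m < n)%N.

Lemma ann_below k n S : (forall m, m \in S -> (m < n)%N) -> below n (ann k (ket S)).
Proof.
move=> nS T; rewrite fann /ann_fun; case: ifP; rewrite ?eqxx // => kT.
rewrite fval_ket; have [e _ m mT|_] := eqVneq (k |` T)%fset S; last by rewrite mulr0 eqxx.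
by apply: nS; rewrite -e !inE mT orbT.
Qed.

Lemma cre_below k n S : (k < n)%N -> (forall m, m \in S -> (m < n)%N) ->
  below n (cre k (ket S)).
Proof.
move=> kn nS T; rewrite fcre /cre_fun; case: ifP; rewrite ?eqxx // => kT.
rewrite fval_ket; have [e _ m mT|_] := eqVneq (T `\ k)%fset S; last by rewrite mulr0 eqxx.
have [->//|mk] := eqVneq m k.
by apply: nS; rewrite -e !inE mT andbT.
Qed.

Lemma ann_ket k S : k \notin S -> ann k (ket S) = 0.
Proof.
move=> kS; apply: fvalP => T; rewrite fann /ann_fun; case: ifP => // kT.
by rewrite fval_ket; case: eqP => [e|_]; [move: kS; rewrite -e !inE eqxx | rewrite mulr0].
Qed.

Section Universal.
Context {W : lmodType K} (U : set W) (C : nat -> W -> W) (q : nat -> K) (w0 : W).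
Hypotheses (U_sub : subspace U) (Uw0 : U w0).
Hypothesis UC : forall k x, U x -> U (C k x).
Hypothesis C_lin : forall k c x y, U x -> U y -> C k (c *: x + y) = c *: C k x + C k y.
Hypothesis CC : forall i j x, i != j -> U x -> C i (C j x) + C j (C i x) = 0.
Hypothesis Csq : forall i x, U x -> C i (C i x) = q i *: x.

Definition cmonom S : W := foldr C w0 (sort geq S).

Lemma sort_ge_cons n S : (forall m, m \in S -> (m < n)%N) ->
  sort geq (n |` S)%fset = n :: sort geq S.
Proof.
move=> nS; have geq_trans : transitive geq by move=> a b c /= h1 h2; exact: leq_trans h2 h1.
have geq_total : total geq by move=> a b /=; exact: leq_total.
have nS' : n \notin S by apply/negP => /nS; rewrite ltnn.
apply: (@sorted_eq _ geq) => //.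
- by move=> a b /=; rewrite andbC -eqn_leq => /eqP.
- exact: sort_sorted.
- rewrite /= path_min_sorted ?sort_sorted //.
  by apply/allP => m; rewrite mem_sort => /nS /ltnW.
- rewrite perm_sort; apply: uniq_perm; first exact: fset_uniq.
    by rewrite /= mem_sort nS' sort_uniq fset_uniq.
  by move=> m; rewrite !inE mem_sort.
Qed.

Lemma cmonomS n S : (forall m, m \in S -> (m < n)%N) ->
  cmonom (n |` S)%fset = C n (cmonom S).
Proof. by move=> nS; rewrite /cmonom sort_ge_cons. Qed.

Lemma cmonom0 : cmonom fset0 = w0.
Proof. by rewrite /cmonom (_ : sort _ _ = [::]). Qed.

Lemma U0 : U 0.
Proof. by have [h _] := U_sub; move: h; rewrite inE. Qed.

Lemma Ulin c x y : U x -> U y -> U (c *: x + y).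
Proof.
by move=> Ux Uy; have [_ /(_ c x y)] := U_sub; rewrite !inE; apply.
Qed.

Lemma U_cmonom S : U (cmonom S).
Proof.
elim/ket_ind: S => [|n S nS IH]; first by rewrite cmonom0.
by rewrite cmonomS //; apply: UC.
Qed.

(** The universal map out of the Fock space. The relations of the C k are required only on the
    subspace U, so that they can be operators on fields that behave well only on local ones; the
    scalars q k allow a C k with nonzero square, such as phi_0. *)
Definition induced (u : fock) : W := \sum_(S \in [set S | fval u S != 0]) fval u S *: cmonom S.

Lemma inducedE (A : {fset {fset nat}}) u : (forall S, fval u S != 0 -> S \in A) ->
  induced u = \sum_(S <- A) fval u S *: cmonom S.
Proof.
move=> h; rewrite /induced.
rewrite (@fsbig_widen _ _ _ _ [set S | fval u S != 0] [set` A]) //; last first.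
  by move=> S [_ /= /negP]; rewrite negbK => /eqP ->; rewrite scale0r.
by rewrite -fsbig_seq //; exact: fset_uniq.
Qed.

Lemma induced_linear : linear induced.
Proof.
move=> c u v.
pose A := fset_set ([set S | fval u S != 0] `|` [set S | fval v S != 0]).
have hA S : (fval u S != 0) || (fval v S != 0) -> S \in A.
  move=> h; rewrite in_fset_set; last by rewrite finite_setU; split; exact: fval_fin.
  by rewrite inE; case/orP: h; [left | right].
rewrite !(@inducedE A) => [|S h|S h|S].
- rewrite scaler_sumr -big_split; apply: eq_bigr => S _.
  by rewrite fvalD fvalZ scalerDl -scalerA.
- by apply: hA; rewrite h orbT.
- by apply: hA; rewrite h.
- move=> h; apply: hA; apply: contraNT h; rewrite negb_or !negbK => /andP[/eqP a /eqP b].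
  by rewrite fvalD fvalZ a b mulr0 addr0.
Qed.

Lemma induced_ket S : induced (ket S) = cmonom S.
Proof.
rewrite (@inducedE [fset S]%fset) => [|T].
  by rewrite big_seq_fset1 fval_ket eqxx scale1r.
by rewrite fval_ket inE; have [//|_] := eqVneq T S; rewrite eqxx.
Qed.

Lemma induced_vac : induced (fvac K) = w0.
Proof. by rewrite induced_ket cmonom0. Qed.

Lemma U_induced u : U (induced u).
Proof.
elim/fock_ind: u => [|c u v Uu Uv||n S nS _].
- by rewrite (lin0 induced_linear); exact: U0.
- by rewrite induced_linear; exact: Ulin.
- by rewrite induced_vac.
- by rewrite cre_ket // induced_ket; exact: U_cmonom.
Qed.

Lemma induced_cre_below n u : below n u -> induced (cre n u) = C n (induced u).
Proof.
move=> bu; rewrite (fock_span u); set A := fset_set _.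
have hA S : S \in A -> forall m, m \in S -> (m < n)%N.
  by rewrite in_fset_set ?inE /=; [exact: bu | exact: fval_fin].
have : {subset enum_fset A <= A} by [].
elim: (enum_fset A) => [|S r IH] sub.
  rewrite !big_nil (lin0 (cre_linear n)) (lin0 induced_linear).
  have := @C_lin n (-1) 0 0 U0 U0; rewrite !scaleN1r oppr0 addr0 => ->.
  by rewrite addNr.
rewrite !big_cons cre_linear !induced_linear C_lin; [|exact: U_induced..].
rewrite IH => [|T hT]; last by apply: sub; rewrite inE hT orbT.
congr (_ *: _ + _); have nS : forall m, m \in S -> (m < n)%N.
  by apply: hA; apply: sub; rewrite inE eqxx.
by rewrite cre_ket // !induced_ket cmonomS.
Qed.

Lemma below_lin n c u v : below n u -> below n v -> below n (c *: u + v).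
Proof.
move=> bu bv S; rewrite fvalD fvalZ => h; have [u0|] := eqVneq (fval u S) 0; last exact: bu.
by apply: bv; apply: contraNN h => /eqP ->; rewrite u0 mulr0 addr0.
Qed.

(** [cre k + q k ann k] squares to q k and anticommutes with its analogues at other indices, just as
    C k does. On a monomial with largest index n, the operator is moved past n if k < n, becomes the
    new leading factor if k > n, and meets [Csq] if k = n. *)
Lemma induced_cre k u : induced (cre k u + q k *: ann k u) = C k (induced u).
Proof.
have C0 j : C j 0 = 0.
  by have := @C_lin j (-1) 0 0 U0 U0; rewrite !scaleN1r oppr0 addr0 => ->; rewrite addNr.
have L u' : induced (cre k u' + q k *: ann k u') = induced (cre k u') + q k *: induced (ann k u').
  by rewrite addrC induced_linear addrC.
elim/fock_ind: u => [|c u v IHu IHv||n S nS IH].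
- by rewrite (lin0 (cre_linear _)) (lin0 (ann_linear _)) scaler0 addr0 (lin0 induced_linear) C0.
- rewrite induced_linear C_lin; [|exact: U_induced..]; rewrite -IHu -IHv !L.
  rewrite cre_linear ann_linear !induced_linear.
  by rewrite !scalerDr !scalerA addrACA [q k * c]mulrC.
- by rewrite L ann_vac (lin0 induced_linear) scaler0 addr0 cre_ket // !induced_ket cmonomS.
have nSn : n \notin S by apply/negP => /nS; rewrite ltnn.
have [kn|nk|->] := ltngtP k n.
- have -> : cre k (cre n (ket S)) + q k *: ann k (cre n (ket S))
     = - cre n (cre k (ket S) + q k *: ann k (ket S)).
    have e1 : cre k (cre n (ket S)) = - cre n (cre k (ket S)).
      by apply/eqP; rewrite -addr_eq0 cre_anticomm.
    have e2 : ann k (cre n (ket S)) = - cre n (ann k (ket S)).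
      by apply/eqP; rewrite -addr_eq0 ann_cre_anticomm ltn_eqF // scale0r.
    by rewrite e1 e2 scalerN -opprD (linD _ _ (cre_linear n)) (linZ _ _ (cre_linear n)).
  rewrite (linN _ induced_linear) induced_cre_below.
    rewrite IH cre_ket // !induced_ket cmonomS //.
    by apply/eqP; rewrite eq_sym -addr_eq0 CC ?ltn_eqF //; exact: U_cmonom.
  rewrite addrC; apply: below_lin; [exact: ann_below | exact: cre_below].
- have nS' m : m \in (n |` S)%fset -> (m < k)%N.
    by rewrite !inE => /orP[/eqP->|/nS mn] //; exact: ltn_trans mn nk.
  rewrite L cre_ket // ann_ket; last by apply/negP => /nS'; rewrite ltnn.
  by rewrite (lin0 induced_linear) scaler0 addr0 cre_ket // !induced_ket cmonomS.
- rewrite cre_sq add0r; have /eqP := ann_cre_anticomm n n (ket S).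
  rewrite ann_ket // (lin0 (cre_linear _)) addr0 eqxx scale1r => /eqP ->.
  by rewrite (linZ _ _ induced_linear) cre_ket // !induced_ket cmonomS // Csq //; exact: U_cmonom.
Qed.

Lemma induced_ann k (A : W -> W) :
  (forall c x y, U x -> U y -> A (c *: x + y) = c *: A x + A y) -> A w0 = 0 ->
  (forall j x, U x -> A (C j x) + C j (A x) = (k == j)%:R *: x) ->
  forall u, induced (ann k u) = A (induced u).
Proof.
move=> A_lin Aw0 AC; have A0 : A 0 = 0.
  by have := @A_lin (-1) 0 0 U0 U0; rewrite !scaleN1r oppr0 addr0 => ->; rewrite addNr.
elim/fock_ind => [|c u v IHu IHv||n S nS IH].
- by rewrite (lin0 (ann_linear _)) (lin0 induced_linear) A0.
- by rewrite ann_linear !induced_linear A_lin ?IHu ?IHv //; exact: U_induced.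
- by rewrite ann_vac (lin0 induced_linear) induced_vac Aw0.
- have -> : ann k (cre n (ket S)) = (k == n)%:R *: ket S - cre n (ann k (ket S)).
    by rewrite -ann_cre_anticomm addrK.
  rewrite (linB _ _ induced_linear) (linZ _ _ induced_linear) induced_cre_below; last exact: ann_below.
  rewrite IH cre_ket // !induced_ket cmonomS // -AC ?addrK //; exact: U_cmonom.
Qed.

End Universal.

Section Diagonal.
Implicit Types e : {fset nat} -> K.

Lemma diag_fin e u : finite_set [set S | e S * fval u S != 0].
Proof.
by apply: sub_finite_set (fval_fin u) => S /=; rewrite mulf_eq0 negb_or => /andP[].
Qed.

Definition diag e u : fock := mk_fock (diag_fin e u).

Lemma fdiag e u S : fval (diag e u) S = e S * fval u S. Proof. by []. Qed.

Lemma diag_linear e : linear (diag e).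
Proof. by move=> c u v; apply: fvalP => S; rewrite fvalD fvalZ !fdiag fvalD fvalZ mulrDr mulrCA. Qed.

Lemma diag_cre e k u : diag e (cre k u) = cre k (diag (fun S => e (k |` S)%fset) u).
Proof.
apply: fvalP => S; rewrite fdiag !fcre /cre_fun; case: ifP => kS; last by rewrite mulr0.
by rewrite fdiag fsetD1K // mulrCA.
Qed.

Lemma diag_ann e k u : diag e (ann k u) = ann k (diag (fun S => e (S `\ k)%fset) u).
Proof.
apply: fvalP => S; rewrite fdiag !fann /ann_fun; case: ifPn => kS; first by rewrite mulr0.
by rewrite fdiag fsetU1K // mulrCA.
Qed.

Lemma diag_ket e S : diag e (ket S) = e S *: ket S.
Proof.
apply: fvalP => T; rewrite fdiag fvalZ fval_ket; case: eqP => [->//|_].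
by rewrite !mulr0.
Qed.

End Diagonal.

Definition par : fock -> fock := diag (fun S => (-1) ^+ #|` S|).

Lemma par_linear : linear par. Proof. exact: diag_linear. Qed.

Lemma parK : involutive par.
Proof. by move=> u; apply: fvalP => S; rewrite !fdiag mulrA -expr2 sqrr_sign mul1r. Qed.

Lemma par_cre k u : par (cre k u) = - cre k (par u).
Proof.
rewrite /par diag_cre -[RHS]linearN; apply: fvalP => S; rewrite !fcre /cre_fun; case: ifP => // kS.
by rewrite !fdiag fsetD1K // (cardfsD1 k S) kS add1n exprS mulN1r mulNr.
Qed.

Lemma par_ann k u : par (ann k u) = - ann k (par u).
Proof.
rewrite /par diag_ann -[RHS]linearN; apply: fvalP => S; rewrite !fann /ann_fun; case: ifPn => // kS.
congr (_ * _); rewrite fvalN !fdiag fsetU1K // cardfsU1 kS add1n exprS.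
by rewrite mulN1r mulNr opprK.
Qed.

Lemma par_ket S : par (ket S) = (-1) ^+ #|` S| *: ket S.
Proof. exact: diag_ket. Qed.

End FockSpace.

(** * Commutation and translation in the Ising model SVOA *)

Section IsingSvoa.
Context {K : numClosedFieldType}.

Lemma psi_fock_ind (Q : fock_M K -> Prop) :
  Q 0 -> (forall c u v, Q u -> Q v -> Q (c *: u + v)) -> Q (vac_M K) ->
  (forall k u, Q u -> Q (psi k u)) -> forall u, Q u.
Proof.
move=> Q0 Ql Qv Qp; apply: fock_ind => // n S _ QS.
exact: (Qp (Negz n)).
Qed.

Variables (S : svoa (fock_M K)) (hS : ising_svoa S).

Lemma svY_psi n b : sv_Y S (psi_state K) n b = psi n b.
Proof. exact: (ising_Y hS). Qed.

Lemma par_psi_state : sv_par S true (psi_state K).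
Proof.
rewrite (ising_par hS) => V /= [_]; apply; exists [:: 1%N] => //.
Qed.

Lemma sv_par_vac : sv_par S false (vac_M K).
Proof. by have := sv_vac_even S; rewrite (ising_vac hS). Qed.

Lemma sv_par_psi i n b : sv_par S i b -> sv_par S (~~ i) (psi n b).
Proof. by move=> hb; rewrite -svY_psi -addTb; apply: sv_Y_par => //; exact: par_psi_state. Qed.

Lemma par_psi k (b : fock_M K) : par (psi k b) = - psi k (par b).
Proof. by case: k => k; [exact: par_ann | exact: par_cre]. Qed.

Lemma sv_parE i b : sv_par S i b -> par b = (-1) ^+ i *: b.
Proof.
rewrite (ising_par hS) => /(_ [set b | par b = (-1) ^+ i *: b])/=; apply; split.
  split=> [|c u v]; rewrite !inE /=; first by rewrite (lin0 par_linear) scaler0.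
  by move=> hu hv; rewrite par_linear hu hv scalerDr !scalerA mulrC.
move=> _ [s [_ _ <-] <-]; elim: s => [|k s IH] /=.
  by rewrite /psi_monomial /= /vac_M /fvac par_ket cardfs0.
rewrite par_psi IH (linZ _ _ (@psi_linear K _)) -scaleNr; congr (_ *: _).
by case: (odd _); rewrite /= ?expr0 ?expr1 ?opprK.
Qed.

Lemma sv_par_ket T : sv_par S (odd #|` T|) (ket K T).
Proof.
elim/ket_ind: T => [|n T nT IH]; first by rewrite cardfs0; exact: sv_par_vac.
have nT' : n \notin T by apply/negP => /nT; rewrite ltnn.
by rewrite -cre_ket // cardfsU1 nT' add1n /=; apply: (sv_par_psi (Negz n) IH).
Qed.

Lemma psi_large (b : fock_M K) : exists k0 : int, forall k, k0 <= k -> psi k b = 0.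
Proof.
have [k0 h] := sv_trunc S (psi_state K) b; exists k0 => k /h.
by rewrite svY_psi.
Qed.

(** The Jacobi identity for (psi, a) at l = 0, solved for the product in which a acts after psi. It
    carries the mode of a towards b. *)
Lemma sv_comm i a m n c0 b : sv_par S i a -> (forall k, (c0 <= k)%N -> psi k%:Z a = 0) ->
  sv_Y S a m (psi n b) = (-1) ^+ i *: psi n (sv_Y S a m b)
    - (-1) ^+ i *: \sum_(k < c0) gbinom n%:~R k *: sv_Y S (psi k%:Z a) (m + n - k%:Z) b.
Proof.
move=> ha hc0; have := sv_jacobi b 0 n m par_psi_state ha.
rewrite -!/(lsum _) (@lsum_single _ _ _ 0%N); last first.
  by case=> // j _; rewrite (gbinom0S (K := K)) mulr0 scale0r.
rewrite (@lsum_single _ _ _ 0%N); last first.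
  by case=> // j _; rewrite (gbinom0S (K := K)) mulr0 scale0r.
rewrite (@lsumE _ _ c0); last first.
  move=> j hj; rewrite svY_psi add0r hc0 //.
  by rewrite (lin0 (fun d u v => sv_linl S (n + m - j%:Z) b d u v)) scaler0.
rewrite !gbinom0 !mulr1 expr0 !addr0 !scale1r !add0r !svY_psi andTb => e.
rewrite -scalerBr (_ : \sum_(k < c0) _ = psi n (sv_Y S a m b) - (-1) ^+ i *: sv_Y S a m (psi n b)).
  by rewrite subKr scalerA -expr2 sqrr_sign scale1r.
by rewrite e; apply: eq_bigr => j _; rewrite svY_psi add0r [m + n]addrC.
Qed.

Definition transl (b : fock_M K) : fock_M K := sv_Y S (sv_vir S) 0 b.

Lemma transl_linear : linear transl.
Proof. exact: sv_linr. Qed.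

Lemma transl_vac : transl (vac_M K) = 0.
Proof. by rewrite -(ising_vac hS); exact: sv_create. Qed.

Lemma transl_psi n b : transl (psi n b) = psi n (transl b) - n%:~R *: psi (n - 1) b.
Proof.
have := sv_jacobi b 0 0 n (sv_vir_even S) par_psi_state.
rewrite -!/(lsum _) (@lsum_single _ _ _ 0%N); last first.
  by case=> // j _; rewrite (gbinom0S (K := K)) mulr0 scale0r.
rewrite (@lsum_single _ _ _ 0%N); last first.
  by case=> // j _; rewrite (gbinom0S (K := K)) mulr0 scale0r.
rewrite (@lsum_single _ _ _ 0%N); last first.
  by case=> // j _; rewrite (gbinom0S (K := K)) scale0r.
rewrite !gbinom0 !mulr1 !expr0 !addr0 !scale1r !add0r !svY_psi sv_deriv svY_psi => /eqP.
by rewrite subr_eq addrC scaleNr => /eqP.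
Qed.

Lemma sv_create_rec a (i : nat) :
  i.+1%:R *: sv_Y S a (- i.+2%:Z) (vac_M K) = sv_Y S (transl a) (- i.+1%:Z) (vac_M K).
Proof.
rewrite sv_deriv intrN opprK; congr (_ *: sv_Y S a _ _).
by lia.
Qed.

End IsingSvoa.

(** D depends on m + r only, so one value of r decides. *)
Lemma shift_zero (V : zmodType) (D : rat -> int -> V) :
  (forall m r, D (m + 1) r = D m (r + 1)) -> (forall m, D m (-1) = 0) -> forall m r, D m r = 0.
Proof.
move=> h h1 m r; elim/int_ind: r m => [|r IH|r IH] m.
- by have := h m (-1); rewrite addNr h1 => <-.
- by rewrite -addn1 PoszD -h IH.
- have := h (m - 1) (- r.+1%:Z); rewrite subrK => ->.
  by rewrite (_ : - r.+1%:Z + 1 = - r%:Z) ?IH //; lia.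
Qed.

(** * Fields on a twisted module *)

Section StateField.
Context {K : numClosedFieldType} {N : lmodType K} (P : N -> N) (F : rat -> N -> N).
Hypotheses (P_lin : linear P) (PK : involutive P).
Hypotheses (gF : good F) (pF : parity_op P true F).
Hypothesis car : forall p q w, half_odd p -> half_odd q ->
  F p (F q w) + F q (F p w) = (p + q == -1)%:R *: w.
Implicit Types (w : N) (m q n : rat).

Local Notation Psi := (Psi P F).
Local Notation loc := (loc P F).
Local Notation rho := (rho P F).

Let U : set (rat -> N -> N) := [set X | good X /\ loc X].
Let C k X := Psi (- k.+1%:Z) X.

Lemma U_subspace : subspace U.
Proof.
split=> [|c X Y]; rewrite !inE; first by split; [exact: good0 | exact: loc0].
move=> [gX lX] [gY lY]; split; first exact: goodD (goodZ _ gX) gY.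
by apply: locD => //; [exact: goodZ | exact: locZ].
Qed.

Let U_idf : U (@idf K N).
Proof. by split; [exact: good_idf | exact: loc_idf]. Qed.

Let UPsi k X : U X -> U (Psi k X).
Proof. by move=> [gX lX]; split; [exact: good_Psi | exact: loc_Psi]. Qed.

Let PsiL k c X Y : U X -> U Y -> Psi k (c *: X + Y) = c *: Psi k X + Psi k Y.
Proof.
move=> [gX lX] [gY lY]; apply/funext => n; apply/funext => w.
exact: (Psi_lin P_lin gF).
Qed.

Let PsiAC l k X : U X -> Psi l (Psi k X) + Psi k (Psi l X) = (l + k + 1 == 0)%:R *: X.
Proof. by move=> [gX lX]; apply/funext => n; apply/funext => w; exact: Psi_anticomm. Qed.

Let CC i j X : i != j -> U X -> C i (C j X) + C j (C i X) = 0.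
Proof.
move=> _ UX; by rewrite PsiAC // (_ : (_ == _) = false) ?scale0r.
Qed.

Let Csq i X : U X -> C i (C i X) = (0 : K) *: X.
Proof.
move=> UX; have /eqP := PsiAC (- i.+1%:Z) (- i.+1%:Z) UX.
rewrite (_ : (_ + _ + _ == 0) = false); last by apply/eqP; lia.
by rewrite !scale0r -mulr2n -scaler_nat scaler_eq0 pnatr_eq0 => /eqP.
Qed.

(** By [Psi_anticomm] the local fields form a module over the psi modes in which the identity field
    is a vacuum vector, see [Psi_idf]; the universal map of the Fock space M therefore sends psi_k
    to [Psi k]. *)
Definition state_field : fock_M K -> rat -> N -> N :=
  induced C (@idf K N).

Local Notation Y := state_field.

Lemma Y_linear : linear Y.
Proof. exact: (induced_linear C). Qed.

Lemma Y_lin n w : linear (fun b => Y b n w).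
Proof. by move=> c u v; rewrite Y_linear. Qed.

Lemma Y_vac : Y (vac_M K) = @idf K N.
Proof. exact: induced_vac. Qed.

Let UY b : U (Y b).
Proof. exact: (U_induced U_subspace U_idf (fun k => @UPsi (- k.+1%:Z))). Qed.

Lemma good_Y b : good (Y b). Proof. by have [] := UY b. Qed.

Lemma loc_Y b : loc (Y b). Proof. by have [] := UY b. Qed.

Lemma Y_psi k b : Y (psi k b) = Psi k (Y b).
Proof.
have CL j := @PsiL (- j.+1%:Z).
case: k => k; rewrite /psi.
  apply: (induced_ann U_subspace U_idf (fun k => @UPsi (- k.+1%:Z)) CL).
  - by move=> c x y; apply: PsiL.
  - by apply/funext => n; apply/funext => w; apply: Psi_idf.
  - move=> j X UX; rewrite PsiAC //; congr (_%:R *: _).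
    by apply/eqP/eqP; lia.
have := induced_cre U_subspace U_idf (fun k => @UPsi (- k.+1%:Z)) CL CC Csq k b.
by rewrite scale0r addr0 NegzE.
Qed.

Lemma th_Y b : th P true (Y b) = Y (par b).
Proof.
elim/(@psi_fock_ind K): b => [|c u v IHu IHv||k u IH].
- rewrite (lin0 par_linear) (lin0 Y_linear); apply/funext => n; apply/funext => w.
  by rewrite /th (lin0 P_lin).
- rewrite par_linear !Y_linear -IHu -IHv; apply/funext => n; apply/funext => w.
  by rewrite /th P_lin.
- rewrite (_ : par _ = vac_M K) ?Y_vac; last by rewrite /vac_M /fvac par_ket cardfs0 scale1r.
  apply/funext => n; apply/funext => w; rewrite /th /idf; case: ifP; rewrite ?PK //.
  by rewrite (lin0 P_lin).
- have -> : par (psi k u) = - psi k (par u).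
    by case: k => k; [exact: par_ann | exact: par_cre].
  rewrite (linN _ Y_linear) !Y_psi -IH; apply/funext => n; apply/funext => w.
  by rewrite (th_Psi P_lin PK gF pF); [|exact: good_Y|exact: loc_Y].
Qed.

Lemma rho_Y q l b n w : half_odd q -> rho q l (Y b) n w =
  lsum (fun j : nat => gbinom (ratr q) j *: Y (psi (l + j%:Z) b) (q + n - j%:R) w).
Proof.
move=> hq; rewrite (rho_Psi P_lin gF w (good_Y b) (loc_Y b) l n hq).
by apply: eq_lsum => j; rewrite Y_psi.
Qed.

Definition on_coset i (X : rat -> N -> N) := forall n w, ~ hcoset i n -> X n w = 0.

Lemma hcosetD i (r : int) n : hcoset i (n + r%:~R) -> hcoset i n.
Proof.
rewrite /hcoset /= => h.
rewrite (_ : n - _ = (n + r%:~R - (i : nat)%:R / 2) - r%:~R); last by ring.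
by rewrite rpredB ?intr_int.
Qed.

Lemma on_coset_rho i q l X : on_coset i X -> on_coset i (rho q l X).
Proof.
move=> hX n w hn; rewrite /rho /R /R1 /R2 !lsum0 ?subr0 // => j.
  rewrite /th hX ?(lin0 P_lin) ?scaler0 // => h; apply: hn.
  by apply: (@hcosetD i (l - j%:Z)); rewrite intrB addrA [n + _]addrC.
rewrite hX ?(lin0 (proj1 gF _)) ?scaler0 // => h; apply: hn.
exact: (@hcosetD i j%:Z).
Qed.

Lemma on_coset_Psi i k X : on_coset i X -> on_coset (~~ i) (Psi k X).
Proof.
move=> hX n w hn; apply: lsum0 => j; rewrite (on_coset_rho _ _ hX) ?scaler0 //.
move=> h; apply: hn; move: h; rewrite /hcoset /= => h.
have [r ->] : exists r : int, n = (n + (1 / 2 - j%:R) - (i : nat)%:R / 2) +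
     (~~ i : nat)%:R / 2 + r%:~R.
  case: i {hX h} => /=; [exists j%:Z | exists (j%:Z - 1)]; rewrite ?intrB; by field.
by rewrite addrAC addrK rpredD // intr_int.
Qed.

Section Svoa.
Variables (S : svoa (fock_M K)) (hS : ising_svoa S).

Lemma on_coset_Y i b : sv_par S i b -> on_coset i (Y b).
Proof.
rewrite (ising_par hS) => /(_ [set b | on_coset i (Y b)])/=; apply; split.
  split=> [|c u v]; rewrite !inE /=; first by move=> n w _; rewrite (lin0 (Y_lin n w)).
  by move=> hu hv n w hn; rewrite (Y_lin n w) hu ?hv ?scaler0 ?addr0.
move=> _ [s [_ _ <-] <-]; elim: s => [|k s IH] /=.
  rewrite Y_vac => n w hn; rewrite /idf; case: eqP => // e; case: hn.
  by rewrite /hcoset /= e mul0r subr0.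
by rewrite Y_psi; apply: on_coset_Psi.
Qed.

Lemma Y_transl b : Y (transl S b) = dd (Y b).
Proof.
elim/(@psi_fock_ind K): b => [|c u v IHu IHv||k u IH].
- rewrite (lin0 (transl_linear S)) (lin0 Y_linear); apply/funext => n; apply/funext => w.
  by rewrite /dd scaler0.
- rewrite (transl_linear S) !Y_linear IHu IHv; apply/funext => n; apply/funext => w.
  transitivity (- ratr n *: (c *: Y u (n - 1) w + Y v (n - 1) w)); last by [].
  by rewrite scalerDr scalerA mulrC -scalerA.
- rewrite transl_vac // (lin0 Y_linear) Y_vac; apply/funext => n; apply/funext => w.
  rewrite /dd /idf; case: eqP => h; last by rewrite scaler0.
  by rewrite (_ : n = 0) ?rmorph0 ?oppr0 ?scale0r // -[n](subrK 1) h addNr.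
- rewrite transl_psi // (linB _ _ Y_linear) (linZ _ _ Y_linear) !Y_psi IH.
  apply/funext => n; apply/funext => w.
  transitivity (Psi k (dd (Y u)) n w - k%:~R *: Psi (k - 1) (Y u) n w); first by [].
  by rewrite (Psi_dd P_lin gF) ?addrK //; [exact: good_Y | exact: loc_Y].
Qed.

(** a_(-i-1) 1 is T^i a / i!, and T acts on fields as d/dz by [Y_transl]; the scalar is that of the
    divided i-th derivative. *)
Lemma Y_create i a x w : Y (sv_Y S a (- i.+1%:Z) (vac_M K)) x w =
  ((-1) ^+ i * gbinom (ratr x) i) *: Y a (x - i%:R) w.
Proof.
elim: i a x => [|i IH] a x.
  rewrite -(ising_vac hS) sv_create1 gbinom0 mulr1 expr0 scale1r.
  by congr (Y a _ w); rewrite subr0.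
have h : i.+1%:R != 0 :> K by rewrite pnatr_eq0.
apply: (scalerI h); rewrite -(linZ _ _ (Y_lin x w)) sv_create_rec // IH Y_transl /dd !scalerA.
have -> : x - i%:R - 1 = x - i.+1%:R by rewrite -natr1; ring.
congr (_ *: _); rewrite [RHS]mulrCA gbinomS rmorphB /= ratr_nat exprS; ring.
Qed.

Lemma sv_Y_trunc a b : exists l0 : int, forall l, l0 <= l -> sv_Y S a l b = 0.
Proof. exact: sv_trunc. Qed.

Definition jac i a b := forall m l n w, hcoset i m ->
  R P i (Y a) m l (Y b) n w
  = lsum (fun j : nat => gbinom (ratr m) j *: Y (sv_Y S a (l + j%:Z) b) (m + n - j%:R) w).

(** For l >= 0 both sides vanish. For l < 0 the two recursions reduce the claim to n = -1, where it
    is a Vandermonde convolution. *)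
Lemma jac_vac i a : sv_par S i a -> jac i a (vac_M K).
Proof.
move=> ha m l n w hm.
pose T m l n := lsum (fun j : nat =>
  gbinom (ratr m) j *: Y (sv_Y S a (l + j%:Z) (vac_M K)) (m + n - j%:R) w).
rewrite -/(T m l n) Y_vac.
have gi := @good_idf K N; have gA := good_Y a.
have T_rec m' l' n' : T (m' + 1) l' n' = T m' (l' + 1) n' + T m' l' (n' + 1).
  have [l0 hl] := sv_Y_trunc a (vac_M K).
  apply: (@lsum_binom_rec _ _ (fun l x => Y (sv_Y S a l (vac_M K)) x w) l0).
  by move=> l'' x /hl ->; rewrite (lin0 (Y_lin x w)).
have Tge0 m' l' n' : 0 <= l' -> T m' l' n' = 0.
  move=> l0; apply: lsum0 => j; rewrite -(ising_vac hS) sv_create; last by lia.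
  by rewrite (lin0 (Y_lin _ w)) scaler0.
have R0 m' n' : R P i (Y a) m' 0 (@idf K N) n' w = 0.
  rewrite R_l0 /idf /th; case: ifP => _; first by case: (i); rewrite ?PK subrr.
  by rewrite (lin0 (proj1 gA _)) (lin0 P_lin) if_same subr0.
have Rge0 m' (l' : nat) n' : R P i (Y a) m' l'%:Z (@idf K N) n' w = 0.
  by elim: l' m' n' => [|l' IH] m' n'; rewrite ?R0 // -addn1 PoszD (R_rec P_lin) // !IH subr0.
have [l0|l0] := leP 0 l; first by rewrite Tge0 // -(gez0_abs l0) Rge0.
(* For n outside the integers every term on either side is zero, because m already lies in the coset
   of a. Integrality is what makes the induction on shifts of n reach n = -1. *)
have [/intrP[r ->]|nZ] := boolP (n \is a Num.int); last first.
  have nidf (k : int) z : @idf K N (n + k%:~R) z = 0.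
    rewrite /idf; case: eqP => // e; move: nZ.
    rewrite (_ : n = (-1 - k)%:~R) ?intr_int //.
    by rewrite intrB -[LHS](addrK k%:~R) e.
  rewrite /R /R1 /R2 /T !lsum0 ?subr0 // => j.
  - rewrite (@on_coset_Y i) ?scaler0 //.
      have := sv_Y_par (l + j%:Z) ha (sv_par_vac hS).
      by rewrite addbF; apply.
    move=> h; move: nZ.
    rewrite (_ : n = (m + n - j%:R - (i : nat)%:R / 2) - (m - (i : nat)%:R / 2) + j%:Z%:~R).
      by rewrite rpredD ?intr_int // rpredB.
    by field.
  - rewrite /th (_ : l%:~R + n - j%:R = n + (l - j%:Z)%:~R); last by rewrite intrB; ring.
    by rewrite !nidf (lin0 P_lin) if_same scaler0.
  - by rewrite (nidf j%:Z) (lin0 (proj1 gA _)) scaler0.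
have [k ->] : exists k : nat, l = - k%:Z by exists `|l|%N; lia.
elim: k m r {hm} => [|k IH] m r; first by rewrite oppr0 Tge0 // (Rge0 _ 0%N).
(* The recursions of the two sides differ only by the settled case l = -k, so the discrepancy at l =
   -k - 1 is a function of m + n, as [shift_zero] requires. *)
have step m' r' : R P i (Y a) (m' + 1) (- k.+1%:Z) (@idf K N) r'%:~R w - T (m' + 1) (- k.+1%:Z) r'%:~R
   = R P i (Y a) m' (- k.+1%:Z) (@idf K N) (r' + 1)%:~R w - T m' (- k.+1%:Z) (r' + 1)%:~R.
  have := IH m' r'; rewrite (_ : - k%:Z = - k.+1%:Z + 1); last by lia.
  rewrite (R_rec P_lin) // T_rec intrD => /eqP; rewrite subr_eq => /eqP ->.
  by rewrite opprD addrACA subrr add0r.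
have main m' : R P i (Y a) m' (- k.+1%:Z) (@idf K N) (-1) w = T m' (- k.+1%:Z) (-1).
  transitivity (Y a (m' - k.+1%:R) w).
    rewrite /R /R1 /R2 [X in _ - X]lsum0 ?subr0 => [|j].
      rewrite (@lsum_single _ _ _ 0%N) => [|[//|j] _].
        rewrite gbinom0 mulr1 expr0 scale1r addr0 /idf eqxx; congr (Y a _ w).
        by rewrite intrN addrC.
      rewrite /idf -[X in _ == X]addr0 (inj_eq (addrI _)) pnatr_eq0.
      by rewrite (lin0 (proj1 gA _)) scaler0.
    rewrite /th /idf (_ : (_ == _) = false) ?(lin0 P_lin) ?if_same ?scaler0 //.
    apply/negbTE; rewrite -subr_eq0 (_ : _ - _ - -1 = - (k.+1 + j)%:R).
      by rewrite oppr_eq0 pnatr_eq0.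
    by rewrite intrN natrD; ring.
  rewrite /T (@lsumE _ _ k.+1) => [|j hj]; last first.
    rewrite -(ising_vac hS) sv_create; last by lia.
    by rewrite (lin0 (Y_lin _ w)) scaler0.
  (* The coefficient 1 is written as binom(k, k) with k = m' + (k - m'); Vandermonde then produces
     the terms of T, the second factor by [Y_create] and [gbinom_neg]. *)
  transitivity (gbinom (k%:R : K) k *: Y a (m' - k.+1%:R) w).
    by rewrite gbinom_nat binn scale1r.
  have -> : (k%:R : K) = ratr m' + (k%:R - ratr m') by ring.
  rewrite -gbinom_Vandermonde scaler_suml; apply: eq_bigr => j _.
  have jk : (j <= k)%N by rewrite -ltnS.
  have -> : - k.+1%:Z + j%:Z = - (k - j).+1%:Z by lia.
  rewrite Y_create scalerA.
  have -> : m' - 1 - j%:R - (k - j)%:R = m' - k.+1%:R by rewrite natrB // -natr1; ring.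
  congr (_ * _ *: _).
  have -> : ratr (m' - 1 - j%:R) = ratr m' - 1 - j%:R :> K.
    by rewrite !rmorphB /= rmorph1 ratr_nat.
  rewrite gbinom_neg natrB //; congr gbinom; ring.
apply/eqP; rewrite -subr_eq0; apply/eqP.
apply: (@shift_zero _ (fun m r => R P i (Y a) m (- k.+1%:Z) (@idf K N) r%:~R w
  - T m (- k.+1%:Z) r%:~R)) => [|m'] /=; first exact: step.
by rewrite main subrr.
Qed.

End Svoa.
End StateField.

(** * The Jacobi identity for all states *)

Section JacobiStep.
Context {K : numClosedFieldType} {N : lmodType K} (P : N -> N) (F : rat -> N -> N).
Hypotheses (P_lin : linear P) (PK : involutive P).
Hypotheses (gF : good F) (pF : parity_op P true F).
Hypothesis car : forall p q w, half_odd p -> half_odd q ->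
  F p (F q w) + F q (F p w) = (p + q == -1)%:R *: w.
Variables (S : svoa (fock_M K)) (hS : ising_svoa S).
Implicit Types (w : N) (m q n : rat) (l k : int).

Local Notation Y := (state_field P F).
Local Notation rho := (rho P F).
Local Notation jac := (jac P F S).
Local Notation h := (- (1 / 2) : rat).

Let gY b : good (Y b). Proof. exact: good_Y. Qed.

Lemma hcoset_half i m (r : int) : hcoset i m -> hcoset (~~ i) (m + h + r%:~R).
Proof.
rewrite /hcoset /= => hm.
rewrite (_ : _ - _ = m - (i : nat)%:R / 2 + (r - (~~ i : nat)%:Z)%:~R).
  by rewrite rpredD ?intr_int.
by case: (i); rewrite /= intrB; field.
Qed.

Lemma parity_op_Y i a : sv_par S i a -> parity_op P i (Y a).
Proof.
move=> ha n w; rewrite -[RHS](linZ _ _ P_lin).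
have : th P true (Y a) n w = (-1) ^+ i *: Y a n w.
  rewrite (th_Y P_lin PK gF pF car) (sv_parE hS ha).
  by rewrite (linZ _ _ (Y_lin P F n w)).
by rewrite /th => <-; rewrite PK.
Qed.

Lemma psi_state_comm i a c0 : sv_par S i a -> (forall j, (c0 <= j)%N -> psi j%:Z a = 0) ->
  forall q n w, half_odd q ->
  Y a n (F q w) - (-1) ^+ i *: F q (Y a n w)
  = \sum_(c < c0) gbinom (ratr q) c *: (- (-1) ^+ i *: Y (psi c%:Z a) (n + q - c%:R) w).
Proof.
move=> ha hc q n w hq; have := rho_Y P_lin PK gF pF car 0 a n w hq.
rewrite /rho R_l0 (th_Y P_lin PK gF pF car) (sv_parE hS ha) (linZ _ _ (Y_lin P F n _)).
rewrite (@lsumE _ _ c0) => [e|j hj]; last by rewrite hc // (lin0 (Y_lin P F _ w)) scaler0.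
transitivity (- (-1) ^+ i *: (F q (Y a n w) - (-1) ^+ i *: Y a n (F q w))).
  by rewrite scaleNr scalerBr scalerA -expr2 sqrr_sign scale1r opprB.
rewrite e scaler_sumr; apply: eq_bigr => j _.
by rewrite [RHS]scalerA [LHS]scalerA mulrC add0r [n + q]addrC.
Qed.

Lemma jac0 i a : jac i a 0.
Proof.
move=> m l n w _; have Y0 x w' : Y 0 x w' = 0 by exact: (lin0 (Y_lin P F x w')).
have -> : Y 0 = fun _ _ => 0 by apply/funext => x; apply/funext => w'.
rewrite (R_0 P_lin) //; apply/esym/lsum0 => j.
by rewrite (lin0 (sv_linr S a _)) Y0 scaler0.
Qed.

(** The hypothesis on b ranges over all states a, since commuting a with psi brings in the states
    psi_c a. *)
Lemma jac_psi i a b : sv_par S i a -> (forall i a, sv_par S i a -> jac i a b) ->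
  forall k, jac i a (psi k b).
Proof.
move=> ha hb k; have [k0 hk0] := psi_large hS b.
have [d hd] : exists d : nat, k0 <= k + d%:Z by exists `|k0 - k|%N; lia.
elim: d k hd => [|d IHd] k hd.
  by rewrite addr0 in hd; rewrite hk0 //; exact: jac0.
have {}IHd j : jac i a (psi (k + j.+1%:Z) b) by apply: IHd; lia.
move=> m l n w hm.
have Y0 x : Y 0 x w = 0 by exact: (lin0 (Y_lin P F x w)).
have sv0 x l' : sv_Y S x l' 0 = 0 by exact: (lin0 (sv_linr S x l')).
have [J hJ] : exists J, forall j, (J <= j)%N -> psi (k + j%:Z) b = 0.
  by exists `|k0 - k|%N => j hj; apply: hk0; lia.
have [I hI] : exists I, forall j, (I <= j)%N -> sv_Y S a (l + j%:Z) b = 0.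
  have [l0 hl0] := sv_trunc S a b; exists `|l0 - l|%N => j hj; apply: hl0; lia.
have [c0 hc0] : exists c0, forall j, (c0 <= j)%N -> psi j%:Z a = 0.
  have [l0 hl0] := psi_large hS a; exists `|l0|%N => j hj; apply: hl0; lia.
pose s : K := (-1) ^+ i.
pose gq := gbinom (ratr h : K). pose gm := gbinom (ratr m : K).
pose E j x := R P i (Y a) m l (Y (psi (k + j%:Z) b)) x w.
pose T j x := lsum (fun j' : nat => gm j' *:
   Y (sv_Y S a (l + j'%:Z) (psi (k + j%:Z) b)) (m + x - j'%:R) w).
(* By [rho_Y] the residue with t^(-1/2) (t - z)^k against Y b combines the fields of psi_(k+j) b
   with weights gq j. In the identity summed this way the terms j > 0 are [IHd], and gq 0 = 1 leaves
   the term j = 0. *)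
suff main : lsum (fun j : nat => gq j *: E j (n - j%:R)) = lsum (fun j : nat => gq j *: T j (n - j%:R)).
  have fE : fsupp (fun j : nat => gq j *: E j (n - j%:R)).
    exists J => j hj; rewrite /E hJ // (_ : Y 0 = fun _ _ => 0) ?(R_0 P_lin) ?scaler0 //.
    by apply/funext => x; apply/funext => w'; exact: (lin0 (Y_lin P F x w')).
  have fT : fsupp (fun j : nat => gq j *: T j (n - j%:R)).
    exists J => j hj; rewrite /T hJ // lsum0 ?scaler0 // => j'.
    by rewrite sv0 Y0 scaler0.
  move: main; rewrite (lsum_recl fE) (lsum_recl fT).
  rewrite (_ : lsum (fun j : nat => gq j.+1 *: E j.+1 _)
     = lsum (fun j : nat => gq j.+1 *: T j.+1 (n - j.+1%:R))); last first.
    by apply: eq_lsum => j; congr (_ *: _); exact: IHd.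
  by move/addIr; rewrite /gq gbinom0 !scale1r subr0 /E /T addr0.
pose V1 j i' := Y (sv_Y S a (l + i'%:Z) (psi (k + j%:Z) b)) (m + n - (j + i')%:R) w.
pose V2 j i' := Y (psi (k + j%:Z) (sv_Y S a (l + i'%:Z) b)) (m + n - (j + i')%:R) w.
pose V3 c t := Y (sv_Y S (psi c%:Z a) (l + k + t%:Z - c%:Z) b) (m + n - t%:R) w.
pose f j i' := gq j * gm i'.
have f1 : fsupp2 (fun j i' => f j i' *: V1 j i').
  apply: (@fsupp2_nested _ _ _ J) => [j i' hj|j].
    by rewrite /V1 hJ // sv0 Y0 scaler0.
  have [l0 hl0] := sv_trunc S a (psi (k + j%:Z) b); exists `|l0 - l|%N => i' hi'.
  by rewrite /V1 hl0 ?Y0 ?scaler0 //; lia.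
have f2 : fsupp2 (fun j i' => f j i' *: V2 j i').
  apply: fsupp2C; apply: (@fsupp2_nested _ _ _ I) => [i' j hi'|i'].
    by rewrite /V2 hI // (lin0 (@psi_linear K _)) Y0 scaler0.
  have [l0 hl0] := psi_large hS (sv_Y S a (l + i'%:Z) b); exists `|l0 - k|%N => j hj.
  by rewrite /V2 hl0 ?Y0 ?scaler0 //; lia.
have f3 c : exists B, forall t, (B <= t)%N -> V3 c t = 0.
  have [l0 hl0] := sv_trunc S (psi c%:Z a) b; exists `|(l0 - l - k + c%:Z)%R|%N => t ht.
  by rewrite /V3 hl0 ?Y0 //; lia.
have f3' : fsupp2 (fun j i' => f j i' *: \sum_(c < c0) gbinom (k%:~R + j%:R : K) c *: V3 c (j + i')%N).
  have /choice[B hB] := f3; exists (\sum_(c < c0) B c)%N => j i' hj.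
  rewrite big1 ?scaler0 // => c _; rewrite hB ?scaler0 //; apply: leq_trans hj.
  by rewrite (bigD1 c) //= leq_addr.
(* Inside M, [sv_comm] moves a past psi_(k+j): V2 collects the exchanged products, V3 the
   commutators. *)
have RHS1 : lsum (fun j : nat => gq j *: T j (n - j%:R))
   = s *: lsum (fun j => lsum (fun i' => f j i' *: V2 j i'))
   - s *: lsum (fun j => lsum (fun i' =>
       f j i' *: \sum_(c < c0) gbinom (k%:~R + j%:R : K) c *: V3 c (j + i')%N)).
  rewrite -!lsumZ; try exact: fsupp2_lsum.
  rewrite -lsumB; try exact/fsuppZc/fsupp2_lsum.
  apply: eq_lsum => j; rewrite -!lsumZ; try exact: fsupp2_row f2; try exact: fsupp2_row f3'.
    rewrite -lsumB; try exact/fsuppZc/(fsupp2_row _ f2); try exact/fsuppZc/(fsupp2_row _ f3').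
    apply: eq_lsum => i'; rewrite scalerA -/(f j i').
    have -> : m + (n - j%:R) - i'%:R = m + n - (j + i')%:R by rewrite natrD; ring.
    rewrite (sv_comm hS (l + i'%:Z) (k + j%:Z) b ha hc0).
    rewrite (linB _ _ (Y_lin P F _ w)) !(linZ _ _ (Y_lin P F _ w)) scalerBr.
    rewrite [f j i' *: (_ *: _)]scalerA mulrC -scalerA; congr (_ - _).
    rewrite scalerA mulrC -scalerA; congr (_ *: (_ *: _)).
    rewrite (lin_raddf _ _ _ (Y_lin P F _ w)); apply: eq_bigr => c _.
    rewrite (linZ _ _ (Y_lin P F _ w)) intrD /V3.
    by rewrite (_ : l + i'%:Z + (k + j%:Z) - c%:Z = l + k + (j + i')%N%:Z - c%:Z) //; lia.
  have [l0 hl0] := sv_trunc S a (psi (k + j%:Z) b); exists `|l0 - l|%N => i' hi'.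
  by rewrite hl0 ?Y0 ?scaler0 //; lia.
rewrite RHS1 {RHS1}.
pose C c n w := (- s) *: Y (psi c%:Z a) n w.
have LHS1 : lsum (fun j : nat => gq j *: E j (n - j%:R)) = R P i (Y a) m l (rho h k (Y b)) (n - h) w.
  have -> : rho h k (Y b) = fun n' w' => \sum_(j < J) gq j *: Y (psi (k + j%:Z) b) (n' + (h - j%:R)) w'.
    apply/funext => n'; apply/funext => w'.
    rewrite (rho_Y P_lin PK gF pF car k b n' w' half_odd_h) (@lsumE _ _ J) => [|j hj].
      by apply: eq_bigr => j _; rewrite addrA [n' + h]addrC.
    by rewrite hJ // (lin0 (Y_lin P F _ w')) scaler0.
  rewrite (R_sum P_lin) //; last by move=> j; apply/goodZ/good_shift.
  rewrite (@lsumE _ _ J) => [|j hj]; last first.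
    rewrite /E hJ // (_ : Y 0 = fun _ _ => 0) ?(R_0 P_lin) ?scaler0 //.
    by apply/funext => x; apply/funext => w'; exact: (lin0 (Y_lin P F x w')).
  apply: eq_bigr => j _; rewrite (R_Z P_lin) //; last exact: good_shift.
  rewrite (R_shift _ _ _ _ _ _ (Y _)) /E.
  by rewrite addrA subrK.
rewrite LHS1 {LHS1}.
(* The exchanged products are matched by the Jacobi identity for (a, b) under [rho]. *)
have A2 : rho h k (R P i (Y a) m l (Y b)) (n - h) w
   = lsum (fun j => lsum (fun i' => f j i' *: V2 j i')).
  have -> : R P i (Y a) m l (Y b) = fun n' w' => \sum_(i' < I) gm i' *:
      Y (sv_Y S a (l + i'%:Z) b) (n' + (m - i'%:R)) w'.
    apply/funext => n'; apply/funext => w'.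
    rewrite (hb _ _ ha) // (@lsumE _ _ I) => [|j hj].
      by apply: eq_bigr => j _; rewrite addrA [n' + m]addrC.
    by rewrite hI // (lin0 (Y_lin P F _ w')) scaler0.
  rewrite (rho_sum P_lin gF) //; last by move=> j; apply/goodZ/good_shift.
  rewrite [RHS]lsum_exchange // (@lsumE _ _ I) => [|j hj]; last first.
    by apply: lsum0 => j'; rewrite /V2 hI // (lin0 (@psi_linear K _)) Y0 scaler0.
  apply: eq_bigr => i' _; rewrite (rho_Z P_lin gF); last exact: good_shift.
  rewrite (rho_shift _ _ _ _ _ (Y _)) (rho_Y P_lin PK gF pF car _ _ _ _ half_odd_h) -lsumZ.
    apply: eq_lsum => j; rewrite scalerA mulrC; congr (_ *: _); rewrite /V2.
    by congr (Y _ _ _); rewrite natrD; ring.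
  have [l0 hl0] := psi_large hS (sv_Y S a (l + i'%:Z) b); exists `|l0 - k|%N => j hj.
  by rewrite hl0 ?Y0 ?scaler0 //; lia.
have := @R_comm K N P P_lin PK i true (Y a) F C c0 m h l k (Y b) (gY a) gF
  (fun c => goodZ _ (gY _)) (gY b) (parity_op_Y ha) pF.
clear hd d; rewrite andbT -/s => /(_ _ (n - h) w) comm.
have {}comm := comm (fun r t w' => psi_state_comm ha hc0 _ _ (half_oddD t half_odd_h)).
move: comm => /eqP; rewrite subr_eq => /eqP ->; rewrite -A2 addrC; congr (_ + _).
(* The commutator terms of [R_comm] are evaluated by the Jacobi identity for (psi_c a, b);
   [binom_zero] identifies their coefficients with those of the V3 terms. *)
rewrite -scaleNr (_ : lsum (fun j => _) = \sum_(c < c0) \sum_(d < c.+1)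
   (gq d * gbinom k%:~R (c - d)) *: lsum (delay d (fun t => gbinom (ratr (m + h - d%:R)) t *: V3 c (d + t)%N))).
  rewrite scaler_sumr; apply: eq_bigr => c _; rewrite (reindex_inj rev_ord_inj) scaler_sumr.
  apply: eq_bigr => d _ /=; rewrite subSS.
  have dc : (d <= c)%N by rewrite -ltnS.
  rewrite subKn // (R_scale P_lin) // addbT.
  rewrite (hb _ _ (sv_par_psi hS _ ha)); last first.
    by have := hcoset_half (- d%:Z) hm; rewrite intrN => hm'; exact: hm'.
  rewrite [LHS]scalerA [_ * - s]mulrC -[LHS]scalerA; congr (_ *: (_ *: _)).
  rewrite lsum_delay.
    apply: eq_lsum => t; congr (_ *: _); rewrite /V3.
    rewrite (_ : l + k - (c - d)%N%:Z + t%:Z = l + k + (d + t)%N%:Z - c%:Z); last by lia.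
    by congr (Y _ _ _); rewrite natrD; ring.
  have [B hB] := f3 c; exists B => t ht; rewrite hB ?scaler0 //.
  exact: leq_trans ht (leq_addl _ _).
rewrite lsum_antidiag //.
transitivity (lsum (fun t => \sum_(c < c0) \sum_(d < c.+1) (gq d * gbinom k%:~R (c - d)) *:
   delay d (fun t => gbinom (ratr (m + h - d%:R)) t *: V3 c (d + t)%N) t)).
  apply: eq_lsum => t; under eq_bigr => j _ do rewrite scaler_sumr.
  rewrite exchange_big; apply: eq_bigr => c _ /=.
  transitivity ((\sum_(j < t.+1) gbinom (ratr m) (t - j) * gq j * gbinom (k%:~R + j%:R) c) *: V3 c t).
    rewrite scaler_suml; apply: eq_bigr => j _; rewrite subnKC -1?ltnS // scalerA /f.
    by congr (_ *: _); rewrite /gm; ring.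
  rewrite binom_zero scaler_suml big_mkcond; apply: eq_bigr => d _; rewrite /delay.
  case: ifP => dt; last by rewrite scaler0.
  rewrite subnKC // scalerA; congr (_ *: _).
  rewrite rmorphB rmorphD /= ratr_nat /gq; ring.
have fd c d : fsupp (delay d (fun t => gbinom (ratr (m + h - d%:R) : K) t *: V3 c (d + t)%N)).
  apply: delay_fsupp; have [B hB] := f3 c; exists B => t ht; rewrite hB ?scaler0 //.
  exact: leq_trans ht (leq_addl _ _).
rewrite lsum_sum => [|c].
  apply: eq_bigr => c _; rewrite lsum_sum => [|d]; last exact: fsuppZc.
  by apply: eq_bigr => d _; rewrite lsumZ.
have /choice[B hB] := fd c; exists (\sum_(d < c.+1) B d)%N => t ht; apply: big1 => d _.
rewrite hB ?scaler0 //; apply: leq_trans ht.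
by rewrite (bigD1 d) //= leq_addr.
Qed.

Lemma jac_lin i a c b1 b2 : jac i a b1 -> jac i a b2 -> jac i a (c *: b1 + b2).
Proof.
move=> h1 h2 m l n w hm.
have -> : Y (c *: b1 + b2) = fun n w => c *: Y b1 n w + Y b2 n w.
  by apply/funext => x; apply/funext => w'; exact: (Y_lin P F x w').
rewrite (R_D P_lin) //; last exact: goodZ.
rewrite (R_Z P_lin) // h1 // h2 //.
have fs b : fsupp (fun j : nat => gbinom (ratr m) j *: Y (sv_Y S a (l + j%:Z) b) (m + n - j%:R) w).
  have [l0 hl] := sv_trunc S a b; exists `|l0 - l|%N => j hj.
  by rewrite hl ?(lin0 (Y_lin P F _ w)) ?scaler0 //; lia.
rewrite -lsumZ // -lsumD //; last exact: fsuppZc.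
apply: eq_lsum => j; rewrite (sv_linr S a _) (Y_lin P F _ w) scalerDr.
by rewrite !scalerA mulrC.
Qed.

Theorem jac_all i a b : sv_par S i a -> jac i a b.
Proof.
elim/(@psi_fock_ind K): b i a => [|c u v IHu IHv||k u IH] i a ha.
- exact: jac0.
- by apply: jac_lin; [exact: IHu | exact: IHv].
- exact: (jac_vac P_lin PK gF pF car hS).
- by apply: jac_psi.
Qed.

Lemma state_field_jacobi i1 i2 a b w l m n :
  sv_par S i1 a -> sv_par S i2 b -> hcoset i1 m -> hcoset i2 n ->
  \sum_(j \in [set: nat])
    ((-1) ^+ j * gbinom l%:~R j *: Y a (l%:~R + m - j%:R) (Y b (n + j%:R) w))
  - (-1) ^+ (i1 && i2) *: \sum_(j \in [set: nat])
    ((-1) ^ (l + j%:Z) * gbinom l%:~R j *: Y b (l%:~R + n - j%:R) (Y a (m + j%:R) w))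
  = \sum_(j \in [set: nat])
    (gbinom (ratr m) j *: Y (sv_Y S a (l + j%:Z) b) (m + n - j%:R) w).
Proof.
move=> ha hb hm _; rewrite -!/(lsum _) -(jac_all b ha) // /R; congr (_ - _).
rewrite -lsumZ; last exact: (R2_fsupp P_lin false m l n w (gY a) (proj1 (gY b))).
have e x y : th P i1 (Y b) x y = (-1) ^+ (i1 && i2) *: Y b x y.
  case: i1 {ha hm}; last by rewrite /= expr0 scale1r.
  rewrite (th_Y P_lin PK gF pF car) (sv_parE hS hb).
  by rewrite (linZ _ _ (Y_lin P F _ _)).
by apply: eq_lsum => j; rewrite e [LHS]scalerA [RHS]scalerA mulrC.
Qed.

End JacobiStep.

(** * The twisted module N *)

Section RamondField.
Context {K : numClosedFieldType}.
Local Notation N := (fock_N K).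
Implicit Types (w : N) (n p q e : rat) (k : nat) (r : int).

Definition phiq n w : N :=
  if n + 1 / 2 \is a Num.int then phi (Num.floor (n + 1 / 2)) w else 0.

Lemma phiq_int r w : phiq (r%:~R - 1 / 2) w = phi r w.
Proof. by rewrite /phiq subrK intr_int intrKfloor. Qed.

Lemma ann_large w : exists B, forall k, (B <= k)%N -> ann k w = 0.
Proof.
elim/(@fock_ind K): w => [|c u v [a ha] [b hb]||n S _ [a ha]].
- by exists 0%N => k _; rewrite (lin0 (ann_linear k)).
- exists (maxn a b) => k; rewrite geq_max => /andP[ak bk].
  by rewrite ann_linear ha // hb // scaler0 addr0.
- by exists 0%N => k _; rewrite ann_vac.
- exists (maxn a n.+1) => k; rewrite geq_max => /andP[ak nk].
  have /eqP := ann_cre_anticomm k n (ket K S).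
  by rewrite ha // (lin0 (cre_linear n)) addr0 gtn_eqF // scale0r => /eqP.
Qed.

Lemma phi_large w : exists r0 : int, forall r, r0 <= r -> phi r w = 0.
Proof.
have [B hB] := ann_large w; exists (B.+1)%:Z => -[[|r]|r] hr //=; try lia.
by apply: hB; lia.
Qed.

Lemma good_phiq : good phiq.
Proof.
split=> [n c u v|w]; rewrite /phiq; first by case: ifP; rewrite ?phi_linear ?scaler0 ?addr0.
have [r0 h] := phi_large w; exists r0%:~R => n hn; case: ifP => // ni.
by apply: h; rewrite floor_ge_int_tmp (le_trans hn) // lerDl.
Qed.

Lemma parity_phi r w : phi r (par w) = - par (phi r w).
Proof.
case: r => [[|r]|r] /=; rewrite ?par_cre ?par_ann ?opprK //.
by rewrite (linD _ _ par_linear) (linZ _ _ par_linear) par_cre par_ann scalerN -opprD opprK.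
Qed.

Lemma parity_phiq : parity_op par true phiq.
Proof.
move=> n w; rewrite /phiq; case: ifP => _; last by rewrite (lin0 par_linear) scaler0.
by rewrite parity_phi scaleN1r.
Qed.

Lemma phiq_car p q w : half_odd p -> half_odd q ->
  phiq p (phiq q w) + phiq q (phiq p w) = (p + q == -1)%:R *: w.
Proof.
move=> [r ->] [s ->]; rewrite !phiq_int phi_anticomm.
have -> : r%:~R - 1 / 2 + (s%:~R - 1 / 2) = (r + s)%:~R - 1 :> rat by rewrite intrD; field.
by have -> : ((r + s)%:~R - 1 == -1 :> rat) = (r + s == 0)
  by rewrite -subr_eq0 opprK subrK intr_eq0.
Qed.

Definition Yn : fock_M K -> rat -> N -> N := state_field par phiq.

Definition wtN (S : {fset nat}) : nat := \sum_(j <- S) j.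

Definition wtM (S : {fset nat}) : rat := \sum_(j <- S) (j%:R + 1 / 2).

(** A rational degree lets mode shifts be written without side conditions; by [homN_nat] nonzero
    vectors occur only in natural degrees. *)
Definition homN e : set N := [set w | forall S, fval w S != 0 -> (wtN S)%:R = e].

Lemma homN_subspace e : subspace (homN e).
Proof.
split=> [|c u v]; rewrite !inE; first by move=> S; rewrite (_ : fval _ S = 0) ?eqxx.
move=> hu hv S; rewrite (_ : fval _ S = c * fval u S + fval v S) // => h; have [u0|] := eqVneq (fval u S) 0; last exact: hu.
by apply: hv; apply: contraNN h => /eqP ->; rewrite u0 mulr0 addr0.
Qed.

Lemma wtN_U k S : k \notin S -> wtN (k |` S)%fset = (k + wtN S)%N.
Proof. by move=> kS; rewrite /wtN big_fsetU1. Qed.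

Lemma wtN_D k S : k \in S -> wtN S = (k + wtN (S `\ k)%fset)%N.
Proof. by move=> kS; rewrite /wtN (big_fsetD1 k). Qed.

Lemma homN_cre e k w : homN e w -> homN (e + k%:R) (cre k w).
Proof.
move=> h S; rewrite fcre /cre_fun; case: ifP; rewrite ?eqxx // => kS.
by rewrite mulf_eq0 negb_or => /andP[_ /h <-]; rewrite (wtN_D kS) natrD addrC.
Qed.

Lemma homN_ann e k w : homN e w -> homN (e - k%:R) (ann k w).
Proof.
move=> h S; rewrite fann /ann_fun; case: ifPn; rewrite ?eqxx // => kS.
rewrite mulf_eq0 negb_or => /andP[_ /h <-]; rewrite (wtN_U kS) natrD.
by rewrite addrAC subrr add0r.
Qed.

Lemma subspace_lin (V : lmodType K) (U : set V) c u v : subspace U -> U u -> U v -> U (c *: u + v).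
Proof. by move=> [_ /(_ c u v)]; rewrite !inE; apply. Qed.

Lemma subspace0 (V : lmodType K) (U : set V) : subspace U -> U 0.
Proof. by move=> [h _]; move: h; rewrite inE. Qed.

Lemma subspaceD (V : lmodType K) (U : set V) u v : subspace U -> U u -> U v -> U (u + v).
Proof. by move=> sU Uu Uv; rewrite -[u]scale1r; exact: subspace_lin. Qed.

Lemma subspaceZ (V : lmodType K) (U : set V) c u : subspace U -> U u -> U (c *: u).
Proof. by move=> sU Uu; rewrite -[c *: u]addr0; apply: subspace_lin => //; exact: subspace0. Qed.

Lemma subspaceB (V : lmodType K) (U : set V) u v : subspace U -> U u -> U v -> U (u - v).
Proof. by move=> sU Uu Uv; rewrite -scaleN1r addrC; exact: subspace_lin. Qed.

Lemma subspace_sum (V : lmodType K) (U : set V) (I : Type) (r : seq I) (p : pred I) (G : I -> V) :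
  subspace U -> (forall i, p i -> U (G i)) -> U (\sum_(i <- r | p i) G i).
Proof.
move=> sU h; elim/big_ind: _ => //; first exact: subspace0.
by move=> x y; exact: subspaceD.
Qed.

Lemma subspace_lsum (V : lmodType K) (U : set V) (G : nat -> V) :
  subspace U -> (forall i, U (G i)) -> U (lsum G).
Proof. by move=> sU h; rewrite /lsum; apply: subspace_sum. Qed.

Lemma homN0 e : homN e (0 : N).
Proof. exact: (subspace0 (homN_subspace e)). Qed.

Lemma homN_vac : homN 0 (vac_N K).
Proof.
move=> S; rewrite /vac_N /fvac fval_ket; have [->|_] := eqVneq S fset0; last by rewrite eqxx.
by rewrite /wtN big_seq_fset0.
Qed.

Lemma homN_phi e r w : homN e w -> homN (e - r%:~R) (phi r w).
Proof.
move=> h; case: r => [[|r]|r] /=.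
- rewrite subr0 addrC; apply: (subspace_lin _ (homN_subspace e)).
    by have := homN_ann (k := 0%N) h; rewrite subr0.
  by have := homN_cre (k := 0%N) h; rewrite addr0.
- exact: homN_ann.
- by rewrite NegzE intrN opprK; exact: homN_cre.
Qed.

Lemma homN_par e w : homN e w -> homN e (par w).
Proof. by move=> h S; rewrite fdiag mulf_eq0 negb_or => /andP[_ /h]. Qed.

Definition homfield d (X : rat -> N -> N) := forall n e w, homN e w -> homN (e + d - n - 1) (X n w).

Lemma homfield_idf : homfield 0 (@idf K N).
Proof.
move=> n e w h; rewrite /idf; case: eqP => [->|_]; last exact: homN0.
by rewrite addr0 opprK addrK.
Qed.

Lemma homfield_phiq : homfield (1 / 2) phiq.
Proof.
move=> n e w h; rewrite /phiq; case: ifP => [|_]; last exact: homN0.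
move=> /floorK hn; have := homN_phi (r := Num.floor (n + 1 / 2)) h.
by rewrite hn; congr (homN _ _); field.
Qed.

Lemma homfield_Psi d (k : int) X : homfield d X -> homfield (d - k%:~R - 1 / 2) (Psi par phiq k X).
Proof.
move=> hX n e w hw; have sub := homN_subspace (e + (d - k%:~R - 1 / 2) - n - 1).
apply: (subspace_lsum sub) => i; apply: (subspaceZ _ sub); apply: (subspaceB sub).
  apply: (subspace_lsum sub) => j; apply: (subspaceZ _ sub).
  have := homfield_phiq (n := (k + i%:Z)%:~R + - (1 / 2) - j%:R)
    (hX (n + (1 / 2 - i%:R) + j%:R) _ _ hw).
  by congr (homN _ _); rewrite intrD; field.
apply: (subspace_lsum sub) => j; apply: (subspaceZ _ sub).
have := homN_par (hX ((k + i%:Z)%:~R + (n + (1 / 2 - i%:R)) - j%:R) _ _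
  (homN_par (homfield_phiq (n := - (1 / 2) + j%:R) hw))).
by congr (homN _ _); rewrite intrD; field.
Qed.

Lemma wtM_U k S : k \notin S -> wtM (k |` S)%fset = k%:R + 1 / 2 + wtM S.
Proof. by move=> kS; rewrite /wtM big_fsetU1. Qed.

Lemma homfield_ket S : homfield (wtM S) (Yn (ket K S)).
Proof.
elim/ket_ind: S => [|n S nS IH].
  rewrite /wtM big_seq_fset0 (_ : Yn _ = @idf K N); first exact: homfield_idf.
  exact: Y_vac.
have -> : ket K (n |` S)%fset = psi (Negz n) (ket K S) by rewrite -cre_ket.
rewrite /Yn (Y_psi par_linear (@parK K) good_phiq parity_phiq phiq_car).
have nS' : n \notin S by apply/negP => /nS; rewrite ltnn.
have := homfield_Psi (k := Negz n) IH; rewrite wtM_U //; congr (homfield _ _).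
by rewrite NegzE intrN -natr1; field.
Qed.

Lemma homN_nat e w : homN e w -> w = 0 \/ exists2 t : nat, e = t%:R & homN t%:R w.
Proof.
move=> h; have [[S hS]|hn] := pselect (exists S, fval w S != 0).
  by right; exists (wtN S); rewrite (h S hS).
left; apply: fvalP => S; rewrite [RHS](_ : _ = 0) //; apply/eqP; apply: contrapT => hS.
by apply: hn; exists S; apply/negP.
Qed.

Definition wt_proj (t : nat) : N -> N := diag (fun S => (wtN S == t)%:R).

Lemma homN_proj t w : homN t%:R (wt_proj t w).
Proof.
move=> S; rewrite fdiag; have [->//|_] := eqVneq (wtN S) t.
by rewrite mul0r eqxx.
Qed.

Lemma sum_proj w : exists B, w = \sum_(t <- iota 0 B) wt_proj t w.
Proof.
pose A := fset_set [set S | fval w S != 0]; exists (\max_(S <- A) wtN S).+1.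
apply: fvalP => S; rewrite fval_sum.
have [w0|w0] := eqVneq (fval w S) 0.
  by rewrite w0 big1 // => t _; rewrite fdiag w0 mulr0.
have SA : S \in A by rewrite in_fset_set ?inE //; exact: fval_fin.
have Sr : wtN S \in iota 0 (\max_(S <- A) wtN S).+1.
  by rewrite mem_iota /= add0n ltnS; apply: (@leq_bigmax_seq _ _ _ wtN).
rewrite (bigD1_seq _ Sr (iota_uniq 0 _)) fdiag eqxx mul1r big1 => [|t tS].
  by rewrite [RHS]addr0.
by rewrite fdiag eq_sym (negbTE tS) mul0r.
Qed.

Lemma homN_direct : direct_sum (fun t : nat => homN t%:R).
Proof.
split=> [t|w|s f us hf h t ts]; first exact: homN_subspace.
  have [B e] := sum_proj w; exists (iota 0 B), (fun t => wt_proj t w); split=> // t.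
  exact: homN_proj.
apply: fvalP => S; rewrite (_ : fval 0 S = 0) //; have [->//|f0] := eqVneq (fval (f t) S) 0.
have : fval (\sum_(i <- s) f i) S = 0 by rewrite h.
rewrite fval_sum (bigD1_seq t) //= big1 ?addr0 // => i it.
apply/eqP; apply: contraTT it => /(hf i) e; rewrite negbK.
by have := hf t S f0; rewrite e => /eqP; rewrite eqr_nat.
Qed.

End RamondField.

(** * Conformal weights, the module structure on N and its psi modes *)

Section TwistedFock.
Context {K : numClosedFieldType}.
Local Notation M := (fock_M K).
Local Notation N := (fock_N K).
Variables (S : svoa M) (hS : ising_svoa S).

Lemma lsum_gbinom0 (V : lmodType K) (c : nat -> K) (G : nat -> V) :
  lsum (fun j : nat => (c j * gbinom (0%:~R : K) j) *: G j) = c 0%N *: G 0%N.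
Proof.
rewrite (@lsum_single _ _ _ 0%N); first by rewrite gbinom0 mulr1.
by case=> // j _; rewrite (gbinom0S (K := K)) mulr0 scale0r.
Qed.

Lemma lsum_gbinom0' (V : lmodType K) (G : nat -> V) :
  lsum (fun j : nat => gbinom (0%:~R : K) j *: G j) = G 0%N.
Proof.
rewrite (@lsum_single _ _ _ 0%N); first by rewrite gbinom0 scale1r.
by case=> // j _; rewrite (gbinom0S (K := K)) scale0r.
Qed.

Local Notation om := (sv_vir S).

Lemma psi_psi_state (n : int) : psi n (psi_state K) = (n == 0)%:R *: vac_M K + (n < 0)%R%:R *: psi n (psi_state K).
Proof.
case: (ltrgtP n 0) => [n0|n0|->].
- by rewrite scale0r add0r scale1r.
- rewrite !scale0r addr0; have /eqP := psi_anticomm n (-1) (vac_M K).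
  rewrite (@psi_vac K n) ?(lin0 (@psi_linear K _)) ?addr0; last by lia.
  by rewrite (_ : n + -1 + 1 == 0 = false) ?scale0r; [move/eqP | apply/eqP; lia].
- rewrite scale0r addr0; have /eqP := psi_anticomm 0 (-1) (vac_M K).
  by rewrite (@psi_vac K 0) // (lin0 (@psi_linear K _)) addr0 => /eqP ->.
Qed.

Lemma psi_psi_state_gt0 (n : int) : 0 < n -> psi n (psi_state K) = 0.
Proof.
move=> n0; rewrite psi_psi_state gt_eqF // (_ : (n < 0) = false); last by lia.
by rewrite !scale0r addr0.
Qed.

Lemma psi_psi_state0 : psi 0 (psi_state K) = vac_M K.
Proof. by rewrite psi_psi_state eqxx ltxx scale1r scale0r addr0. Qed.

Lemma vir1_psi_state : sv_Y S om 1 (psi_state K) = 2^-1 *: psi_state K.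
Proof.
rewrite (ising_vir hS) /omega_M.
rewrite (linZ _ _ (fun c u v => sv_linl S 1 (psi_state K) c u v)); congr (_ *: _).
have hp := par_psi_state hS.
(* With m = 0 the right-hand side is the single mode (psi_(-2) psi)_1, which is L_0 up to the factor
   1/2 of omega. *)
have := sv_jacobi (psi_state K) (-2) 0 1 hp hp.
rewrite -!/(lsum _) lsum_gbinom0' !(svY_psi hS) !addr0 !add0r => <-.
rewrite lsum0 => [|j]; last first.
  by rewrite !(svY_psi hS) psi_psi_state_gt0 ?(lin0 (@psi_linear K _)) ?scaler0 //; lia.
rewrite (@lsum_single _ _ _ 0%N) => [|j j0]; last first.
  rewrite !(svY_psi hS) add0r psi_psi_state_gt0 ?(lin0 (@psi_linear K _)) ?scaler0 //.
  by lia.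
rewrite !(svY_psi hS) !addr0 psi_psi_state0 gbinom0 mulr1 sub0r.
rewrite expr1 scaleN1r opprK.
by rewrite -[(-1) ^ (-2)]/(((-1) ^+ 2)^-1) sqrrN expr1n invr1 scale1r.
Qed.

Lemma L0_psi n b : sv_Y S om 1 (psi n b) = psi n (sv_Y S om 1 b) - (n%:~R + 2^-1) *: psi n b.
Proof.
have := sv_jacobi b 0 1 n (sv_vir_even S) (par_psi_state hS).
rewrite -!/(lsum _) !lsum_gbinom0 !addr0 !expr0 !scale1r !add0r !(svY_psi hS).
rewrite ?expr0z ?scale1r (@lsumE _ _ 2) => [|j hj]; last by rewrite gbinom_small ?scale0r.
rewrite big_ord_recl big_ord1 /= -[bump 0 0]/1%N gbinom0 gbinom1 !scale1r addr0 subr0.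
rewrite vir1_psi_state sv_deriv (linZ _ _ (fun c u v => sv_linl S _ b c u v)) !(svY_psi hS).
rewrite [1 + n]addrC addrK => /eqP; rewrite subr_eq => /eqP ->; rewrite [LHS]addrC; congr (_ + _).
by rewrite -scalerDl -scaleNr; congr (_ *: _); rewrite intrD; field.
Qed.

Lemma L0_ket T : sv_Y S om 1 (ket K T) = ratr (wtM T) *: ket K T.
Proof.
elim/ket_ind: T => [|n T nT IH].
  rewrite /wtM big_seq_fset0 rmorph0 scale0r.
  by rewrite -[ket K fset0]/(vac_M K) -(ising_vac hS); exact: sv_create.
have -> : ket K (n |` T)%fset = psi (Negz n) (ket K T) by rewrite -cre_ket.
have nT' : n \notin T by apply/negP => /nT; rewrite ltnn.
rewrite L0_psi IH (linZ _ _ (@psi_linear K _)) -scalerBl wtM_U //; congr (_ *: _).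
rewrite NegzE intrN -natr1 !rmorphD /= ratr_nat.
have -> : ratr (1 / 2) = 2^-1 :> K by rewrite fmorph_div /= rmorph1 ratr_nat div1r.
by field.
Qed.

Lemma L0_diag a : sv_Y S om 1 a = diag (fun T => ratr (wtM T)) a.
Proof.
elim/(@fock_ind K): a => [|c u v IHu IHv||n T nT _].
- by rewrite (lin0 (sv_linr S _ _)) (lin0 (diag_linear _)).
- by rewrite (sv_linr S _ _) IHu IHv diag_linear.
- by rewrite [LHS]L0_ket diag_ket.
- by rewrite cre_ket // L0_ket diag_ket.
Qed.

Lemma weight_supp d a T : weight_space S d a -> fval a T != 0 -> wtM T = d.
Proof.
rewrite /weight_space /eigensp /= L0_diag => e aT.
have := congr1 (fun u : M => fval u T) e; rewrite fdiag fvalZ => /(mulIf aT).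
exact: fmorph_inj.
Qed.

Lemma Yn_lin n w : linear (fun a => @Yn K a n w).
Proof. exact: Y_lin. Qed.

Lemma homfield_weight d a : weight_space S d a -> homfield d (Yn a).
Proof.
move=> ha n e w hw; rewrite (fock_span a).
have -> : Yn (\sum_(T <- fset_set [set T | fval a T != 0]) fval a T *: ket K T) n w =
   \sum_(T <- fset_set [set T | fval a T != 0]) fval a T *: Yn (ket K T) n w.
  rewrite (lin_raddf _ _ _ (Yn_lin n w)); apply: eq_bigr => T _.
  by rewrite (linZ _ _ (Yn_lin n w)).
rewrite big_seq; apply: (subspace_sum _ (homN_subspace _)) => T hT.
apply: (subspaceZ _ (homN_subspace _)); rewrite -(weight_supp ha (T := T)).
  exact: homfield_ket.
by move: hT; rewrite in_fset_set ?inE //; exact: fval_fin.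
Qed.

Let ps := @par_linear K.
Let pk := @parK K.
Let gph := @good_phiq K.
Let pph := @parity_phiq K.
Let cph := @phiq_car K.

Lemma Yn_vac n (w : N) : Yn (sv_vac S) n w = if n == -1 then w else 0.
Proof. by rewrite (ising_vac hS) /Yn Y_vac. Qed.

Lemma Yn_gr d a n s (w : N) : weight_space S d a -> homN s%:R w ->
  graded_piece (fun t : nat => homN t%:R) (s%:R + d - n - 1) (Yn a n w).
Proof.
move=> ha hw; have [->|[t e ht]] := homN_nat (homfield_weight ha (n := n) hw); first by left.
by right; exists t.
Qed.

Definition TN : twisted_module S N := @TwistedModule K M S N
  (fun t : nat => homN t%:R) Yn homN_direct
  (fun n w => Y_lin par phiq n w)
  (fun a n => proj1 (good_Y ps pk gph pph cph a) n)
  (fun i a n w ha hn => on_coset_Y ps pk gph pph cph hS ha w hn)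
  (fun a w => proj2 (good_Y ps pk gph pph cph a) w)
  Yn_vac Yn_gr
  (fun i1 i2 a b w l m n => @state_field_jacobi K N par phiq ps pk gph pph cph S hS i1 i2 a b w l m n).

Lemma Yn_psi_state r (w : N) : Yn (psi_state K) (r%:~R - 1 / 2) w = phi r w.
Proof.
have hq : half_odd (r%:~R - 1 / 2) by exists r.
have hq' : half_odd (1%:~R + (r%:~R - 1 / 2)) by exact: half_oddD.
(* With l = -1 and b = 1 only j = 0 survives on the right, since psi_j 1 = 0 for j >= 0. On the left
   the mode of index l + q = r - 1/2 meets the identity field at its only index n = -1. *)
have := rho_Y ps pk gph pph cph (-1) (vac_M K) (-1) w hq'.
rewrite (@lsum_single _ _ _ 0%N) => [|[//|j] _]; last first.
  rewrite (_ : -1 + j.+1%:Z = j%:Z); last by lia.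
  by rewrite psi_vac // (lin0 (Y_lin _ _ _ w)) scaler0.
rewrite gbinom0 scale1r addr0 [_ - 0%:R]subr0 [1%:~R + _]addrC addrK => e.
transitivity (state_field par phiq (psi (-1) (vac_M K)) (r%:~R - 1 / 2) w); first by [].
rewrite -e.
rewrite (Y_vac par phiq) /rho /R /R1 /R2 [X in _ - X]lsum0 ?subr0 => [|j].
  rewrite (@lsum_single _ _ _ 0%N) => [|[//|j] _].
    rewrite gbinom0 mulr1 expr0 scale1r addr0 [_ - 0%:R]subr0 /idf eqxx.
    rewrite (_ : _ + _ = r%:~R - 1 / 2) ?phiq_int //.
    by rewrite intrN; ring.
  rewrite /idf -[X in _ == X]addr0 (inj_eq (addrI _)) pnatr_eq0.
  by rewrite (lin0 (proj1 gph _)) scaler0.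
rewrite /th /idf (_ : (_ == _) = false) ?(lin0 ps) ?scaler0 //.
apply/negbTE; rewrite -subr_eq0 (_ : _ - _ - -1 = - j.+1%:R).
  by rewrite oppr_eq0 pnatr_eq0.
by rewrite intrN -natr1; ring.
Qed.

End TwistedFock.

(** * Virasoro submodules of N *)

Section VirasoroGeneration.
Context {K : numClosedFieldType}.
Local Notation M := (fock_M K).
Local Notation N := (fock_N K).
Implicit Types (u w : N) (U : set N) (r n : int).

Lemma phi_lin r : linear (@phi K r). Proof. exact: phi_linear. Qed.

Definition phi_stable U := subspace U /\ forall r w, U w -> U (phi r w).

Lemma phi_generation U : phi_stable U -> U (vac_N K) -> forall w, U w.
Proof.
move=> [sU pU] Uv; elim/(@fock_ind K) => //.
- exact: subspace0 sU.
- by move=> c u v; exact: subspace_lin.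
move=> [|n] T nT Uk; last exact: (pU (Negz n)).
have T0 : T = fset0.
  by apply/fsetP => j; rewrite in_fset0; apply/negbTE/negP => /nT; rewrite ltn0.
have := pU 0 _ Uk; rewrite /= ann_ket ?scaler0 ?addr0 //.
by rewrite T0 in_fset0.
Qed.

Lemma phi0E u : phi 0 u = cre 0 u + 2^-1 *: ann 0 u. Proof. by []. Qed.

Lemma phi0_vac : phi 0 (vac_N K) = ket K [fset 0%N]%fset.
Proof.
rewrite phi0E /vac_N ann_vac scaler0 addr0 /fvac cre_ket; last by move=> m; rewrite inE.
by congr ket; apply/fsetP => j; rewrite !inE orbF.
Qed.

(** [ann k.+1] reads off the coefficients on the sets containing k.+1; only the empty set and {0}
    escape all of them. *)
Lemma vacuum_vector w : (forall k, ann k.+1 w = 0) ->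
  w = fval w fset0 *: vac_N K + fval w [fset 0%N]%fset *: phi 0 (vac_N K).
Proof.
move=> h; have w0 T k : k.+1 \in T -> fval w T = 0.
  move=> kT; have : fval (ann k.+1 w) (T `\ k.+1)%fset = 0 by rewrite h.
  rewrite fann /ann_fun !inE eqxx /= fsetD1K // => /eqP.
  by rewrite mulf_eq0 signr_eq0 /= => /eqP.
rewrite phi0_vac; apply: fvalP => T.
transitivity (fval w fset0 * (T == fset0)%:R + fval w [fset 0%N]%fset * (T == [fset 0%N]%fset)%:R);
  last by [].
have [->|T0] := eqVneq T fset0.
  rewrite mulr1 (_ : (_ == _) = false) ?mulr0 ?addr0 //.
  by apply/negbTE/eqP => /fsetP/(_ 0%N); rewrite !inE.
have [->|T1] := eqVneq T [fset 0%N]%fset; first by rewrite mulr0 add0r mulr1.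
rewrite !mulr0 addr0; have [|k] := fset_0Vmem T; first by move/eqP; rewrite (negbTE T0).
have [[|k'] kT nk] : exists2 k', k' \in T & (T = [fset 0%N]%fset -> False).
  by case: k => k kT; exists k => // e'; rewrite e' eqxx in T1.
  have [k2 k2T] : exists k2, k2.+1 \in T.
    apply: contrapT => h'; apply: nk; apply/fsetP => j; rewrite !inE.
    case: j => [|j]; first by rewrite kT.
    by apply/negbTE/negP => jT; apply: h'; exists j.
  exact: w0 k2T.
exact: w0 kT.
Qed.

Lemma vacuum_hom (e : rat) w : e != 0 -> homN e w -> (forall k, ann k.+1 w = 0) -> w = 0.
Proof.
move=> e0 hw h; rewrite (vacuum_vector h).
have f T : (wtN T = 0)%N -> fval w T = 0.
  move=> T0; apply/eqP; apply: contraNT e0 => /hw <-.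
  by rewrite T0.
rewrite !f ?scale0r ?addr0 //; first by rewrite /wtN big_seq_fset1.
by rewrite /wtN big_seq_fset0.
Qed.

Lemma commutant_scalar (Z : N -> N) c : linear Z -> (forall r w, Z (phi r w) = phi r (Z w)) ->
  Z (vac_N K) = c *: vac_N K -> forall w, Z w = c *: w.
Proof.
move=> lZ Zphi Zv; apply: (@phi_generation [set w | Z w = c *: w]) => //; split.
  split=> [|d u v]; rewrite !inE /=; first by rewrite (lin0 lZ) scaler0.
  by move=> hu hv; rewrite lZ hu hv scalerDr !scalerA mulrC.
by move=> r w /= hw; rewrite Zphi hw (linZ _ _ (phi_lin r)).
Qed.

Section Lvir.
Variable n : int.

Lemma Lvir_index : exists k1 : int, forall k : int, (- n < k * 2) = (k1 <= k).
Proof. by exists ((- n %/ 2)%Z + 1) => k; lia. Qed.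

Definition Lterm (k : int) u : N := (n + 2 * k)%:~R *: phi (- k) (phi (n + k) u).

Lemma Lterm_fsupp (k1 : int) u : fsupp (fun j : nat => Lterm (k1 + j%:Z) u).
Proof.
have [r0 h] := phi_large u; exists `|(r0 - n - k1)%R|%N => j hj.
by rewrite /Lterm h ?(lin0 (phi_lin _)) ?scaler0 //; lia.
Qed.

Lemma Lvir_lsum (k1 : int) u : (forall k : int, (- n < k * 2) = (k1 <= k)) ->
  Lvir n u = ((n == 0)%:R / 16) *: u + 2^-1 *: lsum (fun j : nat => Lterm (k1 + j%:Z) u).
Proof.
move=> hk1; rewrite /Lvir; congr (_ + _ *: _).
rewrite /lsum (reindex_fsbig (fun j : nat => k1 + j%:Z) [set: nat]) //.
split.
- by move=> j _ /=; rewrite hk1; lia.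
- by move=> i j _ _ /=; lia.
- move=> k /=; rewrite hk1 => hk; exists `|k - k1|%N => //.
  by lia.
Qed.

Lemma Lterm_phi k r u : Lterm k (phi r u) = phi r (Lterm k u)
  + (n + 2 * k)%:~R *: ((n + k + r == 0)%:R *: phi (- k) u - (r - k == 0)%:R *: phi (n + k) u).
Proof.
rewrite /Lterm (linZ _ _ (phi_lin r)) -scalerDr; congr (_ *: _).
have e1 : phi (n + k) (phi r u) = (n + k + r == 0)%:R *: u - phi r (phi (n + k) u).
  by rewrite -phi_anticomm addrK.
have e2 v : phi (- k) (phi r v) = (- k + r == 0)%:R *: v - phi r (phi (- k) v).
  by rewrite -phi_anticomm addrK.
by rewrite e1 (linB _ _ (phi_lin _)) (linZ _ _ (phi_lin _)) e2 opprB addrCA [- k + r]addrC.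
Qed.

Lemma Lvir_phi r u : Lvir n (phi r u) = phi r (Lvir n u) - (2^-1 * (n + 2 * r)%:~R) *: phi (n + r) u.
Proof.
have [k1 hk1] := Lvir_index; rewrite !(Lvir_lsum _ hk1).
rewrite (linD _ _ (phi_lin r)) !(linZ _ _ (phi_lin r)) -addrA; congr (_ + _).
rewrite -scalerA -scalerBr; congr (_ *: _); rewrite (lsum_lin (phi_lin r)); last exact: Lterm_fsupp.
have fs : fsupp (fun j : nat => phi r (Lterm (k1 + j%:Z) u)).
  by apply: fsupp_sub (Lterm_fsupp k1 u) _ => j ->; exact: (lin0 (phi_lin r)).
pose A (j : nat) := ((n + 2 * (k1 + j%:Z))%:~R * (n + (k1 + j%:Z) + r == 0)%:R) *: phi (- (k1 + j%:Z)) u.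
pose B (j : nat) := ((n + 2 * (k1 + j%:Z))%:~R * (r - (k1 + j%:Z) == 0)%:R) *: phi (n + (k1 + j%:Z)) u.
have fA : fsupp A.
  exists `|(n + r + k1)%R|.+1%N => j hj; rewrite /A (_ : (_ == 0) = false) ?mulr0 ?scale0r //.
  by apply/eqP; lia.
have fB : fsupp B.
  exists `|(r - k1)%R|.+1%N => j hj; rewrite /B (_ : (_ == 0) = false) ?mulr0 ?scale0r //.
  by apply/eqP; lia.
transitivity (lsum (fun j => phi r (Lterm (k1 + j%:Z) u)) + (lsum A - lsum B)).
  rewrite -lsumB // -lsumD //; last exact/fsuppD/fsuppN.
  by apply: eq_lsum => j; rewrite Lterm_phi scalerBr !scalerA.
congr (_ + _).
have eA : lsum A = if k1 <= - n - r then (- (n + 2 * r))%:~R *: phi (n + r) u else 0.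
  case: ifP => h.
    rewrite (@lsum_single _ _ _ `|(- n - r - k1)%R|%N) => [|j jn]; last first.
      by rewrite /A (_ : (_ == 0) = false) ?mulr0 ?scale0r //; apply/eqP; lia.
    have e : k1 + (`|(- n - r - k1)%R|%N)%:Z = - n - r by lia.
    rewrite /A e (_ : n + (- n - r) + r = 0); last by lia.
    rewrite eqxx mulr1 (_ : - (- n - r) = n + r); last by lia.
    by congr (_%:~R *: _); lia.
  apply: lsum0 => j; rewrite /A (_ : (_ == 0) = false) ?mulr0 ?scale0r //.
  by apply/eqP; lia.
have eB : lsum B = if k1 <= r then (n + 2 * r)%:~R *: phi (n + r) u else 0.
  case: ifP => h.
    rewrite (@lsum_single _ _ _ `|(r - k1)%R|%N) => [|j jn]; last first.
      by rewrite /B (_ : (_ == 0) = false) ?mulr0 ?scale0r //; apply/eqP; lia.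
    have e : k1 + (`|(r - k1)%R|%N)%:Z = r by lia.
    by rewrite /B e subrr eqxx mulr1.
  apply: lsum0 => j; rewrite /B (_ : (_ == 0) = false) ?mulr0 ?scale0r //.
  by apply/eqP; lia.
rewrite eA eB -!hk1.
(* Contractions occur at k = -n - r and at k = r, with the same contribution. Exactly one of these k
   exceeds -n/2, unless 2r = -n; then neither does, and the coefficient n + 2r is zero. *)
have [h|h|h] := ltgtP (- n) (r * 2).
- by rewrite (_ : (- n < (- n - r) * 2) = false) ?sub0r //; lia.
- by rewrite (_ : (- n < (- n - r) * 2) = true) ?subr0 ?intrN ?scaleNr //; lia.
- rewrite (_ : (- n < (- n - r) * 2) = false); last by lia.
  by rewrite (_ : n + 2 * r = 0) ?mulr0z ?scale0r ?subrr ?oppr0 //; lia.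
Qed.

Lemma Lvir_linear : linear (@Lvir K n).
Proof.
have [k1 hk1] := Lvir_index; move=> c u v; rewrite !(Lvir_lsum _ hk1).
have -> : lsum (fun j : nat => Lterm (k1 + j%:Z) (c *: u + v))
  = c *: lsum (fun j : nat => Lterm (k1 + j%:Z) u) + lsum (fun j : nat => Lterm (k1 + j%:Z) v).
  rewrite -lsumZ; last exact: Lterm_fsupp.
  rewrite -lsumD; [|exact/fsuppZc/Lterm_fsupp|exact: Lterm_fsupp].
  apply: eq_lsum => j; rewrite /Lterm !phi_linear scalerDr !scalerA.
  by rewrite mulrC.
rewrite !scalerDr !scalerA [_ * c]mulrC [2^-1 * c]mulrC addrACA.
by [].
Qed.

Lemma Lvir_phi_stable U u : phi_stable U -> U u -> U (Lvir n u).
Proof.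
move=> [sU pU] Uu; have [k1 hk1] := Lvir_index; rewrite (Lvir_lsum _ hk1).
apply: (subspace_lin _ sU) => //; apply: (subspaceZ _ sU); apply: (subspace_lsum sU) => j.
by apply: (subspaceZ _ sU); apply: (pU); apply: (pU).
Qed.

Lemma homN_Lvir e u : homN e u -> homN (e - n%:~R) (Lvir n u).
Proof.
move=> hu; have [k1 hk1] := Lvir_index; rewrite (Lvir_lsum _ hk1).
have sub := homN_subspace (e - n%:~R) (K := K).
apply: (subspaceD sub).
  have [n0|n0] := eqVneq n 0; first by apply: (subspaceZ _ sub); rewrite n0 subr0.
  by rewrite mul0r scale0r; exact: homN0.
apply: (subspaceZ _ sub); apply: (subspace_lsum sub) => j; apply: (subspaceZ _ sub).
have := homN_phi (r := - (k1 + j%:Z)) (homN_phi (r := n + (k1 + j%:Z)) hu).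
by congr (homN _ _); rewrite !intrN !intrD; ring.
Qed.

Lemma par_Lvir u : par (Lvir n u) = Lvir n (par u).
Proof.
have [k1 hk1] := Lvir_index; rewrite !(Lvir_lsum _ hk1).
rewrite (linD _ _ par_linear) !(linZ _ _ par_linear); congr (_ + _ *: _).
rewrite (lsum_lin par_linear); last exact: Lterm_fsupp.
apply: eq_lsum => j; rewrite /Lterm (linZ _ _ par_linear) !parity_phi.
by rewrite (linN _ (phi_lin _)) parity_phi opprK.
Qed.

End Lvir.
End VirasoroGeneration.

#[local] Arguments psi : simpl never.
#[local] Arguments Yn : simpl never.

(** * The modes of omega and of a state of weight 4 *)

Section VirasoroField.
Context {K : numClosedFieldType}.
Local Notation M := (fock_M K).
Local Notation N := (fock_N K).
Implicit Types (u w : N) (U : set N) (r n : int).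
Variables (S : svoa M) (hS : ising_svoa S).

Let ps := @par_linear K.
Let pk := @parK K.
Let gph := @good_phiq K.
Let pph := @parity_phiq K.
Let cph := @phiq_car K.

Local Notation om := (omega_M K).
Local Notation psi1 := (psi_state K).
Local Notation one := (vac_M K).

Lemma Yn_opl b x : linear (@Yn K b x).
Proof. exact: (proj1 (good_Y ps pk gph pph cph b)). Qed.

Lemma Yn_psi_neg k x w : Yn (psi (- k.+1%:Z) one) x w =
  ((-1) ^+ k * gbinom (ratr x) k) *: Yn psi1 (x - k%:R) w.
Proof. by rewrite -(Y_create ps pk gph pph cph hS) (svY_psi hS). Qed.

Lemma psi_pair (c : nat) (d : int) : psi c%:Z (psi d psi1)
  = (c%:Z + d + 1 == 0)%:R *: psi1 - (c == 0)%N%:R *: psi d one.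
Proof.
rewrite -psi_anticomm; case: c => [|c]; last first.
  by rewrite (@psi_psi_state_gt0 K c.+1%:Z) // (lin0 (@psi_linear K _)) addr0 scale0r subr0.
by rewrite psi_psi_state0 scale1r addrK.
Qed.

Lemma Yn_scale c b x w : Yn (c *: b) x w = c *: Yn b x w.
Proof. exact: (linZ c b (Yn_lin x w)). Qed.

Lemma sv_par_om : sv_par S false om.
Proof. by have := sv_vir_even S; rewrite (ising_vir hS). Qed.

Lemma psi_om0 : psi 0 om = - 2^-1 *: psi (-2) one.
Proof.
rewrite (linZ _ _ (@psi_linear K _)) (psi_pair 0 (-2)).
by rewrite scale0r sub0r scale1r scalerN scaleNr.
Qed.

Lemma psi_om1 : psi 1 om = 2^-1 *: psi1.
Proof.
by rewrite (linZ _ _ (@psi_linear K _)) (psi_pair 1 (-2)) scale0r subr0 scale1r.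
Qed.

Lemma psi_om_ge2 j : (2 <= j)%N -> psi j%:Z om = 0.
Proof.
move=> j2; rewrite (linZ _ _ (@psi_linear K _)) psi_pair.
rewrite (_ : (_ + _ == 0) = false); last by apply/eqP; lia.
by rewrite (_ : (j == 0)%N = false) ?scale0r ?subr0 ?scaler0 //; lia.
Qed.

Lemma ratr_half_odd r : ratr (r%:~R - 1 / 2) = r%:~R - 2^-1 :> K.
Proof. by rewrite rmorphB /= ratr_int fmorph_div /= rmorph1 ratr_nat div1r. Qed.

Lemma Yn_om_phi n r w : Yn om (n%:~R + 1) (phi r w)
  = phi r (Yn om (n%:~R + 1) w) - (2^-1 * (n + 2 * r)%:~R) *: phi (n + r) w.
Proof.
have hq : half_odd (r%:~R - 1 / 2) by exists r.
have := psi_state_comm ps pk gph pph cph hS sv_par_om psi_om_ge2 (n%:~R + 1) w hq.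
rewrite expr0 scale1r !phiq_int => e.
rewrite -[LHS](subrK (phi r (Yn om (n%:~R + 1) w))) [LHS]addrC; congr (_ + _).
etransitivity; first exact: e.
rewrite big_ord_recl big_ord1 /= -[bump 0 0]/1%N psi_om0 psi_om1 gbinom0 gbinom1 scale1r.
rewrite -!/(Yn _ _ _) !Yn_scale (Yn_psi_neg 1) gbinom1 subr0.
have -> : n%:~R + 1 + (r%:~R - 1 / 2) - 1%:R = (n + r)%:~R - 1 / 2 :> rat.
  by rewrite intrD; ring.
rewrite Yn_psi_state !scalerA -scalerDl -scaleNr; congr (_ *: _).
have -> : ratr (n%:~R + 1 + (r%:~R - 1 / 2)) = n%:~R + 1 + (r%:~R - 2^-1) :> K.
  by rewrite rmorphD /= ratr_half_odd rmorphD /= ratr_int rmorph1.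
by rewrite ratr_half_odd intrD intrM; field.
Qed.

Lemma homfield_om : homfield 2 (Yn om).
Proof.
move=> x e w hw; rewrite Yn_scale; apply: (subspaceZ _ (homN_subspace _)).
have h1 : homfield (1 / 2) (@Yn K psi1).
  rewrite /Yn (Y_psi ps pk gph pph cph) Y_vac.
  by have := homfield_Psi (k := -1) (@homfield_idf K); congr (homfield _ _); rewrite intrN; field.
rewrite /Yn (Y_psi ps pk gph pph cph) -/(Yn _).
by have := homfield_Psi (k := -2) h1 hw (n := x); congr (homN _ _); rewrite intrN; field.
Qed.

Lemma Yn_om_par x w : par (Yn om x w) = Yn om x (par w).
Proof.
have := parity_op_Y ps pk gph pph cph hS sv_par_om x w; rewrite expr0 scale1r => e.
by apply/esym/e.
Qed.

(** The difference commutes with every phi_r, so it is a scalar once it maps v_0 to a multiple of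
    v_0. The scalar is left undetermined because stability of subspaces does not see it. *)
Lemma Yn_om_Lvir n : exists c, forall w, Yn om (n%:~R + 1) w = Lvir n w + c *: w.
Proof.
pose Z w := Yn om (n%:~R + 1) w - Lvir n w.
have ZE w : Yn om (n%:~R + 1) w = Lvir n w + Z w by rewrite /Z addrCA subrr addr0.
have lZ : linear Z.
  move=> c u v; rewrite /Z Yn_opl Lvir_linear.
  by rewrite opprD addrACA scalerBr.
have Zphi r w : Z (phi r w) = phi r (Z w).
  rewrite /Z Yn_om_phi Lvir_phi (linB _ _ (phi_lin r)) opprB addrA subrK.
  by [].
have Zann k : ann k.+1 (Z (vac_N K)) = 0.
  have -> : ann k.+1 (Z (vac_N K)) = phi k.+1%:Z (Z (vac_N K)) by [].
  by rewrite -Zphi phi_vac ?(lin0 lZ).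
suff [c hc] : exists c, Z (vac_N K) = c *: vac_N K.
  by exists c => w; rewrite ZE; congr (_ + _); apply: (commutant_scalar lZ Zphi hc).
have [n0|n0] := eqVneq n 0; last first.
  exists 0; rewrite scale0r; apply: (@vacuum_hom K (- n%:~R)) => //.
    by rewrite oppr_eq0 intr_eq0.
  apply: (subspaceB (homN_subspace _)).
    by have := homfield_om (n := n%:~R + 1) homN_vac; congr (homN _ _); ring.
  by have := homN_Lvir (n := n) homN_vac; rewrite sub0r.
(* In degree 0 the vacuum vectors are spanned by v_0 and phi_0 v_0; the second is odd, and is
   excluded because Z preserves parity. *)
exists (fval (Z (vac_N K)) fset0); rewrite {1}(vacuum_vector Zann).
rewrite (_ : fval (Z (vac_N K)) [fset 0%N]%fset = 0) ?scale0r ?addr0 //.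
have pZ : par (Z (vac_N K)) = Z (vac_N K).
  rewrite /Z (linB _ _ ps) Yn_om_par par_Lvir.
  by rewrite (_ : par (vac_N K) = vac_N K) // /vac_N /fvac par_ket cardfs0 expr0 scale1r.
have := congr1 (fun u : N => fval u [fset 0%N]%fset) pZ.
rewrite fdiag cardfs1 expr1 mulN1r => /eqP; rewrite eqNr => /eqP.
by [].
Qed.

Definition Yn_om_closed U := forall x w, U w -> U (Yn om x w).

Lemma Lvir_closed_om U : Lvir_submodule U -> Yn_om_closed U.
Proof.
move=> [sU LU] x w Uw; have [/intrP[n e]|nx] := boolP (x \is a Num.int); last first.
  have -> : Yn om x w = 0; last exact: subspace0 sU.
  apply: (on_coset_Y ps pk gph pph cph hS sv_par_om).
  by rewrite /hcoset /= mul0r subr0; apply/negP.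
have [c hc] := Yn_om_Lvir (n - 1).
rewrite e (_ : n%:~R = (n - 1)%:~R + 1); last by rewrite intrB subrK.
by rewrite hc; apply: (subspaceD sU); [exact: LU | exact: (subspaceZ _ sU)].
Qed.

(* [psi (-4)] is psi_(-7/2); the vector has weight 4. *)
Definition quartic : M := psi (-4) psi1.

Lemma transl_om2 : transl S (transl S om) = 3 *: quartic - psi (-2) (psi (-3) one).
Proof.
have t1 : transl S psi1 = psi (-2) one.
  by rewrite transl_psi // transl_vac // (lin0 (@psi_linear K _)) sub0r intrN scaleNr opprK scale1r.
have t2 : transl S (psi (-2) one) = 2 *: psi (-3) one.
  by rewrite transl_psi // transl_vac // (lin0 (@psi_linear K _)) sub0r intrN scaleNr opprK.
have t3 : transl S om = psi (-3) psi1.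
  rewrite /omega_M (linZ _ _ (transl_linear S)) transl_psi // t1 intrN scaleNr opprK.
  have /eqP := psi_anticomm (-2) (-2) one; rewrite scale0r -mulr2n -scaler_nat scaler_eq0 pnatr_eq0 /= => /eqP ->.
  by rewrite add0r scalerA mulVf ?scale1r // pnatr_eq0.
rewrite t3 transl_psi // t1 intrN scaleNr opprK addrC /quartic; congr (_ + _).
have /eqP := psi_anticomm (-3) (-2) one; rewrite scale0r addr_eq0 => /eqP ->.
by [].
Qed.

Lemma om_psi n b : sv_Y S om (-1) (psi n b)
  = psi n (sv_Y S om (-1) b) - (n%:~R - 2^-1) *: psi (n - 2) b.
Proof.
rewrite (sv_comm hS (-1) n b sv_par_om psi_om_ge2) expr0 !scale1r; congr (_ - _).
rewrite big_ord_recl big_ord1 /= -[bump 0 0]/1%N psi_om0 psi_om1 gbinom0 gbinom1 scale1r.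
have lin d := linZ (f := fun a => sv_Y S a d b) _ _ (fun c u v => sv_linl S d b c u v).
rewrite !lin (svY_psi hS).
have t1 : psi (-2) one = transl S psi1.
  by rewrite transl_psi // transl_vac // (lin0 (@psi_linear K _)) sub0r intrN scaleNr opprK scale1r.
rewrite t1 sv_deriv (svY_psi hS).
rewrite (_ : -1 + n - 0%:Z - 1 = n - 2); last by lia.
rewrite (_ : -1 + n - 1%:Z = n - 2); last by lia.
rewrite !scalerA -scalerDl; congr (_ *: _).
by rewrite !intrD; field.
Qed.

Lemma om_om : sv_Y S om (-1) om = (5 / 4) *: quartic + (3 / 4) *: psi (-2) (psi (-3) one).
Proof.
rewrite {2}/omega_M (linZ _ _ (fun c u v => sv_linr S om (-1) c u v)) !om_psi.
have -> : sv_Y S om (-1) one = om by rewrite -(ising_vac hS) sv_create1.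
rewrite /omega_M (linZ _ _ (@psi_linear K _)) (linB _ _ (@psi_linear K _)) !(linZ _ _ (@psi_linear K _)).
have p12 : psi (-1) (psi (-2) psi1) = 0.
  have /eqP := psi_anticomm (-1) (-2) psi1; rewrite scale0r addr_eq0 => /eqP ->.
  have /eqP := psi_anticomm (-1) (-1) one; rewrite scale0r -mulr2n -scaler_nat scaler_eq0 pnatr_eq0 /=.
  by move=> /eqP ->; rewrite (lin0 (@psi_linear K _)) oppr0.
rewrite p12 (lin0 (@psi_linear K _)) scaler0 sub0r -!scaleNr addrC scalerDr !scalerA.
have -> : 2^-1 * - ((-2)%:~R - 2^-1) = 5 / 4 :> K by rewrite intrN; field.
have -> : 2^-1 * - ((-1)%:~R - 2^-1) = 3 / 4 :> K by rewrite intrN; field.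
have -> : (-2 - 2 : int) = -4 by [].
by have -> : (-1 - 2 : int) = -3 by [].
Qed.

(** The multiple 3/4 of T^2 omega cancels psi_(-3/2) psi_(-5/2) 1 in omega_(-1) omega; what is left
    has coefficient 5/4 + 9/4 = 7/2. *)
Lemma quarticE : quartic = (2 / 7) *: (sv_Y S om (-1) om + (3 / 4) *: transl S (transl S om)).
Proof.
rewrite om_om transl_om2 scalerBr addrA addrAC addrK scalerA -scalerDl scalerA.
by rewrite (_ : _ * _ = 1) ?scale1r //; field.
Qed.

(** At l = -1, m = 0 the Jacobi identity writes the modes of omega_(-1) omega as locally finite sums
    of products of two modes of omega, while T only shifts and rescales modes. *)
Lemma Yn_quartic_closed U : subspace U -> Yn_om_closed U -> forall x w, U w -> U (Yn quartic x w).
Proof.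
move=> sU cU x w Uw; rewrite quarticE Yn_scale; apply: (subspaceZ _ sU).
rewrite (linD _ _ (Yn_lin x w)) Yn_scale; apply: (subspaceD sU); last first.
  rewrite /Yn !(Y_transl ps pk gph pph cph hS) /dd.
  by do 3 (apply: (subspaceZ _ sU)); apply: cU.
have h0 : hcoset false 0 by rewrite /hcoset /= mul0r subr0.
have := jac_all ps pk gph pph cph hS om sv_par_om (-1) x w h0.
have r0 : ratr 0 = 0%:~R :> K by rewrite rmorph0.
rewrite r0 (lsum_gbinom0' (fun j : nat => Yn (sv_Y S om (-1 + j%:Z) om) (0 + x - j%:R) w)).
rewrite addr0 add0r subr0 => <-; apply: (subspaceB sU).
  by apply: (subspace_lsum sU) => j; apply: (subspaceZ _ sU); exact: (cU _ _ (cU _ _ Uw)).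
by apply: (subspace_lsum sU) => j; apply: (subspaceZ _ sU); exact: (cU _ _ (cU _ _ Uw)).
Qed.

(** The first binomial comes from contracting phi_r with psi_(-1/2) in [quartic], the second from
    contracting it with psi_(-7/2). Index 3 of a state of weight 4 preserves degree. *)
Definition quartic_coef r : K := gbinom (r%:~R + 5 / 2) 3 + gbinom (r%:~R - 2^-1) 3.

Lemma quartic_coefE r : quartic_coef r = (2 * r%:~R ^+ 3 + 23 / 2 * r%:~R) / 6.
Proof.
rewrite /quartic_coef !gbinomSE !gbinom0; by field.
Qed.

Lemma quartic_par : sv_par S false quartic.
Proof. exact: (sv_par_psi hS (-4) (par_psi_state hS)). Qed.

Lemma psi_quartic_ge4 (j : nat) : (4 <= j)%N -> psi j%:Z quartic = 0.
Proof.
move=> j4; rewrite psi_pair (_ : (_ + _ == 0) = false); last by apply/eqP; lia.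
by rewrite (_ : (j == 0)%N = false) ?scale0r ?subr0 //; lia.
Qed.

Lemma quartic_phi r w : Yn quartic 3 (phi r w) = phi r (Yn quartic 3 w) - quartic_coef r *: phi r w.
Proof.
have hq : half_odd (r%:~R - 1 / 2) by exists r.
have := psi_state_comm ps pk gph pph cph hS quartic_par psi_quartic_ge4 3 w hq.
rewrite expr0 scale1r !phiq_int => e.
rewrite -[LHS](subrK (phi r (Yn quartic 3 w))) [LHS]addrC; congr (_ + _).
etransitivity; first exact: e.
rewrite !big_ord_recl big_ord0 /= -[bump 0 0]/1%N -[bump 0 1]/2%N -[bump 0 2]/3%N.
rewrite (psi_pair 0 (-4)) (psi_pair 1 (-4)) (psi_pair 2 (-4)) (psi_pair 3 (-4)) /=.
rewrite !scale0r !scale1r !subr0 !sub0r.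
rewrite -!/(Yn _ _ _) !(linN _ (Yn_lin _ _)) !(lin0 (Yn_lin _ _)) !scaler0 !add0r addr0.
rewrite (Yn_psi_neg 3) gbinom0 scale1r !scaleN1r opprK.
have -> : 3 + (r%:~R - 1 / 2) - 3%:R = r%:~R - 1 / 2 :> rat by ring.
rewrite Yn_psi_state scalerN -scalerBl -scaleNr; congr (_ *: _).
have -> : ratr (3 + (r%:~R - 1 / 2)) = r%:~R + 5 / 2 :> K.
  by rewrite rmorphD /= ratr_half_odd ratr_nat; field.
rewrite ratr_half_odd /quartic_coef !exprS expr0; ring.
Qed.

End VirasoroField.

#[local] Arguments phi : simpl never.

(** Lagrange interpolation: U contains the combination with weights p(l j) for every polynomial p,
    and p is chosen to vanish at all nodes except l j0. Only l j0 has to differ from the rest; other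
    nodes may coincide. *)
Lemma separation (K : numClosedFieldType) (V : lmodType K) (U : set V) B (l : nat -> K) (x : nat -> V) :
  subspace U -> (forall i, U (\sum_(j < B) l j ^+ i *: x j)) ->
  forall j0, (j0 < B)%N -> (forall j, (j < B)%N -> j != j0 -> l j != l j0) -> U (x j0).
Proof.
move=> sU h j0 hj0 inj.
pose p := \prod_(j < B | (j : nat) != j0) ('X - (l j)%:P).
have key : p.[l j0] *: x j0 = \sum_(i < size p) p`_i *: \sum_(j < B) l j ^+ i *: x j.
  under eq_bigr => i _ do rewrite scaler_sumr.
  rewrite exchange_big (bigD1 (Ordinal hj0)) //= [X in _ + X]big1 => [|j jj0].
    rewrite addr0 horner_coef scaler_suml; apply: eq_bigr => i _.
    by rewrite scalerA.
  under eq_bigr => i _ do rewrite scalerA.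
  rewrite -scaler_suml -horner_coef /p (bigD1 j) //= hornerM hornerXsubC subrr.
  by rewrite mul0r scale0r.
have p0 : p.[l j0] != 0.
  rewrite horner_prod; apply/prodf_neq0 => j jj0.
  by rewrite hornerXsubC subr_eq0 eq_sym inj.
rewrite -[x j0]scale1r -(mulVf p0) -scalerA key; apply: (subspaceZ _ sU).
by apply: (subspace_sum _ sU) => i _; apply: (subspaceZ _ sU).
Qed.

(** * Bilinears in the phi modes preserve Virasoro submodules *)

Section Bilinears.
Context {K : numClosedFieldType}.
Local Notation M := (fock_M K).
Local Notation N := (fock_N K).
Implicit Types (u w : N) (U : set N) (r n k : int).

Definition pair_coef n k : K := quartic_coef (- k) + quartic_coef (n + k).

(** The linear part of the cubic adds up to a constant and drops out; the cubic part leaves n (k -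
    k') (n + k + k'). The last factor is positive because both indices exceed -n/2. *)
Lemma pair_coef_inj n k k' : n != 0 -> - n < k * 2 -> - n < k' * 2 -> pair_coef n k = pair_coef n k' -> k = k'.
Proof.
move=> n0 hk hk'; rewrite /pair_coef !quartic_coefE => /eqP; rewrite -subr_eq0 => /eqP e.
have : (n * (k - k') * (n + k + k'))%:~R = 0 :> K.
  by rewrite -e !intrM !intrD !intrN; field.
move/eqP; rewrite intr_eq0 !mulf_eq0 (negbTE n0) subr_eq0 /= => /orP[/eqP //|/eqP].
by lia.
Qed.

Variables (S : svoa M) (hS : ising_svoa S) (U : set N).
Hypothesis LU : Lvir_submodule U.
Local Notation D := (@Yn K (quartic (K := K)) 3).

Lemma quartic_term n k u : D (Lterm n k u) = Lterm n k (D u) - pair_coef n k *: Lterm n k u.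
Proof.
rewrite /Lterm (linZ _ _ (Yn_opl _ _)) [pair_coef n k *: _]scalerA [pair_coef n k * _]mulrC -scalerA -scalerBr.
congr (_ *: _); rewrite !(quartic_phi hS) (linB _ _ (phi_lin _)) (linZ _ _ (phi_lin _)).
by rewrite addrAC /pair_coef [(quartic_coef _ + _) *: _]scalerDl opprD addrA.
Qed.

Lemma phi_bilinear n k w : n != 0 -> - n < k * 2 -> U w -> U (phi (- k) (phi (n + k) w)).
Proof.
move=> n0 hk Uw; have [sU cU] := LU; have [k1 hk1] := Lvir_index n.
pose l (j : nat) := pair_coef n (k1 + j%:Z).
(* Q 0 is 2 L_n, and Q i.+1 is the commutator Q i D - D Q i, which multiplies the term of index j by
   its eigenvalue l j. *)
pose Q (i : nat) u := lsum (fun j : nat => l j ^+ i *: Lterm n (k1 + j%:Z) u).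
have fQ i u : fsupp (fun j : nat => l j ^+ i *: Lterm n (k1 + j%:Z) u).
  exact/fsuppZ/Lterm_fsupp.
have DU u : U u -> U (D u).
  by apply: (Yn_quartic_closed hS sU); exact: (Lvir_closed_om hS LU).
have UQ i u : U u -> U (Q i u).
  elim: i u => [|i IH] u Uu.
    have -> : Q 0%N u = 2 *: Lvir n u.
      rewrite (Lvir_lsum u hk1) (negbTE n0) mul0r scale0r add0r scalerA mulfV ?scale1r ?pnatr_eq0 //.
      by apply: eq_lsum => j; rewrite expr0 scale1r.
    by apply: (subspaceZ _ sU); exact: cU.
  have -> : Q i.+1 u = Q i (D u) - D (Q i u).
    rewrite /Q (lsum_lin (Yn_opl _ _)) // -lsumB //; last first.
      by apply: fsupp_sub (fQ i u) _ => j ->; exact: (lin0 (Yn_opl _ _)).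
    apply: eq_lsum => j; rewrite (linZ _ _ (Yn_opl _ _)) quartic_term -scalerBr opprB addrCA subrr addr0.
    by rewrite exprSr -scalerA.
  by apply: (subspaceB sU); [apply: IH; exact: DU | apply: DU; exact: IH].
have [B hB] := Lterm_fsupp n k1 w.
have kE : k = k1 + (`|k - k1|%N)%:Z by have := hk1 k; rewrite hk => /esym; lia.
have : U (Lterm n (k1 + (`|k - k1|%N)%:Z) w).
  (* The cutoff must include every term that is nonzero on w, and also the wanted index, whose term
     may itself vanish. *)
  apply: (@separation _ _ U (maxn B (`|k - k1|%N).+1) l (fun j => Lterm n (k1 + j%:Z) w)) => //.
  - move=> i; have := UQ i w Uw; rewrite /Q (@lsumE _ _ (maxn B (`|k - k1|%N).+1)) // => j.
    by rewrite geq_max => /andP[/hB -> _]; rewrite scaler0.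
  - by rewrite leq_max ltnSn orbT.
  - move=> j _; apply: contraNN => /eqP /pair_coef_inj -/(_ n0) h; apply/eqP.
    have : k1 + j%:Z = k1 + (`|k - k1|%N)%:Z by apply: h; rewrite hk1; lia.
    by lia.
rewrite -kE /Lterm => h.
have nk : (n + 2 * k)%:~R != 0 :> K by rewrite intr_eq0; lia.
rewrite -[phi _ _]scale1r -(mulVf nk) -scalerA.
exact: (subspaceZ _ sU).
Qed.

Lemma phi_phi0 r w : r != 0 -> U w -> U (phi r (phi 0 w)).
Proof.
move=> r0 Uw; have [r_lt|r_ge] := ltP r 0.
  have := phi_bilinear (n := r) (k := - r) _ _ Uw; rewrite opprK subrr; apply=> //.
  by lia.
have := phi_bilinear (n := r) (k := 0) _ _ Uw; rewrite oppr0 addr0 => h.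
have /eqP := phi_anticomm r 0 w; rewrite addr0 (negbTE r0) scale0r addr_eq0 => /eqP ->.
rewrite -scaleN1r; apply: (subspaceZ _ (proj1 LU)).
by apply: h => //; lia.
Qed.

Lemma phi0_sq w : phi 0 (phi 0 w) = 2^-1 *: w.
Proof.
have two0 : 2 != 0 :> K by rewrite pnatr_eq0.
apply: (scalerI two0); rewrite scalerA mulfV // scaler_nat mulr2n.
by rewrite phi_anticomm.
Qed.

(** For r <> 0, phi_r w = 2 phi_r phi_0 (phi_0 w) and phi_0 phi_r w = - phi_r phi_0 w, so the
    bilinears phi_r phi_0 applied to phi_0 w and to w suffice. *)
Lemma phi_core_stable : phi_stable [set w | U w /\ U (phi 0 w)].
Proof.
have [sU _] := LU; split.
  split=> [|c u v]; rewrite !inE /=.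
    by rewrite (lin0 (phi_lin _)); split; exact: subspace0.
  by move=> [a b] [c' d]; rewrite phi_lin; split; exact: subspace_lin.
move=> r w /= [Uw U0w]; have [->|r0] := eqVneq r 0.
  by split=> //; rewrite phi0_sq; exact: (subspaceZ _ sU).
split; last first.
  have /eqP := phi_anticomm 0 r w; rewrite add0r (negbTE r0) scale0r addr_eq0 => /eqP ->.
  by rewrite -scaleN1r; apply: (subspaceZ _ sU); exact: phi_phi0.
have -> : w = 2 *: phi 0 (phi 0 w) by rewrite phi0_sq scalerA mulfV ?scale1r ?pnatr_eq0.
by rewrite (linZ _ _ (phi_lin _)); apply: (subspaceZ _ sU); exact: phi_phi0.
Qed.

End Bilinears.

Section RamondModules.
Context {K : numClosedFieldType}.
Local Notation M := (fock_M K).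
Local Notation N := (fock_N K).
Implicit Types (u w : N) (U : set N) (r n k : int).

Lemma phi_stable_Lvir U : phi_stable U -> Lvir_submodule U.
Proof. by move=> pU; split=> [|n u]; [exact: (proj1 pU) | exact: Lvir_phi_stable]. Qed.

Variable s : K.
Hypothesis s2 : s ^+ 2 = 1.

Lemma sqrt2_neq0 : sqrtC 2 != 0 :> K.
Proof. by rewrite sqrtC_eq0 pnatr_eq0. Qed.

Lemma eigen_sq : (s / sqrtC 2) ^+ 2 = 2^-1.
Proof. by rewrite expr_div_n s2 sqrtCK div1r. Qed.

Lemma phi0_v16 : phi 0 (v16 s) = (s / sqrtC 2) *: v16 s.
Proof.
rewrite /v16 (linD _ _ (phi_lin _)) (linZ _ _ (phi_lin _)) phi0_sq [RHS]scalerDr [X in _ = _ + X]scalerA -expr2.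
by rewrite eigen_sq addrC.
Qed.

Lemma L16_v16 : (L16 s : set N) (v16 s).
Proof. by move=> U /= [_]; apply. Qed.

Lemma L16_sub U : phi_stable U -> U (v16 s) -> L16 s `<=` U.
Proof.
move=> pU Uv w; apply; split; first exact: phi_stable_Lvir.
by move=> _ ->.
Qed.

Lemma L16_Lvir : Lvir_submodule (L16 s).
Proof.
split=> [|n u h]; first exact: L16_subspace.
by move=> U /= hU; apply: (proj2 (proj1 hU)); exact: (h U hU).
Qed.

(** The vectors w of L16 with phi_0 w in L16 form a phi-stable subspace, hence a Virasoro submodule,
    and it contains the eigenvector v16 of phi_0. It is therefore all of L16. *)
Theorem L16_phi_stable (S : svoa M) : ising_svoa S -> phi_stable (L16 s).
Proof.
move=> hS; have pU := phi_core_stable hS L16_Lvir; split; first exact: L16_subspace.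
move=> r w Lw; have := L16_sub pU _ Lw; case=> [|h1 h2].
  by split; [exact: L16_v16 | rewrite phi0_v16; apply: (subspaceZ _ (proj1 L16_Lvir)); exact: L16_v16].
by have [] := proj2 pU r w (conj h1 h2).
Qed.

End RamondModules.

(** * Ramond modes of a twisted module *)

Section TwistedModuleTheory.
Context {K : numClosedFieldType}.
Local Notation M := (fock_M K).
Variables (S : svoa M) (hS : ising_svoa S).
Implicit Types (W : lmodType K).

Definition ramond W (T : twisted_module S W) (r : int) w : W :=
  tw_Y T (psi_state K) (r%:~R - 1 / 2) w.

Lemma good_tw W (T : twisted_module S W) a : good (tw_Y T a).
Proof. by split; [exact: tw_linr | exact: tw_trunc]. Qed.

Lemma hcoset_half_odd (r : int) : hcoset true (r%:~R - 1 / 2).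
Proof.
rewrite /hcoset /= (_ : _ - _ = (r - 1)%:~R) ?intr_int //.
by rewrite intrB; field.
Qed.

Lemma ramond_lin W (T : twisted_module S W) r : linear (ramond T r).
Proof. exact: tw_linr. Qed.

Lemma ramond_anticomm W (T : twisted_module S W) (r s : int) w :
  ramond T r (ramond T s w) + ramond T s (ramond T r w) = (r + s == 0)%:R *: w.
Proof.
have hp := par_psi_state hS.
have := tw_jacobi T w 0 hp hp (hcoset_half_odd r) (hcoset_half_odd s).
rewrite -!/(lsum _) !lsum_gbinom0 expr0 !expr0z !scale1r !addr0 ?subr0 !add0r expr1 scaleN1r opprK => ->.
rewrite (@lsum_single _ _ _ 0%N) => [|[//|j] _]; last first.
  rewrite (svY_psi hS) add0r psi_psi_state_gt0 //.
  by rewrite (lin0 (tw_linl T _ w)) scaler0.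
rewrite gbinom0 scale1r (svY_psi hS) addr0 psi_psi_state0 -(ising_vac hS) subr0 tw_vacuum.
have -> : r%:~R - 1 / 2 + (s%:~R - 1 / 2) = (r + s)%:~R - 1 :> rat by rewrite intrD; field.
rewrite -subr_eq0 opprK subrK intr_eq0.
by case: ifP; rewrite ?scale1r ?scale0r.
Qed.

Lemma weight_psi_state : weight_space S (1 / 2) (psi_state K).
Proof.
rewrite /weight_space /eigensp /= (vir1_psi_state hS).
by rewrite fmorph_div /= rmorph1 ratr_nat div1r.
Qed.

Lemma ramond_gr W (T : twisted_module S W) r (t : nat) w : tw_gr T t w ->
  graded_piece (tw_gr T) (t%:R - r%:~R) (ramond T r w).
Proof.
move=> /(tw_gr_Y (r%:~R - 1 / 2) weight_psi_state).
by congr (graded_piece _ _ _); field.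
Qed.

Section LinearRelation.
Variables (W1 W2 : lmodType K) (T1 : twisted_module S W1) (T2 : twisted_module S W2).
Variable G : W1 -> W2 -> Prop.
Hypothesis G0 : G 0 0.
Hypothesis G_lin : forall c u u' v v', G u u' -> G v v' -> G (c *: u + v) (c *: u' + v').
Hypothesis G_ramond : forall r w w', G w w' -> G (ramond T1 r w) (ramond T2 r w').

Let GD u u' v v' : G u u' -> G v v' -> G (u + v) (u' + v').
Proof. by move=> hu hv; rewrite -[u]scale1r -[u']scale1r; exact: G_lin. Qed.

Let GZ c u u' : G u u' -> G (c *: u) (c *: u').
Proof. by move=> hu; rewrite -[c *: u]addr0 -[c *: u']addr0; exact: G_lin. Qed.

Let GB u u' v v' : G u u' -> G v v' -> G (u - v) (u' - v').
Proof. by move=> hu hv; rewrite -!scaleN1r; apply: GD => //; exact: GZ. Qed.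

Let G_lsum F F' : fsupp F -> fsupp F' -> (forall j, G (F j) (F' j)) -> G (lsum F) (lsum F').
Proof.
move=> [B hB] [B' hB'] h.
rewrite (@lsumE _ _ (maxn B B')) => [|j]; last by rewrite geq_max => /andP[/hB].
rewrite (@lsumE _ _ (maxn B B') F') => [|j]; last by rewrite geq_max => /andP[_ /hB'].
by elim/big_rec2: _ => // j u v _; exact: GD.
Qed.

Let hcoset_sub i n : hcoset (~~ i) n -> hcoset i (n - 1 / 2).
Proof.
rewrite /hcoset /= => h.
have [r ->] : exists r : int, n - 1 / 2 - (i : nat)%:R / 2 = n - (~~ i : nat)%:R / 2 + r%:~R.
  by case: i {h} => /=; [exists (- 1) | exists 0]; rewrite ?intrN; field.
by rewrite rpredD ?intr_int.
Qed.

Lemma relation_psi i b : sv_par S i b ->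
  (forall n w w', G w w' -> G (tw_Y T1 b n w) (tw_Y T2 b n w')) ->
  forall k n w w', G w w' -> G (tw_Y T1 (psi k b) n w) (tw_Y T2 (psi k b) n w').
Proof.
move=> hb IH k n w w' Gw; have [k0 hk0] := psi_large hS b.
have [d hd] : exists d : nat, k0 - k <= d%:Z by exists `|k0 - k|%N; lia.
elim: d k hd n => [|d IHd] k hd n.
  by rewrite hk0 ?(lin0 (tw_linl _ _ _)) //; lia.
have [hn|hn] := pselect (hcoset (~~ i) n); last first.
  by rewrite !(tw_par _ _ (sv_par_psi hS k hb) hn).
(* Exponent 1/2 for psi and n - 1/2 for b give the term j = 0 on the right the wanted index n. The
   terms j > 0 form B and are covered by the descent in k. *)
pose h : rat := 1%:~R - 1 / 2.
pose A W (T : twisted_module S W) w := lsum (fun j : nat => ((-1) ^+ j * gbinom k%:~R j)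
         *: tw_Y T (psi_state K) (k%:~R + h - j%:R) (tw_Y T b (n - 1 / 2 + j%:R) w))
    - (-1) ^+ (true && i) *: lsum (fun j : nat => ((-1) ^ (k + j%:Z) * gbinom k%:~R j)
         *: tw_Y T b (k%:~R + (n - 1 / 2) - j%:R) (tw_Y T (psi_state K) (h + j%:R) w)).
pose B W (T : twisted_module S W) w := lsum (fun j : nat => gbinom (ratr h) j.+1
   *: tw_Y T (psi (k + j.+1%:Z) b) (h + (n - 1 / 2) - j.+1%:R) w).
have fB W (T : twisted_module S W) x : fsupp (fun j : nat => gbinom (ratr h) j
   *: tw_Y T (psi (k + j%:Z) b) (h + (n - 1 / 2) - j%:R) x).
  apply: fsuppZ; exists `|k0 - k|%N => j hj.
  by rewrite hk0 ?(lin0 (tw_linl _ _ _)) //; lia.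
have fB' W (T : twisted_module S W) x : fsupp (fun j : nat => gbinom (ratr h) j.+1
   *: tw_Y T (psi (k + j.+1%:Z) b) (h + (n - 1 / 2) - j.+1%:R) x).
  by have [c hc] := fB W T x; exists c => j hj; apply: hc; exact: leqW.
have E W (T : twisted_module S W) x : tw_Y T (psi k b) n x = A W T x - B W T x.
  have := tw_jacobi T x k (par_psi_state hS) hb (hcoset_half_odd 1) (hcoset_sub hn).
  rewrite -!/(lsum _) -/h -/(A W T x) => ->; under eq_lsum => j do rewrite (svY_psi hS).
  rewrite lsum_recl //= gbinom0 scale1r addr0 subr0 -/(B W T x) addrK.
  by congr (tw_Y T _ _ x); rewrite /h; field.
have GY q x x' : half_odd q -> G x x' -> G (tw_Y T1 (psi_state K) q x) (tw_Y T2 (psi_state K) q x').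
  by move=> [r ->]; exact: G_ramond.
rewrite !E; apply: GB; last first.
  apply: G_lsum => // j; apply: GZ; apply: IHd; lia.
apply: GB.
  apply: G_lsum => [||j]; last first.
  - apply: GZ; apply: GY; last exact: IH.
    by exists (k + 1 - j%:Z); rewrite /h intrB intrD; ring.
  - have [c hc] := trunc_nat (n - 1 / 2) w' (good_tw T2 b); exists c => j /hc ->.
    by rewrite (lin0 (tw_linr T2 _ _)) scaler0.
  - have [c hc] := trunc_nat (n - 1 / 2) w (good_tw T1 b); exists c => j /hc ->.
    by rewrite (lin0 (tw_linr T1 _ _)) scaler0.
apply: GZ; apply: G_lsum => [||j]; last first.
- apply: GZ; apply: IH; apply: GY => //.
  by exists (1 + j%:Z); rewrite /h intrD; ring.
- have [c hc] := trunc_nat h w' (good_tw T2 (psi_state K)); exists c => j /hc ->.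
  by rewrite (lin0 (tw_linr T2 _ _)) scaler0.
- have [c hc] := trunc_nat h w (good_tw T1 (psi_state K)); exists c => j /hc ->.
  by rewrite (lin0 (tw_linr T1 _ _)) scaler0.
Qed.

(** Stated for a relation so that one induction over states serves twice: for a stable subspace,
    through its diagonal, and for a homomorphism, through its graph. *)
Theorem relation_tw a n w w' : G w w' -> G (tw_Y T1 a n w) (tw_Y T2 a n w').
Proof.
elim/(@fock_ind K): a n w w' => [|c u v IHu IHv||k A _ IH] n w w' Gw.
- by rewrite !(lin0 (tw_linl _ _ _)).
- by rewrite !(tw_linl _ _ _); apply: G_lin; [exact: IHu | exact: IHv].
- rewrite -[fvac K]/(vac_M K) -(ising_vac hS) !tw_vacuum.
  by case: ifP.
- exact: (relation_psi (sv_par_ket hS A) IH (Negz k)).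
Qed.

End LinearRelation.

Lemma ramond_stable W (T : twisted_module S W) (U : set W) : subspace U ->
  (forall r w, U w -> U (ramond T r w)) -> forall a n w, U w -> U (tw_Y T a n w).
Proof.
move=> sU pU a n w Uw; pose G (x y : W) := x = y /\ U x.
suff [] : G (tw_Y T a n w) (tw_Y T a n w) by [].
apply: (@relation_tw W W T T G) => //.
- by split=> //; exact: subspace0.
- by move=> c x y u v [-> hx] [-> hu]; split=> //; exact: subspace_lin.
- by move=> r x y [-> hx]; split=> //; exact: pU.
Qed.

Lemma ramond_hom W1 W2 (T1 : twisted_module S W1) (T2 : twisted_module S W2) (f : W1 -> W2) :
  linear f -> (forall r w, f (ramond T1 r w) = ramond T2 r (f w)) ->
  forall a n w, f (tw_Y T1 a n w) = tw_Y T2 a n (f w).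
Proof.
move=> lf fr a n w; apply: (@relation_tw W1 W2 T1 T2 (fun x y => f x = y)) => //.
- exact: lin0.
- by move=> c x y u v <- <-; rewrite lf.
- by move=> r x y <-.
Qed.

End TwistedModuleTheory.

(** * Restriction of a twisted module to a graded stable subspace *)

Section Restriction.
Context {K : numClosedFieldType} {W : lmodType K} (U : subsp W).

Lemma subsp_val_lin : linear (@subsp_val K W U).
Proof. by []. Qed.

Lemma subsp_val_in (x : subsp_type U) : (U : set W) (subsp_val x).
Proof. by case: x => v /= hv; exact: set_mem. Qed.

Lemma subsp_val_inj : injective (@subsp_val K W U).
Proof. exact: val_inj. Qed.

Definition subsp_elt v (hv : (U : set W) v) : subsp_type U := SubspElt (mem_set hv).

Local Notation M := (fock_M K).
Variables (S : svoa M) (T : twisted_module S W).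
Hypothesis U_tw : forall a n w, (U : set W) w -> (U : set W) (tw_Y T a n w).
Hypothesis U_gr : forall w, (U : set W) w -> exists (s : seq nat) (f : nat -> W),
  (forall i, tw_gr T i (f i) /\ (U : set W) (f i)) /\ w = \sum_(i <- s) f i.

Definition sub_Y a n (x : subsp_type U) : subsp_type U := subsp_elt (U_tw a n (subsp_val_in x)).

Definition sub_gr t : set (subsp_type U) := [set x | tw_gr T t (subsp_val x)].

Lemma sub_gr_sum : direct_sum sub_gr.
Proof.
have [g1 g2 g3] := tw_gr_sum T; split=> [t|x|s f us hf e t ts].
- split=> [|c u v]; rewrite !inE /sub_gr /=; first exact: (subspace0 (g1 t)).
  exact: (subspace_lin _ (g1 t)).
- have [s [f [hf e]]] := U_gr (subsp_val_in x).
  exists s, (fun i => subsp_elt (proj2 (hf i))); split=> [i|]; first exact: (proj1 (hf i)).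
  by apply: subsp_val_inj; rewrite (lin_raddf _ _ _ subsp_val_lin).
apply: subsp_val_inj; apply: (g3 s (fun i => subsp_val (f i)) us) => //.
by rewrite -(lin_raddf _ _ _ subsp_val_lin) e.
Qed.

Lemma sub_fsupp (F : nat -> subsp_type U) : fsupp (fun j => subsp_val (F j)) -> fsupp F.
Proof. by move=> /fsupp_sub; apply=> j h; apply: subsp_val_inj. Qed.

Lemma sub_linl n x : linear (fun a => sub_Y a n x).
Proof. by move=> c a b; apply: subsp_val_inj; exact: tw_linl. Qed.

Lemma sub_linr a n : linear (sub_Y a n).
Proof. by move=> c x y; apply: subsp_val_inj; exact: tw_linr. Qed.

Lemma sub_par i a n x : sv_par S i a -> ~ hcoset i n -> sub_Y a n x = 0.
Proof. by move=> ha hn; apply: subsp_val_inj; exact: tw_par ha hn. Qed.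

Lemma sub_trunc a x : exists n0 : rat, forall n, n0 <= n -> sub_Y a n x = 0.
Proof.
have [n0 h] := tw_trunc T a (subsp_val x); exists n0 => n hn.
by apply: subsp_val_inj; exact: h.
Qed.

Lemma sub_vacuum n x : sub_Y (sv_vac S) n x = if n == -1 then x else 0.
Proof. by apply: subsp_val_inj; rewrite /= tw_vacuum; case: ifP. Qed.

Lemma sub_gr_Y d a n t x : weight_space S d a -> sub_gr t x ->
  graded_piece sub_gr (t%:R + d - n - 1) (sub_Y a n x).
Proof.
move=> ha hx; have [e|[t' e h]] := tw_gr_Y n ha hx; last by right; exists t'.
by left; exact: subsp_val_inj.
Qed.

Lemma sub_jacobi i1 i2 a b x (l : int) (m n : rat) :
  sv_par S i1 a -> sv_par S i2 b -> hcoset i1 m -> hcoset i2 n ->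
  \sum_(j \in [set: nat])
    ((-1) ^+ j * gbinom l%:~R j
       *: sub_Y a (l%:~R + m - j%:R) (sub_Y b (n + j%:R) x))
  - (-1) ^+ (i1 && i2) *: \sum_(j \in [set: nat])
    ((-1) ^ (l + j%:Z) * gbinom l%:~R j
       *: sub_Y b (l%:~R + n - j%:R) (sub_Y a (m + j%:R) x))
  = \sum_(j \in [set: nat])
    (gbinom (ratr m) j *: sub_Y (sv_Y S a (l + j%:Z) b) (m + n - j%:R) x).
Proof.
move=> ha hb hm hn; have := tw_jacobi T (subsp_val x) l ha hb hm hn.
rewrite -!/(lsum _) => e; apply: subsp_val_inj.
rewrite (linB _ _ subsp_val_lin) (linZ _ _ subsp_val_lin) !(lsum_lin subsp_val_lin) //.
- apply: sub_fsupp; apply: fsuppZ.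
  have [l0 hl] := sv_trunc S a b; exists `|l0 - l|%N => j hj.
  by rewrite /= hl ?(lin0 (tw_linl T _ _)) //; lia.
- apply: sub_fsupp; apply: fsuppZ.
  have [B hB] := trunc_nat m (subsp_val x) (good_tw T a); exists B => j /hB /= ->.
  by rewrite (lin0 (tw_linr T _ _)).
- apply: sub_fsupp; apply: fsuppZ.
  have [B hB] := trunc_nat n (subsp_val x) (good_tw T b); exists B => j /hB /= ->.
  by rewrite (lin0 (tw_linr T _ _)).
Qed.

Definition sub_module : twisted_module S (subsp_type U) :=
  @TwistedModule K M S (subsp_type U) sub_gr sub_Y sub_gr_sum sub_linl sub_linr sub_par
    sub_trunc sub_vacuum sub_gr_Y sub_jacobi.

Lemma sub_module_restriction : is_restriction sub_module T.
Proof. by []. Qed.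

End Restriction.

(** * Irreducibility of the two halves of N *)

Section IrreducibleRamond.
Context {K : numClosedFieldType}.
Local Notation M := (fock_M K).
Local Notation N := (fock_N K).
Implicit Types (u w : N) (U : set N) (r n k : int).

Lemma proj_hom e t w : homN e w -> wt_proj t w = w \/ wt_proj t w = 0.
Proof.
move=> hw; have [te|te] := eqVneq t%:R e; [left|right]; apply: fvalP => T; rewrite fdiag;
  have [->|wT] := eqVneq (fval w T) 0; rewrite ?mulr0 //.
  by rewrite -(eqr_nat rat) te (hw T wT) eqxx mul1r.
by rewrite -(eqr_nat rat) (hw T wT) eq_sym (negbTE te) mul0r.
Qed.

(** Each phi_r is homogeneous, so it maps homogeneous components to homogeneous components. Applied
    to L16, this shows that L16 is a graded subspace. *)
Lemma graded_phi_stable U : phi_stable U -> phi_stable [set w | U w /\ forall t, U (wt_proj t w)].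
Proof.
move=> [sU pU]; split.
  split=> [|c u v]; rewrite !inE /=.
    by split=> [|t]; rewrite ?/wt_proj ?(lin0 (diag_linear _)); exact: (subspace0 sU).
  move=> [a b] [c' d]; split=> [|t]; first exact: subspace_lin.
  by rewrite /wt_proj diag_linear; exact: (subspace_lin _ sU (b t) (d t)).
move=> r w /= [Uw Uw']; split=> [|t]; first exact: pU.
have [B {1}->] := sum_proj w.
rewrite (lin_raddf _ _ _ (phi_lin r)) /wt_proj (lin_raddf _ _ _ (diag_linear _)) -/(wt_proj t).
apply: (subspace_sum _ sU) => t' _.
have [->|->] := proj_hom t (homN_phi (r := r) (@homN_proj K t' w)); last exact: subspace0 sU.
exact: pU.
Qed.

(** The companion of phi_0 built from the same pair [cre 0], [ann 0]. It anticommutes with every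
    phi_r, phi_0 included, so its composition with the parity commutes with all of them. *)
Definition phi0' u : N := cre 0 u - 2^-1 *: ann 0 u.

Lemma phi0'_anticomm r u : phi0' (phi r u) = - phi r (phi0' u).
Proof.
apply/eqP; rewrite -addr_eq0 /phi0' /phi.
case: r => [[|k]|k]; rewrite ?(linB _ _ (cre_linear _)) ?(linB _ _ (ann_linear _)) ?(linD _ _ (cre_linear _))
  ?(linD _ _ (ann_linear _)) ?(linZ _ _ (cre_linear _)) ?(linZ _ _ (ann_linear _)).
- rewrite !cre_sq !ann_sq !scaler0 !add0r addr0 subr0.
  by rewrite addrACA subrr add0r addNr.
- rewrite addrACA -opprD -scalerDr ann_anticomm scaler0 subr0 addrC ann_cre_anticomm.
  by rewrite scale0r.
- rewrite addrACA -opprD -scalerDr cre_anticomm ann_cre_anticomm.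
  by rewrite scale0r scaler0 subr0.
Qed.

(* Its eigenspaces are the two summands of N. *)
Definition chir u : N := par (phi0' u).

Lemma phi0'_linear : linear phi0'.
Proof.
move=> c u v; rewrite /phi0' cre_linear ann_linear !scalerDr opprD addrACA.
by rewrite scalerN !scalerA [2^-1 * c]mulrC.
Qed.

Lemma chir_linear : linear chir.
Proof. by move=> c u v; rewrite /chir phi0'_linear par_linear. Qed.

Lemma chir_phi r u : chir (phi r u) = phi r (chir u).
Proof. by rewrite /chir phi0'_anticomm (linN _ par_linear) -parity_phi. Qed.

Lemma chir_vac : chir (vac_N K) = - phi 0 (vac_N K).
Proof.
rewrite phi0_vac /chir /phi0' /vac_N ann_vac scaler0 subr0.
have := @phi0_vac K; rewrite phi0E /vac_N ann_vac scaler0 addr0 => ->.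
by rewrite par_ket cardfs1 expr1 scaleN1r.
Qed.

Lemma ann_phi0_vac (k : nat) : ann k.+1 (phi 0 (vac_N K)) = 0.
Proof.
by rewrite phi0_vac ann_ket // in_fset1.
Qed.

Section Chirality.
Variable s : K.
Hypothesis s2 : s ^+ 2 = 1.

Let e2 := eigen_sq s2.

Lemma chir_stable : phi_stable [set w | chir w = - (s / sqrtC 2) *: w].
Proof.
split.
  split=> [|c u v]; rewrite !inE /=; first by rewrite (lin0 chir_linear) scaler0.
  by move=> hu hv; rewrite chir_linear hu hv scalerDr !scalerA mulrC.
by move=> r w /= hw; rewrite chir_phi hw (linZ _ _ (phi_lin _)).
Qed.

Lemma chir_L16 w : (L16 s : set N) w -> chir w = - (s / sqrtC 2) *: w.
Proof.
move: w; apply: (L16_sub chir_stable) => /=.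
rewrite /v16 (linD _ _ chir_linear) (linZ _ _ chir_linear) chir_phi chir_vac.
rewrite (linN _ (phi_lin _)) phi0_sq scalerDr scalerA mulNr -expr2 e2.
by rewrite scalerN scaleNr scaleNr addrC.
Qed.

(** The eigenvalue of [chir] on L16 cuts the two-dimensional space of vacuum vectors of N down to
    the line of v16. *)
Lemma L16_vacuum w : (L16 s : set N) w -> (forall k : nat, ann k.+1 w = 0) -> exists b, w = b *: v16 s.
Proof.
move=> Lw /vacuum_vector; set a := fval w fset0; set b := fval w _ => e; exists b.
have := chir_L16 Lw; rewrite e (linD _ _ chir_linear) !(linZ _ _ chir_linear) chir_phi chir_vac.
rewrite (linN _ (phi_lin _)) phi0_sq phi0_vac => /(congr1 (fun u : N => fval u [fset 0%N]%fset)).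
rewrite !(fvalD, fvalZ, fvalN) /vac_N /fvac !fval_ket eqxx.
rewrite (_ : (_ == fset0) = false); last by apply/negbTE/eqP => /fsetP/(_ 0%N); rewrite !inE.
rewrite !mulr0 !mulr1 oppr0 mulr0 addr0 add0r mulrN1 mulNr => /oppr_inj ea.
by rewrite {1}ea /v16 scalerDr phi0_vac scalerA [b * _]mulrC addrC.
Qed.

Lemma v16_neq0 : v16 s != 0.
Proof.
apply/eqP => /(congr1 (fun u : N => fval u [fset 0%N]%fset)).
rewrite /v16 phi0_vac fvalD fvalZ /vac_N /fvac !fval_ket eqxx.
rewrite (_ : (_ == fset0) = false); last by apply/negbTE/eqP => /fsetP/(_ 0%N); rewrite !inE.
by rewrite mulr0 addr0 => /eqP; rewrite fval0 oner_eq0.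
Qed.

End Chirality.

(** Annihilation lowers the number of occupied indices, so repeated annihilation ends in a nonzero
    vector that all [ann k.+1] kill. *)
Lemma vacuum_exists U w : phi_stable U -> U w -> w != 0 ->
  exists w', [/\ U w', w' != 0 & forall k : nat, ann k.+1 w' = 0].
Proof.
move=> [sU pU]; have [c] : exists c, forall T, fval w T != 0 -> (#|` T| < c)%N.
  exists (\max_(T <- fset_set [set T | fval w T != 0]) #|` T|).+1 => T wT.
  rewrite ltnS; apply: (@leq_bigmax_seq _ _ _ (fun T : {fset nat} => #|` T|)) => //.
  by rewrite in_fset_set ?inE //; exact: fval_fin.
elim: c w => [|c IH] w hc Uw w0.
  by case/eqP: w0; apply: fvalP => T; apply/eqP; apply: contraT => /hc.
have [h|h] := pselect (forall k : nat, ann k.+1 w = 0); first by exists w.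
have [k kw] : exists k : nat, ann k.+1 w != 0.
  by apply: contrapT => hk; apply: h => k; apply/eqP; apply: contraT => hk'; case: hk; exists k.
apply: (IH _ _ (pU k.+1%:Z _ Uw)) => // T.
rewrite fann /ann_fun; case: ifPn => kT; first by rewrite eqxx.
by rewrite mulf_eq0 negb_or => /andP[_ /hc]; rewrite cardfsU1 kT.
Qed.

Lemma L16_minimal (s : K) U w : s ^+ 2 = 1 -> phi_stable U -> U w -> w != 0 ->
  (L16 s : set N) w -> U `<=` L16 s -> L16 s `<=` U.
Proof.
move=> s2 pU Uw w0 Lw UL.
have [w' [Uw' w'0 hw']] := vacuum_exists pU Uw w0.
have [b e] := L16_vacuum s2 (UL _ Uw') hw'; apply: (L16_sub pU).
have b0 : b != 0 by apply: contraNneq w'0 => b0; rewrite e b0 scale0r.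
rewrite -[v16 s]scale1r -(mulVf b0) -scalerA -e; exact: (subspaceZ _ (proj1 pU)).
Qed.

Variables (S : svoa M) (hS : ising_svoa S).
Variable s : K.
Hypothesis s2 : s ^+ 2 = 1.
Local Notation L := (L16 s).

Lemma ramond_TN r w : ramond (TN hS) r w = phi r w.
Proof. exact: Yn_psi_state. Qed.

Lemma L16_tw a (n : rat) w : (L : set N) w -> (L : set N) (tw_Y (TN hS) a n w).
Proof.
have [sL pL] := L16_phi_stable s2 hS.
by apply: (ramond_stable hS sL) => r u; rewrite ramond_TN; exact: pL.
Qed.

Lemma L16_gr w : (L : set N) w -> exists (c : seq nat) (f : nat -> N),
  (forall i, tw_gr (TN hS) i (f i) /\ (L : set N) (f i)) /\ w = \sum_(i <- c) f i.
Proof.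
have pL := L16_phi_stable s2 hS.
move=> Lw; have := L16_sub (graded_phi_stable pL) _ Lw; case=> [|_ h].
  split=> [|t]; first exact: L16_v16.
  have h0 : homN 0 (v16 s).
    apply: (subspaceD (homN_subspace 0)); last exact/(subspaceZ _ (homN_subspace 0))/homN_vac.
    by have := homN_phi (r := 0) homN_vac; rewrite subr0.
  have [->|->] := proj_hom t h0; [exact: L16_v16 | exact: (subspace0 (proj1 pL))].
have [B e] := sum_proj w; exists (iota 0 B), (fun t => wt_proj t w); split=> // t.
by split; [exact: homN_proj | exact: h].
Qed.

Definition TL : twisted_module S (subsp_type L) := sub_module L16_tw L16_gr.

Lemma ramond_TL r (x : subsp_type L) : subsp_val (ramond TL r x) = phi r (subsp_val x).
Proof. exact: (Yn_psi_state r (subsp_val x)). Qed.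

Lemma TL_irreducible : irreducible TL.
Proof.
split.
  exists (subsp_elt (@L16_v16 K s)); apply/eqP => /(congr1 (@subsp_val K N L)).
  by apply/eqP; exact: v16_neq0.
move=> X sX cX; have [h|h] := pselect (forall x, X x -> x = 0).
  left; apply/seteqP; split=> x /=; first exact: h.
  by move=> ->; exact: (subspace0 sX).
right; have [x Xx x0] : exists2 x, X x & x != 0.
  apply: contrapT => hx; apply: h => x Xx; apply/eqP; apply: contraT => x0.
  by case: hx; exists x.
pose U : set N := [set w | exists2 y, X y & w = subsp_val y].
have pU : phi_stable U.
  split.
    split=> [|c u v]; rewrite !inE /=; first by exists 0; first exact: (subspace0 sX).
    move=> [y Xy ->] [z Xz ->]; exists (c *: y + z) => //.
    exact: (subspace_lin _ sX).
  move=> r w [y Xy ->]; exists (ramond TL r y); last by rewrite ramond_TL.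
  exact: cX.
have sub : L `<=` U.
  apply: (L16_minimal (w := subsp_val x) s2 pU).
  - by exists x.
  - by apply: contraNneq x0 => e; apply/eqP; exact: subsp_val_inj.
  - exact: subsp_val_in.
  - by move=> _ [y _ ->]; exact: subsp_val_in.
apply/seteqP; split=> // y _; have [z Xz e] := sub _ (subsp_val_in y).
by rewrite (subsp_val_inj e).
Qed.

End IrreducibleRamond.

(** * Classification *)

Section Classification.
Context {K : numClosedFieldType}.
Local Notation M := (fock_M K).
Local Notation N := (fock_N K).
Variables (S : svoa M) (hS : ising_svoa S).

Lemma linear_map (V V' : lmodType K) (f : V -> V') : linear f ->
  exists g : {linear V -> V'}, g =1 f.
Proof.
move=> lf; pose g : {linear V -> V'} := HB.pack f (GRing.isLinear.Build K V V' *:%R f lf).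
by exists g.
Qed.

(** The universal property gives a map towards the given module, whereas the classification asks for
    one out of it. *)
Lemma isomorphic_inverse (W1 W2 : lmodType K) (T1 : twisted_module S W1) (T2 : twisted_module S W2)
    (f : W1 -> W2) : linear f -> injective f -> (forall y, exists x, f x = y) ->
  (forall r w, f (ramond T1 r w) = ramond T2 r (f w)) -> isomorphic T2 T1.
Proof.
move=> lf fI /choice[g fg] fr; have gf : cancel f g by move=> x; apply: fI; rewrite fg.
have lg : linear g by move=> c u v; apply: fI; rewrite lf !fg.
have [h hg] := linear_map lg; exists h; split.
  by exists f => x; rewrite ?hg ?gf ?fg.
by move=> a n w; rewrite !hg; apply: fI; rewrite fg (ramond_hom hS lf fr) fg.
Qed.

Section NonIsomorphic.
Variables (s s' : K) (s2 : s ^+ 2 = 1) (s2' : s' ^+ 2 = 1).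

(** An isomorphism sends v16 to a nonzero vacuum vector, hence to a multiple of the other v16, and
    it preserves the phi_0-eigenvalue s / sqrt 2. *)
Lemma TL_isomorphic : isomorphic (TL hS s2) (TL hS s2') -> s = s'.
Proof.
move=> [f [[g fK _] hf]]; pose v := subsp_elt (@L16_v16 K s).
have fr r x : f (ramond (TL hS s2) r x) = ramond (TL hS s2') r (f x) by exact: hf.
have v0 : ramond (TL hS s2) 0 v = (s / sqrtC 2) *: v.
  by apply: subsp_val_inj; rewrite ramond_TL; exact: phi0_v16.
have fv : subsp_val (f v) != 0.
  apply/eqP => h; have e : f v = 0 by exact: subsp_val_inj.
  have : v = 0 by rewrite -[v]fK e -[RHS]fK linear0.
  by move=> /(congr1 (@subsp_val _ _ _)) /eqP; apply/negP; exact: v16_neq0.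
have vac (k : nat) : ann k.+1 (subsp_val (f v)) = 0.
  rewrite -[ann k.+1 _]/(phi k.+1%:Z (subsp_val (f v))) -(ramond_TL hS s2') -fr.
  have -> : ramond (TL hS s2) k.+1%:Z v = 0; last by rewrite linear0.
  apply: subsp_val_inj; rewrite ramond_TL /= /v16 (linD _ _ (phi_lin _)) (linZ _ _ (phi_lin _)).
  rewrite -![phi k.+1%:Z _]/(ann k.+1 _) ann_phi0_vac /vac_N ann_vac scaler0 addr0.
  by [].
have [b e] := L16_vacuum s2' (subsp_val_in (f v)) vac.
have e1 : phi 0 (subsp_val (f v)) = (s' / sqrtC 2) *: subsp_val (f v).
  by rewrite e (linZ _ _ (phi_lin _)) phi0_v16 // !scalerA mulrC.
have : (s / sqrtC 2 - s' / sqrtC 2) *: subsp_val (f v) = 0.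
  rewrite scalerBl -e1 -(ramond_TL hS s2') -fr v0 linearZ /=.
  by rewrite subrr.
move/eqP; rewrite scaler_eq0 (negbTE fv) orbF -mulrBl mulf_eq0 invr_eq0.
by rewrite (negbTE (sqrt2_neq0 (K := K))) orbF subr_eq0 => /eqP.
Qed.

End NonIsomorphic.

Variables (W : lmodType K) (T : twisted_module S W).
Implicit Types (x y : W) (r : int).
Local Notation phiT := (ramond T).

Lemma ramond_vacuum_exists : (exists x, x != 0) ->
  exists2 x, x != 0 & forall r, 0 < r -> phiT r x = 0.
Proof.
have [_ g2 _] := tw_gr_sum T.
move=> [w0 w0_neq0]; have [t [x x0 hx]] : exists t, exists2 x, x != 0 & tw_gr T t x.
  apply: contrapT => h; case/eqP: w0_neq0; have [c [f [hf ->]]] := g2 w0.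
  apply: big1 => i _; apply/eqP; apply: contraT => fi; case: h; exists i.
  by exists (f i) => //; exact: hf.
elim/ltn_ind: t x x0 hx => t IH x x0 hx.
have [h|h] := pselect (forall r, 0 < r -> phiT r x = 0); first by exists x.
have [r r0 rx] : exists2 r, 0 < r & phiT r x != 0.
  apply: contrapT => h'; apply: h => r r0; apply/eqP; apply: contraT => rx.
  by case: h'; exists r.
have [e|[t' e hx']] := ramond_gr hS r hx; first by rewrite e eqxx in rx.
apply: (IH t' _ _ rx hx'); have : t%:Z - r = t'%:Z.
  by apply/eqP; rewrite -(eqr_int rat) intrB e.
by lia.
Qed.

Lemma ramond0_sq x : phiT 0 (phiT 0 x) = 2^-1 *: x.
Proof.
have two0 : 2 != 0 :> K by rewrite pnatr_eq0.
apply: (scalerI two0); rewrite scalerA mulfV // scaler_nat mulr2n.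
by rewrite ramond_anticomm.
Qed.

Lemma ramond_eigenvector : (exists x, x != 0) -> exists s x,
  [/\ s = 1 \/ s = -1, x != 0, forall r, 0 < r -> phiT r x = 0 & phiT 0 x = (s / sqrtC 2) *: x].
Proof.
move=> /ramond_vacuum_exists[x x0 hx].
pose y (s : K) := phiT 0 x + (s / sqrtC 2) *: x.
have yr s r : 0 < r -> phiT r (y s) = 0.
  move=> r0; rewrite (linD _ _ (ramond_lin T r)) (linZ _ _ (ramond_lin T r)) (hx r r0) scaler0 addr0.
  have := ramond_anticomm hS T r 0 x; rewrite (hx r r0) (lin0 (ramond_lin T 0)) addr0 => ->.
  by rewrite addr0 gt_eqF // scale0r.
have y0 s : s ^+ 2 = 1 -> phiT 0 (y s) = (s / sqrtC 2) *: y s.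
  move=> s2; rewrite (linD _ _ (ramond_lin T 0)) (linZ _ _ (ramond_lin T 0)) ramond0_sq.
  by rewrite scalerDr scalerA -expr2 eigen_sq // addrC.
(* y 1 - y (-1) is a nonzero multiple of x, so the two candidates are not both zero. *)
have [y1|y1] := eqVneq (y 1) 0; last first.
  by exists 1, (y 1); split; [left | | exact: yr | apply: y0; rewrite expr1n].
exists (-1), (y (-1)); split; [by right | | exact: yr | by apply: y0; rewrite sqrrN expr1n].
apply: contra_neq x0 => ym; have : y 1 - y (-1) = 0 by rewrite y1 ym subrr.
rewrite /y opprD addrACA subrr add0r -scalerBl => /eqP; rewrite scaler_eq0 => /orP[|/eqP //].
rewrite -mulrBl mulf_eq0 invr_eq0 (negbTE (sqrt2_neq0 (K := K))) orbF opprK.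
by rewrite -mulr2n pnatr_eq0.
Qed.

Section UniversalMap.
Variable x0 : W.
Hypothesis x0_vac : forall r, 0 < r -> phiT r x0 = 0.

Let C (k : nat) := if k is k'.+1 then phiT (Negz k') else phiT 0.
(** Matches phi_0 = [cre 0] + 1/2 [ann 0]: index 0 carries an operator of square 1/2, all other C k
    square to zero. *)
Let q (k : nat) : K := if k is _.+1 then 0 else 2^-1.

Let U : set W := setT.

Let C_lin k c x y : U x -> U y -> C k (c *: x + y) = c *: C k x + C k y.
Proof. by move=> _ _; case: k => [|k]; exact: ramond_lin. Qed.

Let CC i j x : i != j -> U x -> C i (C j x) + C j (C i x) = 0.
Proof.
move=> ij _; case: i j ij => [|i] [|j] //= ij; rewrite ramond_anticomm //;
  by rewrite (_ : _ == 0 = false) ?scale0r //; apply/eqP; lia.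
Qed.

Let Csq i x : U x -> C i (C i x) = q i *: x.
Proof.
move=> _; case: i => [|i] /=; first exact: ramond0_sq.
have two0 : 2 != 0 :> K by rewrite pnatr_eq0.
apply: (scalerI two0); rewrite scale0r scaler0 scaler_nat mulr2n ramond_anticomm //.
by rewrite (_ : _ == 0 = false) ?scale0r //; apply/eqP; lia.
Qed.

Let U_sub : subspace U.
Proof. by split=> [|c u v]; rewrite !inE. Qed.

Definition ramond_map : N -> W := induced C x0.

Lemma ramond_map_linear : linear ramond_map.
Proof. exact: (induced_linear C). Qed.

Lemma ramond_map_vac : ramond_map (vac_N K) = x0.
Proof. exact: induced_vac. Qed.

Lemma ramond_map_phi r u : ramond_map (phi r u) = phiT r (ramond_map u).
Proof.
have UC k x : U x -> U (C k x) by [].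
case: r => [[|k]|k].
- exact: (induced_cre (q := q) U_sub I UC C_lin CC Csq 0).
- apply: (induced_ann U_sub I UC C_lin (k := k.+1)) => //.
  + by move=> c x y _ _; exact: ramond_lin.
  + exact: x0_vac.
  + move=> j x _; case: j => [|j] /=; rewrite ramond_anticomm //;
    by congr (_%:R *: _); apply/eqP/eqP; lia.
- have := induced_cre (w0 := x0) (q := q) U_sub I UC C_lin CC Csq k.+1 u.
  by rewrite [q _]/= scale0r addr0; apply.
Qed.

End UniversalMap.

Lemma classification : irreducible T -> exists s, (s = 1 \/ s = -1) /\
  forall s2 : s ^+ 2 = 1, isomorphic T (TL hS s2).
Proof.
move=> [ne irr]; have [s [x0 [s1 x0_neq0 x0_vac phi0_x0]]] := ramond_eigenvector ne.
exists s; split=> // s2; pose f (v : subsp_type (L16 s)) := ramond_map x0 (subsp_val v).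
have lf : linear f by move=> c u v; exact: ramond_map_linear.
have fr r v : f (ramond (TL hS s2) r v) = phiT r (f v).
  by rewrite /f ramond_TL (ramond_map_phi x0_vac).
have fv0 : f (subsp_elt (@L16_v16 K s)) != 0.
  (* The image of v16 is phi_0 x0 + (s / sqrt 2) x0 = 2 (s / sqrt 2) x0, which is nonzero because s
     is the sign of the eigenvalue of x0; the opposite sign would give 0. *)
  rewrite /f /= /v16 (linD _ _ (ramond_map_linear x0)) (linZ _ _ (ramond_map_linear x0)).
  rewrite (ramond_map_phi x0_vac) ramond_map_vac phi0_x0 -scalerDl scaler_eq0 (negbTE x0_neq0) orbF.
  rewrite -mulr2n mulrn_eq0 /= mulf_eq0 invr_eq0 (negbTE (sqrt2_neq0 (K := K))) orbF.
  by case: s1 => ->; rewrite ?oppr_eq0 oner_eq0.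
apply: (isomorphic_inverse (f := f) lf _ _ fr).
  have [_ /(_ [set v | f v = 0]) h] := TL_irreducible hS s2.
  have [|a n v /= hv|k0 u v e|kT] := h.
  - split=> [|c u v]; rewrite !inE /=; first by rewrite (lin0 lf).
    by move=> hu hv; rewrite lf hu hv scaler0 addr0.
  - by rewrite (ramond_hom hS lf fr) hv (lin0 (tw_linr _ _ _)).
  - apply/eqP; rewrite -subr_eq0; apply/eqP.
    have : [set v | f v = 0] (u - v) by rewrite /= (linB _ _ lf) e subrr.
    by rewrite k0.
  - have : [set v | f v = 0] (subsp_elt (@L16_v16 K s)) by rewrite kT.
    by move=> /= /eqP; rewrite (negbTE fv0).
move=> y; have [] := irr [set y | exists v, f v = y].
- split; [by rewrite inE; exists 0; rewrite (lin0 lf) | move=> c y1 y2; rewrite !inE /=].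
  by move=> [u <-] [v <-]; exists (c *: u + v); rewrite lf.
- move=> a n _ [v <-]; exists (tw_Y (TL hS s2) a n v).
  exact: (ramond_hom hS lf fr).
- move=> h; have : [set y | exists v, f v = y] (f (subsp_elt (@L16_v16 K s))) by eexists.
  by rewrite h /= => /eqP; rewrite (negbTE fv0).
- by move=> h; have : [set y | exists v, f v = y] y by rewrite h.
Qed.

End Classification.

Theorem theorem4p9 (R : realType) (S : svoa (fock_M R[i])) (hS : ising_svoa S) :
  exists TN : twisted_module S (fock_N R[i]),
    (forall (n : int) (w : fock_N R[i]),
        tw_Y TN (psi_state R[i]) (n%:~R - 1 / 2) w = phi n w) /\
    exists (Tp : twisted_module S (subsp_type (L16 (1 : R[i]))))
           (Tm : twisted_module S (subsp_type (L16 (- 1 : R[i])))),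
      [/\ is_restriction Tp TN /\ is_restriction Tm TN,
          irreducible Tp /\ irreducible Tm,
          ~ isomorphic Tp Tm &
          forall (W : lmodType R[i]) (T : twisted_module S W),
            irreducible T -> isomorphic T Tp \/ isomorphic T Tm].
Proof.
have sp : (1 : R[i]) ^+ 2 = 1 by rewrite expr1n.
have sm : (- 1 : R[i]) ^+ 2 = 1 by rewrite sqrrN expr1n.
exists (TN hS); split; first exact: Yn_psi_state.
exists (TL hS sp), (TL hS sm); split.
- by split; exact: sub_module_restriction.
- by split; exact: TL_irreducible.
- move=> /TL_isomorphic /eqP; rewrite -subr_eq0 opprK -mulr2n pnatr_eq0.
  by [].
- move=> W T /(classification hS)[s [[es|es] h]]; [left|right]; move: h; rewrite es.
    exact.
  exact.
Qed.
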